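(* Let $(X,\mathcal{B},\mu)$ be a standard Borel probability space without atoms, and let $\Lambda$ be an (at most countable) treeing on $X$ such that the equivalence relation $\mathcal{R}_{\Lambda}$ is ergodic. For $n\geq 1$ and $i\in\{1,\dots,n\}$ let $g_i\in\Lambda$, with $g_i:A_i\to B_i$, let $f_i\in L^{\infty}(X)$, and let $$T=\sum_{i=1}^n M_{f_i}L_{g_i}\in\mathcal{M}(\mathcal{R}_{\Lambda}).$$ Assume that there is an index $i_0\in\{1,\dots,n\}$ such that $$\sum_{i\neq i_0}\|f_i/f_{i_0}\|_{\infty}<1,$$ that $f_{i_0}$ is non-vanishing on sets of positive measure (i.e. $\mu(\{x: f_{i_0}(x)=0\})=0$), and that $g_{i_0}:A_{i_0}=X\to B_{i_0}=X$. Then the Fuglede-Kadison determinant of $T$ satisfies $$\log\Delta(T)=\int_X\log|f_{i_0}(x)|\,d\mu(x).$$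
   Context: Let $(X,\mathcal{B},\mu)$ be a standard Borel probability space without atoms. Generated relation: let $\Lambda=\{g_i:A_i\to B_i \mid i\in I\}$ be an at most countable family of measure preserving Borel bijections between measurable subsets of $X$. A word $\omega=g_{i_1}^{\varepsilon_1}\cdots g_{i_k}^{\varepsilon_k}$, $\varepsilon_t=\pm1$, denotes the composition of partial maps (rightmost applied first) on its maximal domain $Dom(\omega)$. $\mathcal{R}_{\Lambda}\subset X\times X$ is the equivalence relation with $(x,y)\in\mathcal{R}_\Lambda$ (written $x\sim y$) iff $x=y$ or there is a word $\omega$ with $x\in Dom(\omega)$ and $\omega x=y$. Treeing: a word $g_{i_1}^{\varepsilon_1}\cdots g_{i_k}^{\varepsilon_k}$ is reduced if $g_{i_t}=g_{i_{t+1}}$ implies $\varepsilon_t=\varepsilon_{t+1}$. $\Lambda$ is a treeing if $\mu\{x\in Dom(\omega): \omega(x)=x\}=0$ for every nontrivial (i.e. $k\geq1$) reduced word $\omega$. Ergodicity: $\mathcal{R}$ is ergodic if every measurable set $A$ equal to its saturation $\{y\in X: y\sim x \text{ for some } x\in A\}$ has $\mu(A)\in\{0,1\}$. Feldman-Moore algebra: for $\mathcal{R}=\mathcal{R}_\Lambda$, $L^2(\mathcal{R})$ is the Hilbert space of (classes of) measurable $\Psi:\mathcal{R}\to\mathbb{C}$ with finite norm for the inner product $\langle\Psi,\Phi\rangle=\int_X\sum_{z\sim x}\Psi(x,z)\overline{\Phi(x,z)}\,d\mu(x)$. For a word $\omega$ (in particular for $\omega=g\in\Lambda$) and $f\in L^\infty(X)$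 define operators on $L^2(\mathcal{R})$ by $$(L_\omega\Psi)(x,y)=\chi_{D_\omega}(x)\Psi(\omega^{-1}x,y),\qquad (M_f\Psi)(x,y)=f(x)\Psi(x,y),$$ where $D_\omega$ is the domain of $\omega^{-1}$ (the first expression is read as $0$ when $x\notin D_\omega$). $\mathcal{M}(\mathcal{R})$ is the von Neumann algebra given by the weak closure of the linear span of all products of the operators $L_g$, $L_{g^{-1}}$ ($g\in\Lambda$) and $M_f$ ($f\in L^\infty(X)$). Its trace is $\tau(T)=\langle T\delta_0,\delta_0\rangle$, where $\delta_0$ is the characteristic function of the diagonal of $\mathcal{R}$; it is a faithful normal tracial state. Fuglede-Kadison determinant: for $T\in\mathcal{M}(\mathcal{R})$ let $|T|=\sqrt{T^*T}$, let $E$ be the spectral measure of $|T|$ and $\mu_{|T|}=\tau\circ E$. Then $\Delta(T)=\exp\left(\int_0^\infty\log t\,d\mu_{|T|}(t)\right)$, with $\log 0=-\infty$ and $\exp(-\infty)=0$, so $\log\Delta(T)\in[-\infty,\infty)$.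
   Formalization: The elements g_1,…,g_n of Λ are taken to be pairwise distinct; with repetitions the claim fails, e.g. g_1=g_2=g, f_1=1, f_2=1/2 gives T=(3/2)L_g with log Δ(T)=log(3/2), not 0. *)

(* Defs.v *)
From HB Require Import structures.
From mathcomp Require Import all_boot all_order all_algebra.
From mathcomp Require Import all_classical all_reals all_analysis.
From mathcomp Require Import complex.

Set Implicit Arguments.
Unset Strict Implicit.
Unset Printing Implicit Defensive.

Import Order.TTheory GRing.Theory Num.Theory.
Import numFieldNormedType.Exports.

Local Open Scope classical_set_scope.
Local Open Scope ring_scope.
Local Open Scope complex_scope.

Section MeasureSpaces.
Context {R : realType} {d : measure_display} {X : measurableType d}.

(* A Borel isomorphism onto a Polish space, i.e. a separable completely
   metrizable one; for pseudometric spaces separability is the same as second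
   countability. *)
Definition standard_borel : Prop :=
  exists Y : completePseudoMetricType R,
    [/\ hausdorff_space Y, second_countable (T := Y) &
        exists2 h : X -> Y, bijective h &
          forall A : set X, measurable A <-> <<s @open Y >> (h @` A)].

Definition atomless (mu : {measure set X -> \bar R}) : Prop :=
  forall A, measurable A -> (0 < mu A)%E ->
    exists B, [/\ measurable B, B `<=` A & (0 < mu B < mu A)%E].

Definition cmeasurable_fun (D : set X) (f : X -> R[i]) : Prop :=
  measurable_fun D (fun x => complex.Re (f x)) /\
  measurable_fun D (fun x => complex.Im (f x)).

Definition Linfty_norm (mu : {measure set X -> \bar R}) (f : X -> R[i]) :
    \bar R :=
  Lnorm mu +oo (fun x => (Normc.normc (f x))%:E).

Definition Linfty (mu : {measure set X -> \bar R}) : set (X -> R[i]) :=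
  [set f | cmeasurable_fun setT f /\ (Linfty_norm mu f < +oo)%E].

End MeasureSpaces.
Arguments standard_borel R {d} X.

(* A measure preserving Borel bijection pdom -> prng with its inverse; the values
   of pfun off pdom and of pinv off prng are irrelevant. *)
Record partial_iso (R : realType) (d : measure_display) (X : measurableType d)
    (mu : {measure set X -> \bar R}) := PartialIso {
  pdom : set X;
  prng : set X;
  pfun : X -> X;
  pinv : X -> X;
  pdom_measurable : measurable pdom;
  prng_measurable : measurable prng;
  pfun_prng : forall x, pdom x -> prng (pfun x);
  pinv_pdom : forall y, prng y -> pdom (pinv y);
  pfunK : forall x, pdom x -> pinv (pfun x) = x;
  pinvK : forall y, prng y -> pfun (pinv y) = y;
  pfun_measurable : measurable_fun pdom pfun;
  pinv_measurable : measurable_fun prng pinv;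
  pfun_preserves : forall C, measurable C -> C `<=` pdom -> mu (pfun @` C) = mu C
}.

Section GeneratedRelation.
Context {R : realType} {d : measure_display} {X : measurableType d}.
Context {mu : {measure set X -> \bar R}}.
Context {I : countType} (Lam : I -> partial_iso mu).

(* (i, true) stands for g_i and (i, false) for g_i^-1. *)
Definition word := seq (I * bool).

Definition letter_act (l : I * bool) (x : X) : option X :=
  let g := Lam l.1 in
  if l.2 then (if x \in pdom g then Some (pfun g x) else None)
  else (if x \in prng g then Some (pinv g x) else None).

(* [word_act w x = Some y] means that x lies in the maximal domain of w, the
   rightmost letter being applied first, and is sent to y. *)
Definition word_act (w : word) (x : X) : option X :=
  foldr (fun l => obind (letter_act l)) (Some x) w.

Definition word_inv (w : word) : word := rev [seq (l.1, ~~ l.2) | l <- w].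

Definition reduced (w : word) : bool :=
  sorted (fun l l' : I * bool => (l.1 == l'.1) ==> (l.2 == l'.2)) w.

Definition gen_rel (x y : X) : Prop :=
  x = y \/ exists w : word, word_act w x = Some y.

Definition treeing : Prop :=
  forall w : word, w != [::] -> reduced w ->
    mu [set x | word_act w x = Some x] = 0%E.

Definition saturation (A : set X) : set X :=
  [set y | exists2 x, A x & gen_rel y x].

Definition ergodic : Prop :=
  forall A, measurable A -> saturation A = A -> mu A = 0%E \/ mu A = 1%E.

(* Functions on the relation are represented by total functions on X * X whose
   values off the relation play no role; operators on L^2 act on
   representatives, and are only compared up to [eqL2]. *)
Local Notation kernel := (X * X -> R[i]).
Local Notation operator := (kernel -> kernel).

Definition rel_set : set (X * X) := [set p | gen_rel p.1 p.2].

Definition rel_class (x : X) : set X := [set z | gen_rel z x].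

Definition normL2sq (Psi : kernel) : \bar R :=
  (\int[mu]_x \esum_(z in rel_class x) ((Normc.normc (Psi (x, z))) ^+ 2)%:E)%E.

Definition L2 : set kernel :=
  [set Psi | cmeasurable_fun rel_set Psi /\ (normL2sq Psi < +oo)%E].

Definition class_sum (x : X) (u : X -> R) : R :=
  fine (\esum_(z in rel_class x) (Num.max (u z) 0)%:E) -
  fine (\esum_(z in rel_class x) (Num.max (- u z) 0)%:E).

Definition inner (Psi Phi : kernel) : R[i] :=
  let h x z := Psi (x, z) * (Phi (x, z))^* in
  (\int[mu]_x class_sum x (fun z => complex.Re (h x z)))%R +i*
  (\int[mu]_x class_sum x (fun z => complex.Im (h x z)))%R.

Definition eqL2 (Psi Phi : kernel) : Prop := normL2sq (Psi \- Phi) = 0%E.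

Definition eqop_L2 (A B : operator) : Prop :=
  forall Psi, L2 Psi -> eqL2 (A Psi) (B Psi).

(* The last two clauses make A well defined on classes. *)
Definition bounded_op (A : operator) : Prop :=
  [/\ forall Psi, L2 Psi -> L2 (A Psi),
      forall (a : R[i]) Psi Phi, L2 Psi -> L2 Phi ->
        eqL2 (A (a \*o Psi \+ Phi)) (a \*o A Psi \+ A Phi) &
      exists M : R, forall Psi, L2 Psi ->
        (normL2sq (A Psi) <= M%:E * normL2sq Psi)%E].

Definition is_adjoint (A B : operator) : Prop :=
  bounded_op B /\
  forall Psi Phi, L2 Psi -> L2 Phi -> inner (A Psi) Phi = inner Psi (B Phi).

Definition positive_op (A : operator) : Prop :=
  bounded_op A /\ forall Psi, L2 Psi -> 0 <= inner (A Psi) Psi.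

Definition orth_proj (A : operator) : Prop :=
  [/\ bounded_op A, is_adjoint A A & eqop_L2 (A \o A) A].

Definition is_abs_op (T P : operator) : Prop :=
  positive_op P /\ exists2 S, is_adjoint T S & eqop_L2 (P \o P) (S \o T).

(* E is a projection-valued Borel measure on the line, countably additive in
   the weak operator topology, and P is the integral of t against E. *)
Definition spectral_measure (P : operator)
    (E : set (measurableTypeR R) -> operator) : Prop :=
  [/\ forall B, measurable B -> orth_proj (E B),
      eqop_L2 (E setT) id &
      forall Psi, L2 Psi ->
        exists2 m : {measure set (measurableTypeR R) -> \bar R},
          (forall B, measurable B ->
             m B = (complex.Re (inner (E B Psi) Psi))%:E) &
          (\int[m]_t t%:E = (complex.Re (inner (P Psi) Psi))%:E)%E].

Definition delta0 : kernel := fun p => if `[< p.1 = p.2 >] then 1 else 0.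

Definition FM_trace (A : operator) : R[i] := inner (A delta0) delta0.

(* [is_FK_det T D] : D is the Fuglede-Kadison determinant of T. |T| and its
   spectral measure E are pinned down, up to equality of operators on L^2, by
   their defining properties. *)
Definition is_FK_det (T : operator) (D : \bar R) : Prop :=
  exists P E (m : {measure set (measurableTypeR R) -> \bar R}),
    [/\ is_abs_op T P,
        spectral_measure P E,
        forall B, measurable B -> m B = (complex.Re (FM_trace (E B)))%:E &
        D = expeR (\int[m]_(t in `[0%R, +oo[) lne t%:E)%E].

Definition L_op (w : word) : operator := fun Psi p =>
  if word_act (word_inv w) p.1 is Some x then Psi (x, p.2) else 0.

Definition M_op (f : X -> R[i]) : operator := fun Psi p => f p.1 * Psi p.

Definition FM_generator (A : operator) : Prop :=
  (exists l : I * bool, A = L_op [:: l]) \/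
  (exists2 f, Linfty mu f & A = M_op f).

Definition FM_product (A : operator) : Prop :=
  exists k (G : 'I_k -> operator),
    (forall j, FM_generator (G j)) /\
    A = \big[(fun B C => B \o C) / id]_(j < k) G j.

Definition FM_span (A : operator) : Prop :=
  exists k (c : 'I_k -> R[i]) (G : 'I_k -> operator),
    (forall j, FM_product (G j)) /\
    A = fun Psi p => \sum_(j < k) c j * G j Psi p.

(* Closure of the span in the weak operator topology. *)
Definition FM_algebra (A : operator) : Prop :=
  bounded_op A /\
  forall k (Psi Phi : 'I_k -> kernel) (e : R),
    (forall j, L2 (Psi j) /\ L2 (Phi j)) -> 0 < e ->
    exists2 B, FM_span B &
      forall j, Normc.normc (inner (A (Psi j)) (Phi j) - inner (B (Psi j)) (Phi j)) < e.

End GeneratedRelation.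

(* Main.v *)
Require Import Defs.
From HB Require Import structures.
From mathcomp Require Import all_boot all_order all_algebra.
From mathcomp Require Import all_classical all_reals all_analysis.
From mathcomp Require Import measurable_realfun ess_sup_inf complex.
From mathcomp Require Import ring lra.

(** Put [f0 = f_{i0}] and let [L] be the translation by [g_{i0}], a unitary of
    the relation algebra.  Then [T = L m (1 + q)] with [m] a multiplication by
    [f0] composed with [g_{i0}] and [q = \sum_{i <> i0} m_i L^-1 L_{g_i}] of norm
    [rho < 1], so that [T^* T = (1 + q)^* h (1 + q)] with [h = |m|^2].  All words
    occurring in [q^j], j >= 1, are reduced and nontrivial, hence [tau(q^j) = 0]
    because of the treeing.  Along the path
    [A_s = eps + (1 + s q)^* h (1 + s q)], 0 <= s <= 1, the derivative of
    [tau(log A_s)] is, up to terms that vanish with [eps], the real part of twice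
    [tau((1 + s q)^-1 q) = \sum_j (-s)^j tau(q^{j+1}) = 0].  With [log] replaced by
    its Taylor polynomials everything takes place in the *-algebra generated by the
    translations and the multiplications; letting first the degree tend to infinity
    and then [eps] to 0 shows that [log] has the same integral for the distribution
    of [|T|] and for that of [|f0|].  No von Neumann algebra theory is needed: the
    spectral measure of [|T|] only enters through its even moments
    [tau((T^* T)^k)]. *)

Set Implicit Arguments.
Unset Strict Implicit.
Unset Printing Implicit Defensive.

Import Order.TTheory GRing.Theory Num.Theory.
Import numFieldNormedType.Exports.

Local Open Scope classical_set_scope.
Local Open Scope ring_scope.

(** * Perturbation of traces in a tracial *-algebra *)

(** The obstacle is that [h] is positive but need not be bounded away from 0, so neither its inverse
    nor its logarithm is bounded; [eps] repairs this at the price of an error. With [B = 1 + s q]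
    and [w] close to [A_s^-1], [w B^* h B] is close to [1 - eps w], so the derivative differs from a
    vanishing trace by a multiple of [eps tau(B^-1 q w)], and everything rests on [eps |w|_2 -> 0].
    Since [|B| <= 2], [A_s >= B^* (eps/4 + h) B]; with [e = (eps/4 + h)^(-1/2)] this bounds
    [eps |w|_2] by a constant times the square root of [eps tau(e^2)], uniformly in [s] and up to
    geometric errors. That trace is the integral of [eps / (eps/4 + h)], which tends to 0 by
    dominated convergence. Inverses occur only as partial Neumann sums, whose errors are discarded
    in real inequalities. No logarithm is assumed integrable: the limit in [eps] is taken in the
    extended reals, which includes the case of determinant 0. Only real parts of traces enter the
    determinant, so the algebra is taken over the reals. *)

Section RealInequalities.
Context {R : realType}.

(** Source of every Cauchy-Schwarz inequality below. The forms are only semidefinite, so the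
    degenerate case [z = 0] has to be covered. *)
Lemma discriminant_le (x y z : R) :
  (forall r, 0 <= x + (r * y) *+ 2 + r ^+ 2 * z) -> y ^+ 2 <= x * z.
Proof.
move=> H; have x0 : 0 <= x by have := H 0; rewrite !mul0r mul0rn expr0n mul0r !addr0.
have [z0|z0|z0] := ltgtP z 0.
- exfalso.
  (* Large enough for [r ^+ 2 * z] to outweigh the other two terms; the last summand 1 ensures
     [1 <= r]. *)
  pose r := (x + 1 + `|y| *+ 2) / - z + 1.
  have Hr : r * - z = x + 1 + `|y| *+ 2 - z.
    by rewrite /r mulrDl divfK ?oppr_eq0 ?lt_eqF// mul1r.
  have r1 : 1 <= r.
    rewrite /r lerDr; apply: divr_ge0; last by rewrite oppr_ge0 ltW.
    by rewrite addr_ge0 ?mulrn_wge0// addr_ge0.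
  have Hy : y <= `|y| by exact: ler_norm.
  have Hy0 : 0 <= `|y| by [].
  have := H r; nra.
- have := H (- y / z) ; have zz : z * z^-1 = 1 by rewrite divff// gt_eqF.
  set w := z^-1 in zz *; have w0 : 0 < w by rewrite invr_gt0.
  have -> : x + - y * w * y *+ 2 + (- y * w) ^+ 2 * z = x - y ^+ 2 * w * (2 - z * w) by ring.
  rewrite zz => h.
  have {}h : y ^+ 2 * w <= x by lra.
  have := ler_wpM2r (ltW z0) h; rewrite -mulrA (mulrC w) zz mulr1//.
- rewrite z0 mulr0; have [->|y0] := eqVneq y 0; first by rewrite expr0n.
  exfalso; have := H (- (x + 1) / y); rewrite z0 mulr0 addr0 divfK//; lra.
Qed.

Lemma expr_lt_eventually (r e : R) : 0 <= r -> r < 1 -> 0 < e ->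
  exists n, forall m, (n <= m)%N -> r ^+ m < e.
Proof.
move=> r0 r1 e0.
have /cvgrPdist_lt /(_ _ e0) [N _ HN] : (r ^+ n @[n --> \oo] --> (0 : R))%classic.
  by apply: cvg_expr; rewrite ger0_norm.
by exists N => m /HN; rewrite sub0r normrN ger0_norm// exprn_ge0.
Qed.

(** The algebra has no limits, so an inverse is only available as a partial Neumann sum. Each
    estimate is proved with the [m]-th partial sum, and the remainder is discarded here, among real
    numbers. *)
Lemma le_add_geometric (x y c r : R) : 0 <= r -> r < 1 -> 0 <= c ->
  (forall m, x <= y + c * r ^+ m) -> x <= y.
Proof.
move=> r0 r1 c0 H; apply/ler_addgt0Pr => e e0.
have c1 : 0 < c + 1 by rewrite ltr_pwDr.
have [N HN] := expr_lt_eventually r0 r1 (divr_gt0 e0 c1).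
have := HN N (leqnn _); rewrite ltr_pdivlMr// => h.
apply: (le_trans (H N)); rewrite lerD2l.
have : 0 <= r ^+ N by rewrite exprn_ge0.
nra.
Qed.

Lemma poly_diff_le (p : {poly R}) (e : R) :
  (forall s, 0 <= s <= 1 -> `|p^`().[s]| <= e) -> `|p.[1] - p.[0]| <= e.
Proof.
move=> H.
have dp (x : R) : x \in `]0, 1[ -> is_derive x 1 (horner p) p^`().[x].
  by move=> _; exact: is_derive_poly.
have cp : {within `[(0 : R), 1], continuous (horner p)}%classic.
  by apply: continuous_subspaceT; exact: continuous_horner.
have [c c01 ->] := MVT ltr01 dp cp.
rewrite subr0 mulr1; apply: H.
by move: c01; rewrite in_itv/= => /andP[/ltW-> /ltW->].
Qed.

End RealInequalities.

Section TracialAlgebra.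
Context {R : realType} {A : algType R}.
Variables (star : A -> A) (t : A -> R).
Hypothesis starD : forall a b, star (a + b) = star a + star b.
Hypothesis starM : forall a b, star (a * b) = star b * star a.
Hypothesis starZ : forall s a, star (s *: a) = s *: star a.
Hypothesis starK : forall a, star (star a) = a.
Hypothesis tD : forall a b, t (a + b) = t a + t b.
Hypothesis tZ : forall s a, t (s *: a) = s * t a.
Hypothesis tC : forall a b, t (a * b) = t (b * a).
Hypothesis t_star : forall a, t (star a) = t a.
Hypothesis t_ge0 : forall a, 0 <= t (star a * a).
Hypothesis t1 : t 1 = 1.

Let star1 : star 1 = 1.
Proof. by rewrite -[LHS]mul1r -{1}[1]starK -starM mul1r starK. Qed.
Let starN a : star (- a) = - star a.
Proof. by rewrite -scaleN1r starZ scaleN1r. Qed.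
Let tN a : t (- a) = - t a.
Proof. by rewrite -scaleN1r tZ mulN1r. Qed.
Let tB a b : t (a - b) = t a - t b. Proof. by rewrite tD tN. Qed.
Let t0 : t 0 = 0. Proof. by rewrite -(subrr 0) tB subrr. Qed.
Let tMn a n : t (a *+ n) = t a *+ n.
Proof. by elim: n => [|n IH]; rewrite ?mulr0n// !mulrS tD IH. Qed.
Let starX a n : star (a ^+ n) = star a ^+ n.
Proof. by elim: n => [|n IH]; rewrite ?expr0 ?star1// exprS starM IH exprSr. Qed.
Let t_sum (J : Type) (r : seq J) (P : pred J) F :
  t (\sum_(j <- r | P j) F j) = \sum_(j <- r | P j) t (F j).
Proof. exact: (big_morph t tD t0). Qed.
Let star_sum (J : Type) (r : seq J) (P : pred J) F :
  star (\sum_(j <- r | P j) F j) = \sum_(j <- r | P j) star (F j).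
Proof.
apply: (big_morph star starD).
by rewrite -(scale0r 1) starZ star1.
Qed.

(** The GNS form of the trace and its seminorm. [mul_bound a c] bounds left multiplication by [a] in
    this representation and takes the place of a C*-norm. *)
Definition tip (x y : A) : R := t (star y * x).
Definition tnorm (x : A) : R := Num.sqrt (t (star x * x)).
Definition mul_bound (a : A) (c : R) := forall x, tnorm (a * x) <= c * tnorm x.

Lemma tnorm_ge0 x : 0 <= tnorm x. Proof. exact: sqrtr_ge0. Qed.
Lemma tnorm_sqr x : tnorm x ^+ 2 = t (star x * x).
Proof. by rewrite sqr_sqrtr. Qed.
Lemma tnorm1 : tnorm 1 = 1. Proof. by rewrite /tnorm star1 mulr1 t1 sqrtr1. Qed.
Lemma tipC x y : tip x y = tip y x.
Proof. by rewrite /tip -t_star starM starK. Qed.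
Lemma tnorm_star x : tnorm (star x) = tnorm x.
Proof. by rewrite /tnorm starK tC. Qed.

Lemma tip_le x y : `|tip x y| <= tnorm x * tnorm y.
Proof.
rewrite -[leRHS]ger0_norm ?mulr_ge0 ?tnorm_ge0// -ler_sqr ?nnegrE ?normr_ge0//.
rewrite !real_normK ?num_real// exprMn !tnorm_sqr.
apply: discriminant_le => r.
have H := t_ge0 (x + r *: y).
rewrite starD starZ mulrDl !mulrDr !tD -!scalerAl -!scalerAr !tZ in H.
rewrite tipC /tip in H *; have E := tipC x y; rewrite /tip in E; rewrite E in H *.
by apply: le_trans H _; rewrite le_eqVlt; apply/orP; left; apply/eqP; ring.
Qed.

Lemma tnormD x y : tnorm (x + y) <= tnorm x + tnorm y.
Proof.
rewrite -ler_sqr ?nnegrE ?addr_ge0 ?tnorm_ge0//.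
rewrite sqrrD !tnorm_sqr starD mulrDl !mulrDr !tD -!/(tip _ _).
have := tip_le x y; have := ler_norm (tip x y); rewrite (tipC y x); lra.
Qed.

Lemma tnormZ s x : tnorm (s *: x) = `|s| * tnorm x.
Proof.
rewrite /tnorm starZ -scalerAl -scalerAr !tZ mulrA -expr2.
by rewrite sqrtrM ?sqr_ge0// sqrtr_sqr.
Qed.

Lemma t_le x : `|t x| <= tnorm x.
Proof. by have := tip_le x 1; rewrite /tip star1 mul1r tnorm1 mulr1. Qed.

Lemma mul_bound_mul a b c d : 0 <= c -> mul_bound a c -> mul_bound b d ->
  mul_bound (a * b) (c * d).
Proof.
move=> c0 Ha Hb x; rewrite -mulrA -mulrA; apply: le_trans (Ha _) _.
exact: ler_wpM2l.
Qed.
Lemma mul_boundD a b c d : mul_bound a c -> mul_bound b d -> mul_bound (a + b) (c + d).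
Proof.
by move=> Ha Hb x; rewrite !mulrDl; apply: le_trans (tnormD _ _) _; rewrite lerD.
Qed.
Lemma mul_bound1 : mul_bound 1 1. Proof. by move=> x; rewrite !mul1r. Qed.
Lemma mul_boundX a c n : 0 <= c -> mul_bound a c -> mul_bound (a ^+ n) (c ^+ n).
Proof.
move=> c0 Ha; elim: n => [|n IH]; first by rewrite !expr0; exact: mul_bound1.
by rewrite !exprS; apply: mul_bound_mul.
Qed.
Lemma mul_bound_norm a c : mul_bound a c -> tnorm a <= c.
Proof. by move=> /(_ 1); rewrite mulr1 tnorm1 mulr1. Qed.

(* Cauchy-Schwarz for the form [<C x, y>] turns a quadratic-form bound into an
   operator bound. *)
Lemma mul_bound_form C r : star C = C -> 0 <= r ->
  (forall x, 0 <= tip (C * x) x <= r * tnorm x ^+ 2) -> mul_bound C r.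
Proof.
move=> sC r0 H x.
have C0 y : 0 <= tip (C * y) y by case/andP: (H y).
have CS : tip (C * x) (C * x) ^+ 2 <= tip (C * x) x * tip (C * (C * x)) (C * x).
  apply: discriminant_le => s.
  have H1 := C0 (x + s *: (C * x)).
  rewrite /tip starD starZ mulrDr mulrDl in H1.
  rewrite !mulrDr !tD -!scalerAr -!scalerAl !tZ in H1.
  rewrite /tip; rewrite !starM sC !mulrA in H1 *.
  by apply: le_trans H1 _; rewrite le_eqVlt; apply/orP; left; apply/eqP; ring.
rewrite -(@ler_pXn2r _ 2)// ?nnegrE ?mulr_ge0 ?tnorm_ge0// exprMn.
set N := tnorm (C * x) in CS *.
have N0 : 0 <= N by exact: tnorm_ge0.
have EN : tip (C * x) (C * x) = N ^+ 2 by rewrite /N tnorm_sqr.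
rewrite EN in CS.
have /andP[_ H1] := H x; have /andP[_ H2] := H (C * x); rewrite -/N in H2.
have H3 : (N ^+ 2) ^+ 2 <= (r * tnorm x ^+ 2) * (r * N ^+ 2).
  apply: le_trans CS _; apply: ler_pM => //.
have [->|h] := eqVneq N 0; first by rewrite expr0n mulr_ge0 ?sqr_ge0.
have Np : 0 < N ^+ 2 by rewrite exprn_gt0// lt_neqAle eq_sym h.
have -> : r ^+ 2 * tnorm x ^+ 2 = r * tnorm x ^+ 2 * r by ring.
rewrite -(ler_pM2r Np); move: H3; congr (_ <= _); ring.
Qed.

(** A polynomial path in the noncommutative algebra becomes an ordinary real polynomial, to which
    the mean value theorem applies. *)
Definition trace_poly (p : {poly A}) : {poly R} := map_poly t p.

Lemma coef_trace_poly p i : (trace_poly p)`_i = t p`_i.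
Proof. by rewrite coef_map_id0 ?t0. Qed.

Lemma trace_polyC p q : trace_poly (p * q) = trace_poly (q * p).
Proof.
apply/polyP => i; rewrite !coef_trace_poly coefM coefMr !t_sum.
by apply: eq_bigr => j _; rewrite tC.
Qed.

Lemma trace_polyD p q : trace_poly (p + q) = trace_poly p + trace_poly q.
Proof. by apply/polyP => i; rewrite coefD !coef_trace_poly coefD tD. Qed.

Lemma trace_poly_deriv p : (trace_poly p)^`() = trace_poly p^`().
Proof.
apply/polyP => i; rewrite coef_trace_poly !coef_deriv coef_trace_poly.
by rewrite tMn.
Qed.

(** The path does not commute with its derivative, but cyclicity of the trace lets all factors [p]
    be collected on one side. The extra [p ^+ m] keeps the induction going. *)
Lemma trace_poly_deriv_exp p k m :
  trace_poly ((p ^+ k.+1)^`() * p ^+ m) = trace_poly (p^`() * p ^+ (k + m)) *+ k.+1.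
Proof.
elim: k m => [|k IH] m; first by rewrite expr1 add0n mulr1n.
rewrite exprS derivM mulrDl trace_polyD -mulrA -exprD -mulrA.
by rewrite (trace_polyC p) -mulrA -exprSr IH addnS addSn -mulrS.
Qed.

Lemma trace_poly_horner p s : (trace_poly p).[s] = t p.[s%:A].
Proof.
rewrite (horner_coef_wide s (size_poly _ _)) horner_coef t_sum.
apply: eq_bigr => i _; rewrite coef_trace_poly exprZn expr1n -scalerAr mulr1 tZ.
by rewrite mulrC.
Qed.

Lemma comm_poly_scalar p s : comm_poly p (s%:A : A).
Proof. by apply: comm_coef_poly => i; rewrite /GRing.comm mulr_algl mulr_algr. Qed.

Lemma hornerX_scalar p (s : R) k : (p ^+ k).[s%:A] = (p.[s%:A]) ^+ k :> A.
Proof.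
elim: k => [|k IH]; first by rewrite !expr0 hornerE.
by rewrite !exprS hornerM_comm ?IH//; exact: comm_poly_scalar.
Qed.

(* The truncation of [- t (log a)] obtained from
   [- log a = \sum_(k >= 1) (1 - a) ^ k / k]. *)
Definition trunc_log (n : nat) (C : A) : R :=
  \sum_(k < n) k.+1%:R^-1 * t (C ^+ k.+1).

(** The weights [1 / (k + 1)] cancel the exponents produced by differentiation, so the derivative
    contains the geometric sum that approximates [(1 - p)^-1]. *)
Lemma trunc_log_diff_le (p : {poly A}) n e :
  (forall s, 0 <= s <= 1 ->
     `|t (p^`().[s%:A] * \sum_(k < n) p.[s%:A] ^+ k)| <= e) ->
  `|trunc_log n p.[1] - trunc_log n p.[0]| <= e.
Proof.
move=> H.
pose P := \sum_(k < n) k.+1%:R^-1 *: trace_poly (p ^+ k.+1).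
have EP s : P.[s] = trunc_log n p.[s%:A].
  rewrite horner_sum; apply: eq_bigr => k _.
  by rewrite hornerZ trace_poly_horner hornerX_scalar.
have -> : p.[1] = p.[1%:A] by rewrite scale1r.
have -> : p.[0] = p.[0%:A] by rewrite scale0r.
rewrite -!EP; apply: poly_diff_le => s /H; congr (`|_| <= _).
rewrite mulr_sumr t_sum raddf_sum horner_sum; apply: eq_bigr => k _ /=.
rewrite derivZ hornerZ trace_poly_deriv.
have := trace_poly_deriv_exp p k 0; rewrite addn0 mulr1 => ->.
rewrite hornerMn -[X in _ = _ * X]mulr_natl mulrA mulVf ?pnatr_eq0// mul1r.
rewrite trace_poly_horner hornerM_comm ?hornerX_scalar//.
exact: comm_poly_scalar.
Qed.

Lemma geometric_inverse (Q : A) m : (1 - Q) * (\sum_(j < m) Q ^+ j) = 1 - Q ^+ m.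
Proof. by rewrite -opprB mulNr -subrX1 opprB. Qed.

Lemma geometric_inverse_r (Q : A) m : (\sum_(j < m) Q ^+ j) * (1 - Q) = 1 - Q ^+ m.
Proof.
rewrite -geometric_inverse mulr_suml mulr_sumr; apply: eq_bigr => j _.
by rewrite mulrBr mulrBl mulr1 mul1r -exprS -exprSr.
Qed.

Lemma mul_bound_geometric Q r m : 0 <= r -> r < 1 -> mul_bound Q r ->
  mul_bound (\sum_(j < m) Q ^+ j) (1 - r)^-1.
Proof.
move=> r0 r1 HQ.
have H : mul_bound (\sum_(j < m) Q ^+ j) (\sum_(j < m) r ^+ j).
  elim: m => [|m IH]; first by move=> x; rewrite !big_ord0 !mul0r /tnorm mulr0 t0 sqrtr0.
  by rewrite !big_ord_recr /=; apply: mul_boundD => //; apply: mul_boundX.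
move=> x; apply: le_trans (H x) _; apply: ler_wpM2r; first exact: tnorm_ge0.
have r1' : 0 < 1 - r by rewrite subr_gt0.
rewrite -(ler_pM2l r1') divff ?gt_eqF//.
have -> : (1 - r) * \sum_(j < m) r ^+ j = 1 - r ^+ m by rewrite -opprB mulNr -subrX1 opprB.
by rewrite lerBlDr lerDl exprn_ge0.
Qed.

(** * Control of the truncated logarithm along the path [A_s] *)

Section Perturbation.
Variables (q h d e : A) (rho kap eps Mh : R).
Hypothesis bdA : forall a, exists2 c, 0 <= c & mul_bound a c.
Hypothesis q_trace : forall j, t (q ^+ j.+1) = 0.
Hypothesis rho_ge0 : 0 <= rho.
Hypothesis rho_lt1 : rho < 1.
Hypothesis q_bound : mul_bound q rho.
Hypothesis star_h : star h = h.
Hypothesis h_ge0 : forall x, 0 <= tip (h * x) x.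
Hypothesis h_le : forall x, tip (h * x) x <= Mh * tnorm x ^+ 2.
Hypothesis star_d : star d = d.
Hypothesis star_e : star e = e.
Hypothesis dd : d * d = (eps / 4)%:A + h.
Hypothesis ed : e * d = 1.
Hypothesis eps_gt0 : 0 < eps.
Hypothesis kap_gt0 : 0 < kap.
Hypothesis kap_le : kap * (eps + 4 * Mh) <= 1.

(** This is [1 - kap A_s], where [kap] scales [A_s <= eps + 4 Mh] below 1. In the hypotheses, [d]
    stands for the square root of [eps/4 + h] and [e] for its inverse. *)
Definition perturbed (s : R) : A :=
  1 - kap *: (eps%:A + (1 + s *: star q) * h * (1 + s *: q)).

Let r := 1 - kap * eps.
Let k0 := (1 - rho)^-1.

Section FixedTime.
Variable s : R.
Hypothesis s01 : 0 <= s <= 1.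
Let B := 1 + s *: q.
Let C := perturbed s.
Let s_ge0 : 0 <= s. Proof. by case/andP: s01. Qed.
Let s_le1 : s <= 1. Proof. by case/andP: s01. Qed.

Let k0_ge0 : 0 <= k0. Proof. by rewrite invr_ge0 subr_ge0 ltW. Qed.
Let star_B : star B = 1 + s *: star q.
Proof. by rewrite /B starD star1 starZ. Qed.
Let star_C : star C = C.
Proof.
rewrite /C /perturbed -star_B -/B starD starN star1 starZ starD starZ star1.
by rewrite !starM starK star_h !mulrA.
Qed.

Let tipD x y z : tip (x + y) z = tip x z + tip y z.
Proof. by rewrite /tip mulrDr tD. Qed.
Let tipN x z : tip (- x) z = - tip x z.
Proof. by rewrite /tip mulrN tN. Qed.
Let tipZ a x z : tip (a *: x) z = a * tip x z.
Proof. by rewrite /tip -scalerAr tZ. Qed.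

Let tipBB x : tip (star B * h * B * x) x = tip (h * (B * x)) (B * x).
Proof. by rewrite /tip starM !mulrA. Qed.

Let tnormBx x : tnorm (B * x) <= 2 * tnorm x.
Proof.
rewrite /B mulrDl mul1r -scalerAl; apply: le_trans (tnormD _ _) _.
rewrite tnormZ ger0_norm// [leRHS]mulrDl !mul1r lerD2l.
apply: le_trans (_ : 1 * tnorm (q * x) <= _).
  by rewrite ler_wpM2r ?tnorm_ge0.
rewrite mul1r; apply: le_trans (q_bound x) _.
by rewrite ler_piMl ?tnorm_ge0// ltW.
Qed.

Let Mh_ge0 : 0 <= Mh.
Proof.
by have := le_trans (h_ge0 1) (h_le 1); rewrite tnorm1 expr1n mulr1.
Qed.

Let r_ge0 : 0 <= r.
Proof.
rewrite subr_ge0; apply: le_trans kap_le; apply: ler_wpM2l; first exact: ltW.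
by rewrite lerDl mulr_ge0.
Qed.
Let r_lt1 : r < 1.
Proof. by rewrite /r ltrBlDr ltrDl mulr_gt0. Qed.

(** As a form, [C] is [r - kap B^* h B], so [C <= r]. Since [|B| <= 2] the subtracted term is at
    most [4 kap Mh], and [kap_le] says precisely that this is at most [r]; hence [C >= 0]. *)
Let C_bound : mul_bound C r.
Proof.
apply: mul_bound_form => // x.
have E : tip (C * x) x =
    r * tnorm x ^+ 2 - kap * tip (h * (B * x)) (B * x).
  rewrite /C /perturbed -star_B -/B -tipBB mulrBl mul1r -scalerAl mulrDl mulr_algl.
  rewrite tipD tipN tipZ tipD tipZ tnorm_sqr /r -/(tip x x); ring.
have h0 := h_ge0 (B * x); have h1 := h_le (B * x).
have k0' := ltW kap_gt0.
rewrite E; apply/andP; split; last by rewrite gerBl mulr_ge0.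
rewrite subr_ge0.
have h2 : tip (h * (B * x)) (B * x) <= Mh * (4 * tnorm x ^+ 2).
  apply: le_trans h1 _; rewrite ler_wpM2l//.
  have -> : 4 * tnorm x ^+ 2 = (2 * tnorm x) ^+ 2 by ring.
  by rewrite lerXn2r ?nnegrE ?mulr_ge0 ?tnorm_ge0.
apply: le_trans (ler_wpM2l k0' h2) _.
have -> : kap * (Mh * (4 * tnorm x ^+ 2)) = kap * (4 * Mh) * tnorm x ^+ 2 by ring.
by rewrite ler_wpM2r ?sqr_ge0// /r lerBrDr -mulrDr addrC.
Qed.

Let Q := - s *: q.
Let BQ : B = 1 - Q. Proof. by rewrite /B /Q scaleNr opprK. Qed.
Let Q_bound : mul_bound Q rho.
Proof.
move=> x; rewrite /Q -scalerAl tnormZ normrN ger0_norm//.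
apply: le_trans (_ : 1 * tnorm (q * x) <= _); last by rewrite mul1r.
by rewrite ler_wpM2r ?tnorm_ge0.
Qed.

(** Stands for [B^-1]: on either side, [B] times [J m] is [1 - Q ^+ m], because [B = 1 - Q]. *)
Let J m := \sum_(j < m) Q ^+ j.
Let J_bound m : mul_bound (J m) k0.
Proof. exact: mul_bound_geometric. Qed.
Let Jq_trace m : t (J m * q) = 0.
Proof.
rewrite mulr_suml t_sum big1// => j _.
by rewrite exprZn -scalerAl -exprSr tZ q_trace mulr0.
Qed.
Let Jq_bound m : mul_bound (J m * q) k0.
Proof.
move=> x; apply: le_trans (mul_bound_mul k0_ge0 (@J_bound m) q_bound x) _.
by rewrite ler_wpM2r ?tnorm_ge0// ler_piMr// ltW.
Qed.

Variable n : nat.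
Let G := \sum_(k < n) C ^+ k.
(** Stands for [A_s^-1]: as [1 - C = kap A_s], the product of [A_s] and [w] is [1 - C ^+ n]. *)
Let w := kap *: G.
Let star_G : star G = G.
Proof. by rewrite star_sum; apply: eq_bigr => k _; rewrite starX star_C. Qed.

Let pert := eps%:A + star B * h * B.
Let CE : 1 - C = kap *: pert.
Proof. by rewrite /C /perturbed /pert star_B opprB addrCA subrr addr0. Qed.
Let pert_w : pert * w = 1 - C ^+ n.
Proof. by rewrite /w -scalerAr scalerAl -CE geometric_inverse. Qed.
Let w_pert : w * pert = 1 - C ^+ n.
Proof. by rewrite /w -scalerAl scalerAr -CE geometric_inverse_r. Qed.

Let C_norm : tnorm (C ^+ n) <= r ^+ n.
Proof. by apply: mul_bound_norm; apply: mul_boundX. Qed.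

(** A self-improving estimate. Pairing [A_s w = 1 - C^n] with [w] expresses
    [eps |w|^2 + <h B w, B w>] through [t w]. This quantity dominates [Y^2 = |d B w|^2], while [t w]
    is at most a multiple [S] of [Y]. Hence [Y] is controlled by [S], and so is the quantity
    itself. *)
Let w_norm : eps * tnorm w <= k0 * Num.sqrt eps * tnorm e + 2 * r ^+ n.
Proof.
have tw : tip 1 w = t w by rewrite /tip mulr1 t_star.
set x := tnorm w.
have x0 : 0 <= x by exact: tnorm_ge0.
set Y := tnorm (d * (B * w)).
have Y0 : 0 <= Y by exact: tnorm_ge0.
set hb := tip (h * (B * w)) (B * w).
have hb0 : 0 <= hb by exact: h_ge0.
have eps0 := ltW eps_gt0.
have form : eps * x ^+ 2 + hb = t w - tip (C ^+ n) w.
  rewrite -tw -tipN -tipD -pert_w /pert mulrDl mulr_algl tipD tipZ tipBB.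
  by rewrite /x tnorm_sqr.
have rest : `|tip (C ^+ n) w| <= r ^+ n * x.
  by apply: le_trans (tip_le _ _) _; rewrite ler_wpM2r.
(* The 4 in [dd] absorbs [|B|^2 <= 4], so the part [eps / 4] of [d * d] costs at most
   [eps |w|^2]. *)
have Y2 : Y ^+ 2 <= eps * x ^+ 2 + hb.
  rewrite /Y tnorm_sqr; have -> : star (d * (B * w)) * (d * (B * w)) =
      star (B * w) * ((d * d) * (B * w)) by rewrite starM star_d !mulrA.
  rewrite dd (mulrDl _ h) mulrDr tD mulr_algl -scalerAr tZ -/(tip _ _) -/hb.
  rewrite lerD2r -tnorm_sqr.
  have -> : eps * x ^+ 2 = eps / 4 * (2 * x) ^+ 2 by field.
  rewrite ler_wpM2l ?divr_ge0//.
  by rewrite lerXn2r ?nnegrE ?mulr_ge0 ?tnorm_ge0.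
(* Write [t w = t (B^-1 e d B w)] with [J m] for [B^-1], and separate [J m * e] from [d B w] by
   Cauchy-Schwarz. *)
have tw_le : t w <= k0 * tnorm e * Y.
  apply: (@le_add_geometric _ _ _ x rho) => // m.
  have -> : w = J m * (B * w) + Q ^+ m * w.
    by rewrite mulrA BQ geometric_inverse_r -mulrDl subrK mul1r.
  rewrite tD lerD//.
    have -> : J m * (B * w) = J m * e * (d * (B * w)).
      by rewrite !mulrA -(mulrA _ e) ed mulr1.
    apply: le_trans (ler_norm _) _.
    have := tip_le (d * (B * w)) (star (J m * e)); rewrite /tip starK => h1.
    apply: le_trans h1 _; rewrite mulrC tnorm_star ler_wpM2r//.
    exact: J_bound.
  apply: le_trans (ler_norm _) _; apply: le_trans (t_le _) _.
  rewrite mulrC; apply: (mul_boundX _ rho_ge0 Q_bound).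
set S := k0 * tnorm e in tw_le *.
have S0 : 0 <= S by rewrite mulr_ge0 ?tnorm_ge0.
set z := r ^+ n in rest *; have z0 : 0 <= z by exact: exprn_ge0.
have {}rest : - tip (C ^+ n) w <= z * x.
  by apply: le_trans rest; rewrite -normrN ler_norm.
(* The previous bounds combine to [Y^2 <= S Y + z x]. If [Y > S], then
   [S (Y - S) <= Y (Y - S) <= z x]. *)
have SY : S * Y <= S ^+ 2 + z * x.
  have zx : 0 <= z * x by rewrite mulr_ge0.
  have [YS|YS] := leP Y S; first by nra.
  nra.
(* Multiplying [eps x^2 <= S^2 + 2 z x] by [eps] and completing the square isolates [eps x], the
   quantity to be bounded. *)
have x2 : (eps * x - z) ^+ 2 <= eps * S ^+ 2 + z ^+ 2.
  have : eps * (eps * x ^+ 2) <= eps * (S ^+ 2 + 2 * (z * x)).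
    by rewrite ler_wpM2l//; lra.
  by nra.
have sq : (eps * x - z) ^+ 2 <= (S * Num.sqrt eps + z) ^+ 2.
  apply: le_trans x2 _.
  have -> : (S * Num.sqrt eps + z) ^+ 2 =
      eps * S ^+ 2 + z ^+ 2 + (S * Num.sqrt eps * z) *+ 2.
    by rewrite -{2}(sqr_sqrtr eps0); ring.
  by rewrite lerDl mulrn_wge0// !mulr_ge0// sqrtr_ge0.
have : eps * x - z <= S * Num.sqrt eps + z.
  apply: le_trans (ler_norm _) _.
  rewrite -ler_sqr ?nnegrE ?normr_ge0// ?real_normK ?num_real//.
  by rewrite addr_ge0// mulr_ge0// sqrtr_ge0.
rewrite /S; lra.
Qed.

(** Inserting [q = B (B^-1 q)] and cycling gives [t (B^-1 q w B^* h B)], where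
    [w B^* h B = 1 - C^n - eps w]. The term 1 contributes [t (B^-1 q) = 0]; the others are bounded
    by [k0 r^n] and [k0 eps |w|], and the 3 is this one [r^n] plus the two from [w_norm]. *)
Lemma perturbation_step :
  `|t ((- kap *: (star q * h * B + star B * h * q)) * G)| <=
  2 * k0 * (k0 * Num.sqrt eps * tnorm e + 3 * r ^+ n).
Proof.
(* The two summands are adjoint to each other; since [t] is invariant under [star] and cyclic and
   [G] is self-adjoint, they have the same trace against [G]. *)
have -> : t ((- kap *: (star q * h * B + star B * h * q)) * G) =
    - (2 * t (star B * h * q * w)).
  rewrite /w -scalerAl -scalerAr !tZ mulrDl tD.
  rewrite -[t (star q * _ * _ * _)]t_star !starM star_G star_h starK.
  by rewrite tC !mulrA; ring.
rewrite normrN normrM ger0_norm// -[leRHS]mulrA ler_wpM2l//.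
(* The value of [c] is irrelevant: it multiplies only the geometric remainder. *)
have [c c0 Hc] := bdA (star B * h).
apply: (@le_add_geometric _ _ _ (c * (rho * tnorm w)) rho) => //.
  by rewrite !mulr_ge0// tnorm_ge0.
move=> m.
have qE : q = B * (J m * q) + Q ^+ m * q.
  by rewrite mulrA BQ geometric_inverse -mulrDl subrK mul1r.
rewrite {1}qE mulrDr mulrDl tD.
apply: le_trans (ler_normD _ _) _; apply: lerD; last first.
  have -> : star B * h * (Q ^+ m * q) * w = star B * h * (Q ^+ m * (q * w)).
    by rewrite !mulrA.
  apply: le_trans (t_le _) _; apply: le_trans (Hc _) _.
  rewrite -(mulrA c); apply: ler_wpM2l => //.
  apply: le_trans (mul_boundX _ rho_ge0 Q_bound _) _.
  by rewrite mulrC; apply: ler_wpM2r; rewrite ?exprn_ge0.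
have E : t (star B * h * (B * (J m * q)) * w) =
    - (t (J m * q * C ^+ n) + eps * t (J m * q * w)).
  have -> : star B * h * (B * (J m * q)) * w = (star B * h * B) * (J m * q * w).
    by rewrite !mulrA.
  rewrite (tC (star B * h * B)) -(mulrA (J m * q)).
  have -> : w * (star B * h * B) = 1 - C ^+ n - eps *: w.
    by rewrite -w_pert /pert (mulrDr w eps%:A) mulr_algr addrAC subrr add0r.
  by rewrite !mulrDr mulr1 !mulrN -scalerAr !tD !tN tZ Jq_trace; ring.
rewrite E normrN.
apply: le_trans (ler_normD _ _) _.
have E1 : `|t (J m * q * C ^+ n)| <= k0 * r ^+ n.
  apply: le_trans (t_le _) _; apply: le_trans (Jq_bound m _) _.
  by rewrite ler_wpM2l.
have E2 : `|eps * t (J m * q * w)| <= k0 * (eps * tnorm w).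
  have eps0 := ltW eps_gt0.
  rewrite normrM gtr0_norm// [leRHS]mulrCA ler_wpM2l//.
  by apply: le_trans (t_le _) _; exact: Jq_bound.
have E3 := ler_wpM2l k0_ge0 w_norm.
lra.
Qed.

End FixedTime.

Lemma trunc_log_perturbed n :
  `|trunc_log n (perturbed 1) - trunc_log n (perturbed 0)| <=
  2 * k0 * (k0 * Num.sqrt eps * tnorm e + 3 * r ^+ n).
Proof.
pose c0 := 1 - kap *: (eps%:A + h).
pose c1 := - kap *: (star q * h + h * q).
pose c2 := - kap *: (star q * h * q).
pose p : {poly A} := (c2%:P * 'X + c1%:P) * 'X + c0%:P.
have pE (s : R) : p.[s%:A] = perturbed s.
  rewrite /p !hornerMXaddC hornerC !mulr_algr.
  have E : (1 + s *: star q) * h * (1 + s *: q) =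
      h + s *: (star q * h + h * q) + (s * s) *: (star q * h * q).
    rewrite mulrDl mul1r mulrDr mulr1 mulrDl -!scalerAr -!scalerAl scalerA.
    by rewrite scalerDr !addrA.
  rewrite /perturbed E /c0 /c1 /c2 scalerDr addrC -addrA; congr (1 + _).
  rewrite !addrA !(scalerDr kap) !opprD [RHS]addrAC.
  by congr (_ + _ + _); rewrite !scalerA -scaleNr; congr (_ *: _); ring.
have pD (s : R) : p^`().[s%:A] =
    - kap *: (star q * h * (1 + s *: q) + star (1 + s *: q) * h * q).
  rewrite /p derivMXaddC derivMXaddC derivC mul0r addr0 hornerD.
  rewrite hornerMXaddC hornerMX !hornerC !mulr_algr /c1 /c2.
  rewrite starD star1 starZ (mulrDr (star q * h)) mulr1 !mulrDl !mul1r.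
  rewrite -!scalerAr -!scalerAl !scalerA (mulrC s) -!scalerA -!scalerDr.
  by rewrite !addrA (addrC (s *: _) (star q * h)).
have -> : perturbed 1 = p.[1] by rewrite -pE scale1r.
have -> : perturbed 0 = p.[0] by rewrite -pE scale0r.
apply: trunc_log_diff_le => s s01.
rewrite pE pD; exact: perturbation_step.
Qed.

End Perturbation.

End TracialAlgebra.

(** * Spectral measures and moments *)

Section Density.
Context {R : realType} {d : measure_display} {T : measurableType d}.
Variables (m nu : {measure set T -> \bar R}) (g : T -> R).
Hypothesis g_ge0 : forall x, 0 <= g x.
Hypothesis g_meas : measurable_fun setT g.
Hypothesis nuE : forall B, measurable B -> nu B = (\int[m]_(x in B) (g x)%:E)%E.

Import HBNNSimple.

Lemma ge0_integral_density (f : T -> \bar R) : measurable_fun setT f ->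
  (forall x, 0 <= f x)%E -> (\int[nu]_x f x = \int[m]_x (f x * (g x)%:E))%E.
Proof.
move=> mf f0.
have mg : measurable_fun setT (EFin \o g) by exact/measurable_EFinP.
pose h := nnsfun_approx measurableT mf.
have hf x : (EFin \o h n) x @[n --> \oo] --> f x by apply: cvg_nnsfun_approx.
have hnd x : {homo (fun n => (EFin \o h n) x) : a b / (a <= b)%N >-> (a <= b)%E}.
  by move=> a b ab; rewrite lee_fin; exact/lefP/nd_nnsfun_approx.
have mh n : measurable_fun setT (EFin \o h n) by exact/measurable_EFinP.
have h0 n x : (0 <= (EFin \o h n) x)%E by rewrite lee_fin.
have -> : (\int[nu]_x f x = limn (fun n => \int[nu]_x (EFin \o h n) x))%E.
  rewrite -monotone_convergence//.
  by apply: eq_integral => x _; apply/esym/cvg_lim.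
have -> : (\int[m]_x (f x * (g x)%:E) =
    limn (fun n => \int[m]_x ((EFin \o h n) x * (g x)%:E)))%E.
  rewrite -monotone_convergence//.
  - by apply: eq_integral => x _; apply/esym/cvg_lim => //; exact: cvgeZr.
  - by move=> n; apply: emeasurable_funM.
  - by move=> n x _; rewrite mule_ge0 ?lee_fin.
  - by move=> x _ a b ab; rewrite lee_wpmul2r ?lee_fin//; exact/lefP/nd_nnsfun_approx.
congr (limn _); apply/funext => n.
pose I r := (fun x => (r * \1_(h n @^-1` [set r]) x)%:E) : T -> \bar R.
have mI r : measurable_fun setT (I r).
  by apply/measurable_EFinP; exact: measurable_funM.
have hE x : (EFin \o h n) x = (\sum_(r \in range (h n)) I r x)%E.
  by rewrite /= fimfunE -fsumEFin.
transitivity (\int[nu]_x (\sum_(r \in range (h n)) I r x))%E.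
  by apply: eq_integral => x _; rewrite hE.
rewrite ge0_integral_fsum//; last by move=> r x _; exact: nnfun_muleindic_ge0.
transitivity (\int[m]_x (\sum_(r \in range (h n)) (I r x * (g x)%:E)))%E; last first.
  apply: eq_integral => x _; rewrite hE ge0_mule_fsuml// => r.
  exact: nnfun_muleindic_ge0.
rewrite ge0_integral_fsum//; last 2 first.
- by move=> r; exact: emeasurable_funM.
- by move=> r x _; rewrite mule_ge0 ?lee_fin//; exact: nnfun_muleindic_ge0.
apply: eq_fsbigr => r; rewrite inE => -[x0 _ rE].
have r0 : (0 <= r)%R by rewrite -rE.
have mB : measurable (h n @^-1` [set r]) by [].
rewrite /I; under eq_integral do rewrite EFinM.
rewrite ge0_integralZl//; last by apply/measurable_EFinP.
under [RHS]eq_integral do rewrite EFinM -muleA.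
rewrite [RHS]ge0_integralZl//; last 2 first.
- by apply: emeasurable_funM => //; exact/measurable_EFinP.
- by move=> x _; rewrite mule_ge0 ?lee_fin.
congr (_ * _)%E.
rewrite integral_indic// setIT nuE// integral_mkcond; apply: eq_integral => x _.
rewrite patchE indicE; case: (x \in _); by rewrite ?mul1e ?mul0e.
Qed.

End Density.

Section DensityMeasure.
Context {R : realType} {d : measure_display} {T : measurableType d}.
Variables (m : {measure set T -> \bar R}) (g : T -> R).
Hypothesis g_ge0 : forall x, 0 <= g x.
Hypothesis g_meas : measurable_fun setT g.

(** The proofs are arguments so that the measure structure can be inferred from the term alone. *)
Definition density_measure of (forall x, 0 <= g x) & measurable_fun setT g :=
  fun B : set T => (\int[m]_(x in B) (g x)%:E)%E.

Let dm := density_measure g_ge0 g_meas.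
Let dm0 : dm set0 = 0%E. Proof. by rewrite /dm /density_measure integral_set0. Qed.
Let dm_ge0 B : (0 <= dm B)%E.
Proof. by apply: integral_ge0 => x _; rewrite lee_fin. Qed.
Let dm_sigma : semi_sigma_additive dm.
Proof.
move=> F mF tF mUF; rewrite /dm /density_measure ge0_integral_bigcup//.
- by apply: is_cvg_ereal_nneg_natsum_cond => n _ _; exact: dm_ge0.
- by apply/measurable_funTS/measurable_EFinP.
- by move=> x _; rewrite lee_fin.
Qed.
HB.instance Definition _ := isMeasure.Build _ _ _ dm dm0 dm_ge0 dm_sigma.

Lemma density_measure_exists :
  {nu : {measure set T -> \bar R} |
    forall B, measurable B -> nu B = (\int[m]_(x in B) (g x)%:E)%E}.
Proof. by exists (dm : {measure set T -> \bar R}). Qed.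

End DensityMeasure.

(** * Moments of a spectral measure given by its scalar measures *)

Section SpectralMoments.
Context {R : realType} {V : Type}.
Local Notation Rm := (measurableTypeR R).
Variables (add : V -> V -> V) (form : V -> V -> R) (P : V -> V).
Variables (E : set Rm -> V -> V) (M : R).
Hypothesis formC : forall u v, form u v = form v u.
Hypothesis formDl : forall u v w, form (add u v) w = form u w + form v w.
Hypothesis form_ge0 : forall u, 0 <= form u u.
Hypothesis form_null : forall u v, form u u = 0 -> form u v = 0.
Hypothesis PD : forall u v w,
  form (P (add u v)) w = form (P u) w + form (P v) w.
Hypothesis Psym : forall u v, form (P u) v = form u (P v).
Hypothesis P_ge0 : forall u, 0 <= form (P u) u.
Hypothesis M_ge0 : 0 <= M.
Hypothesis P_le : forall u, form (P u) u <= M * form u u.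
Hypothesis ED : forall B u v w, measurable B ->
  form (E B (add u v)) w = form (E B u) w + form (E B v) w.
Hypothesis Esym : forall B u v, measurable B -> form (E B u) v = form u (E B v).
Hypothesis Eidem : forall B u v, measurable B ->
  form (E B (E B u)) v = form (E B u) v.
Hypothesis ET : forall u v, form (E setT u) v = form u v.

(** All identities are tested through [form], since operators are determined only up to null
    vectors. For each vector the data give just the first moment of its scalar measure; higher
    moments have to be extracted by varying the vector. *)
Definition scalar_spectral_measure (u : V) (m : {measure set Rm -> \bar R}) :=
  forall B, measurable B -> m B = (form (E B u) u)%:E.

Hypothesis Espec : forall u,
  exists2 m : {measure set Rm -> \bar R}, scalar_spectral_measure u m &
    (\int[m]_t t%:E = (form (P u) u)%:E)%E.

Local Notation ssm := scalar_spectral_measure.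

Let formDr u v w : form w (add u v) = form w u + form w v.
Proof. by rewrite formC formDl !(formC w). Qed.

Let integral_id u m : ssm u m -> (\int[m]_t t%:E = (form (P u) u)%:E)%E.
Proof.
move=> Hm; have [m' Hm' <-] := Espec u.
by apply: eq_measure_integral => B mB _; rewrite Hm// Hm'.
Qed.

Let form_EE B u : measurable B -> form (E B u) (E B u) = form (E B u) u.
Proof. by move=> mB; rewrite -Esym// Eidem. Qed.

(** Idempotence gives the scalar measure of [E B u] the same mass on [B] as on the whole line. It
    therefore vanishes on the complement of [B], which contains [C]. *)
Let E_disjoint B C u y : measurable B -> measurable C -> B `&` C = set0 ->
  form (E C (E B u)) y = 0.
Proof.
move=> mB mC BC; apply: form_null; rewrite form_EE//.
have [m Hm _] := Espec (E B u).
have mCB : measurable (~` B) by exact: measurableC.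
have h : (m setT = m B + m (~` B))%E.
  by rewrite -measureU ?setUv ?setICr.
have {}h : form (E (~` B) (E B u)) (E B u) = 0.
  by move: h; rewrite !Hm// ET Eidem// -EFinD => -[]; lra.
have : (m C <= m (~` B))%E.
  rewrite le_measure ?inE// => x Cx Bx.
  by have : (B `&` C) x by []; rewrite BC.
rewrite !Hm// h lee_fin => h'.
by apply/eqP; rewrite eq_le h' -form_EE// form_ge0.
Qed.

Let E_polar B u v : measurable B ->
  form (E B (add u v)) (add u v) =
  form (E B u) u + form (E B v) v + 2 * form (E B u) v.
Proof.
by move=> mB; rewrite formDr !ED// (Esym v u)// (formC v); ring.
Qed.

Let E_additive B C u y : measurable B -> measurable C -> B `&` C = set0 ->
  form (E (B `|` C) u) y = form (E B u) y + form (E C u) y.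
Proof.
move=> mB mC BC; have mBC : measurable (B `|` C) by exact: measurableU.
have q z : form (E (B `|` C) z) z = form (E B z) z + form (E C z) z.
  have [m Hm _] := Espec z.
  have : (m (B `|` C) = m B + m C)%E by rewrite measureU.
  by rewrite !Hm// => -[].
have := q (add u y); rewrite !E_polar// !q; lra.
Qed.

Let E_compl B u z : measurable B -> form (E B u) z = form u z - form (E (~` B) u) z.
Proof.
move=> mB; rewrite -(ET u z) -(setUv B) E_additive ?setICr ?addrK//.
exact: measurableC.
Qed.

Let E_setI B C u y : measurable B -> measurable C ->
  form (E C (E B u)) y = form (E (C `&` B) u) y.
Proof.
move=> mB mC.
have mBc : measurable (~` B) by exact: measurableC.
have mCB : measurable (C `&` B) by exact: measurableI.
have mCD : measurable (C `&` ~` B) by exact: measurableI.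
have -> : form (E C (E B u)) y = form (E (C `&` B) (E B u)) y.
  rewrite -{1}(setIT C) -(setUv B) setIUr E_additive//; last first.
    by rewrite setIACA setICr setI0.
  by rewrite (@E_disjoint B (C `&` ~` B)) ?addr0// setICA setICr setI0.
rewrite Esym// E_compl// -Esym// -[X in _ - X]Esym//.
rewrite (@E_disjoint (~` B)) ?subr0//.
by rewrite setICA [~` B `&` B]setIC setICr setI0.
Qed.

Let ssm_restr B u m m' : measurable B -> ssm u m -> ssm (E B u) m' ->
  forall C, measurable C -> m' C = m (C `&` B).
Proof.
move=> mB Hm Hm' C mC.
have mCB : measurable (C `&` B) by exact: measurableI.
by rewrite Hm'// Hm// E_setI// -Esym// E_setI// setICA setIid.
Qed.

(** The scalar measure of [E B u] is that of [u] restricted to [B], so the first-moment identity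
    localizes. Support properties of [m] follow from bounds on the form of [P]. *)
Let integral_id_restr B u m : measurable B -> ssm u m ->
  (\int[m]_(t in B) t%:E = (form (P (E B u)) (E B u))%:E)%E.
Proof.
move=> mB Hm; have [m' Hm' <-] := Espec (E B u).
have mm' := ssm_restr mB Hm Hm'.
have mBc : measurable (~` B) by exact: measurableC.
transitivity (\int[m']_(t in B) t%:E)%E.
  by apply: eq_measure_integral => C mC CB; rewrite mm'// setIidl.
rewrite integral_mkcond; apply: ae_eq_integral => //.
  by apply/(measurable_restrictT _ mB).
exists (~` B); split => //; first by rewrite mm'// setICl measure0.
move=> t /= /not_implyP[_ h] Bt; apply: h.
by rewrite patchE mem_set.
Qed.

Let ssm_ltN u m (c : R) : ssm u m -> 0 < c -> m [set t | t <= - c] = 0%E.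
Proof.
move=> Hm c0; set B := [set t | _].
have mB : measurable B by rewrite /B -set_itvNyc; exact: measurable_itv.
have h1 : (0 <= \int[m]_(t in B) t%:E)%E by rewrite (integral_id_restr mB Hm) lee_fin.
have h2 : (\int[m]_(t in B) t%:E = - \int[m]_(t in B) (- t)%:E)%E.
  rewrite -integral_ge0N; last first.
    by move=> t; rewrite /B/= lee_fin oppr_ge0 => /le_trans; apply; rewrite oppr_le0 ltW.
  by apply: eq_integral => t _; rewrite EFinN oppeK.
have h3 : (c%:E * m B <= \int[m]_(t in B) (- t)%:E)%E.
  rewrite -integral_cst//; apply: ge0_le_integral => //.
  - by move=> t _; rewrite lee_fin ltW.
  - by apply/measurable_EFinP; exact: measurable_funN.
  - by move=> t; rewrite /B/= lee_fin lerNr.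
apply/eqP; rewrite eq_le measure_ge0 andbT.
move: h1; rewrite h2 oppe_ge0 => h1.
have := le_trans h3 h1.
by rewrite pmule_rle0 ?lte_fin.
Qed.

Lemma ssm_lt0 u m : ssm u m -> m [set t | t < 0] = 0%E.
Proof.
move=> Hm.
have mB n : measurable [set t : Rm | t <= - n.+1%:R^-1].
  by rewrite -set_itvNyc; exact: measurable_itv.
have -> : [set t : Rm | t < 0] = \bigcup_n [set t : Rm | t <= - n.+1%:R^-1].
  apply/seteqP; split => [t /= t0|t [n _ /=]]; last first.
    by move=> h; apply: le_lt_trans h _; rewrite oppr_lt0.
  have [n nt] := ltr_add_invr t0.
  by exists n => //=; rewrite -subr_ge0 -opprD oppr_ge0 addrC ltW.
apply/negligibleP; first exact: bigcup_measurable.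
apply: negligible_bigcup => n; apply/negligibleP => //.
exact: (ssm_ltN Hm).
Qed.

(** The gap of 1 above [M] makes one comparison enough: [(M + 1) m(B) <= M m(B)] forces
    [m(B) = 0]. *)
Lemma ssm_gt u m : ssm u m -> m [set t | M + 1 <= t] = 0%E.
Proof.
move=> Hm; set B := [set t | _].
have mB : measurable B by rewrite /B -set_itvcy; exact: measurable_itv.
have h1 : (\int[m]_(t in B) t%:E <= M%:E * m B)%E.
  by rewrite (integral_id_restr mB Hm) Hm// -EFinM lee_fin -form_EE.
have h2 : ((M + 1)%:E * m B <= \int[m]_(t in B) t%:E)%E.
  rewrite -integral_cst//; apply: ge0_le_integral => //.
  - by move=> t _; rewrite lee_fin addr_ge0.
have := le_trans h2 h1; rewrite Hm// -!EFinM lee_fin mulrDl mul1r gerDl => h.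
by congr (_%:E); apply/eqP; rewrite eq_le h -form_EE ?form_ge0.
Qed.

(** Equal to [t] almost everywhere for each scalar measure; being nonnegative everywhere, it can be
    integrated against sums and densities without integrability conditions. *)
Let pos (t : R) := Num.max t 0.
Let pos_ge0 t : 0 <= pos t. Proof. by rewrite le_max lexx orbT. Qed.
Let measurable_pos (D : set Rm) : measurable_fun D (pos : Rm -> R).
Proof. by apply: measurable_maxr. Qed.

Let integral_pos_restr B u m : measurable B -> ssm u m ->
  (\int[m]_(t in B) (pos t)%:E = (form (P (E B u)) (E B u))%:E)%E.
Proof.
move=> mB Hm; rewrite -(integral_id_restr mB Hm).
apply: ae_eq_integral => //; first exact/measurable_EFinP.
exists [set t | t < 0]; split.
- by rewrite -set_itvNyo; exact: measurable_itv.
- exact: (ssm_lt0 Hm).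
- move=> t /= /not_implyP[_ h]; rewrite ltNge; apply/negP => t0; apply: h.
  by rewrite /pos max_l.
Qed.

(** The ranges of [E B] and of its complement are orthogonal, also after any further [E C], so the
    scalar measure of [v + w] is the sum of those of [v] and [w]. Comparing first moments kills the
    cross term of [P]. *)
Let P_disjoint B u y : measurable B -> form (P (E B u)) (E (~` B) y) = 0.
Proof.
move=> mB; have mBc : measurable (~` B) by exact: measurableC.
set v := E B u; set w := E (~` B) y.
have [m1 H1 e1] := Espec v; have [m2 H2 e2] := Espec w.
have [m3 H3 e3] := Espec (add v w).
have m3E C : measurable C -> m3 C = measure_add m1 m2 C.
  move=> mC; rewrite measure_addE H3// H1// H2// -EFinD; congr (_%:E).
  rewrite E_polar// [X in _ + 2 * X](_ : _ = 0) ?mulr0 ?addr0//.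
  have mCB : measurable (C `&` B) by exact: measurableI.
  rewrite /v /w E_setI// -Esym//; apply: E_disjoint => //.
  by rewrite -setIA setICr setI0.
have pe z m : ssm z m -> (\int[m]_t (pos t)%:E = (form (P z) z)%:E)%E.
  move=> Hm; rewrite -(integral_id Hm).
  apply: ae_eq_integral => //; first exact/measurable_EFinP.
  exists [set t | t < 0]; split.
  - by rewrite -set_itvNyo; exact: measurable_itv.
  - exact: (ssm_lt0 Hm).
  - move=> t /= /not_implyP[_ h]; rewrite ltNge; apply/negP => t0; apply: h.
    by rewrite /pos max_l.
have := pe _ _ H3.
rewrite (eq_measure_integral (measure_add m1 m2)); last by move=> C mC _; exact: m3E.
rewrite ge0_integral_measure_add//; last 2 first.
- by move=> t _; rewrite lee_fin.
- exact/measurable_EFinP.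
rewrite (pe _ _ H1) (pe _ _ H2) -EFinD => -[].
rewrite formDr !PD (Psym w v) (formC w); lra.
Qed.

(** By [P_disjoint], [P] is block diagonal for [E B] and its complement. *)
Let P_E B u y : measurable B -> form (P (E B u)) y = form (E B (P u)) y.
Proof.
move=> mB; have mBc : measurable (~` B) by exact: measurableC.
have e1 : form (P (E B u)) y = form (P (E B u)) (E B y).
  by rewrite -[RHS]Esym// E_compl// Esym// P_disjoint// subr0.
have e2 : form (P u) (E B y) = form (P (E B u)) (E B y).
  by rewrite Psym (Psym (E B u)) E_compl// (formC (E _ u)) P_disjoint// subr0.
by rewrite e1 -e2 -Esym.
Qed.

(** The scalar measure of [u + P u] is [m + m'] plus twice the cross measure [<E u, P u>], which has
    density [t] with respect to [m]. Its first moment over [B] therefore contains twice the integral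
    of [t^2], whereas expanding the form of [P] at [E B (u + P u)] produces [2 m'(B)] in its
    place. *)
Lemma ssm_P_density u m m' : ssm u m -> ssm (P u) m' ->
  forall B, measurable B -> (m' B = \int[m]_(t in B) (t ^+ 2)%:E)%E.
Proof.
move=> Hm Hm' B mB.
have [dm Hdm] := density_measure_exists m pos_ge0 (measurable_pos (D := setT)).
pose m2 := measure_add dm dm.
have [m3 H3 _] := Espec (add u (P u)).
have cross C : measurable C -> (dm C = (form (E C u) (P u))%:E)%E.
  move=> mC; rewrite Hdm// (integral_pos_restr mC Hm).
  by rewrite P_E// -Esym// Eidem// Esym// formC.
have addE (a b : {measure set Rm -> \bar R}) C :
    (measure_add a b : {measure set Rm -> \bar R}) C = (a C + b C)%E.
  exact: measure_addE.
have m3E C : measurable C ->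
    m3 C = (measure_add (measure_add m m') m2 : {measure set Rm -> \bar R}) C.
  move=> mC; rewrite !addE H3// E_polar// Hm// Hm'// !cross//.
  by rewrite -!EFinD; congr (_%:E); ring.
have := integral_pos_restr mB H3.
rewrite (eq_measure_integral (measure_add (measure_add m m') m2)); last first.
  by move=> C mC _; exact: m3E.
have mpos : measurable_fun B (fun t : Rm => (pos t)%:E) by exact/measurable_EFinP.
have pos0 t : B t -> (0 <= (pos t)%:E)%E by rewrite lee_fin.
rewrite !ge0_integral_measure_add// (integral_pos_restr mB Hm) (integral_pos_restr mB Hm').
have -> : (\int[dm]_(t in B) (pos t)%:E = \int[m]_(t in B) (t ^+ 2)%:E)%E.
  rewrite integral_mkcond (@ge0_integral_density _ _ Rm m dm pos pos_ge0 (measurable_pos (D := setT)) Hdm).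
  - rewrite [RHS]integral_mkcond; apply: ae_eq_integral => //.
    + apply: emeasurable_funM; last by apply/measurable_EFinP.
      exact/(measurable_restrictT _ mB).
    + by apply/(measurable_restrictT _ mB)/measurable_EFinP; exact: measurable_funX.
    exists [set t | t < 0]; split.
    * by rewrite -set_itvNyo; exact: measurable_itv.
    * exact: (ssm_lt0 Hm).
    * move=> t /= /not_implyP[_ h]; rewrite ltNge; apply/negP => t0; apply: h.
      by rewrite !patchE; case: ifPn => _; rewrite ?mul0e// /pos max_l// -EFinM expr2.
  - exact/(measurable_restrictT _ mB).
  - by move=> t; rewrite patchE; case: ifPn => // _; rewrite lee_fin.
have PEE a : form (P (E B a)) (E B a) = form (E B (P a)) a.
  by rewrite P_E// -Esym// Eidem.
have PEED a b : form (P (E B (add a b))) (E B (add a b)) =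
    form (E B (P a)) a + form (E B (P b)) b + form (E B (P a)) b + form (E B (P b)) a.
  by rewrite PEE Esym// PD -(Esym (P a))// -(Esym (P b))// !formDr; ring.
rewrite PEED !PEE Hm'//.
have -> : form (E B (P (P u))) u = form (E B (P u)) (P u).
  by rewrite Esym// Psym formC P_E.
case: (\int[m]_(t in B) (t ^+ 2)%:E)%E => [x| |] //.
by rewrite -!EFinD => -[] h; congr (_%:E); lra.
Qed.

Lemma iter_moment u m k : ssm u m ->
  (\int[m]_t (t ^+ (2 * k))%:E = (form (iter k P u) (iter k P u))%:E)%E.
Proof.
elim: k u m => [|k IH] u m Hm.
  under eq_integral do rewrite muln0 expr0.
  by rewrite integral_cst// mul1e Hm// ET.
have [m' H' _] := Espec (P u).
rewrite iterSr -(IH _ _ H').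
rewrite (@ge0_integral_density _ _ Rm m m' (fun t => t ^+ 2)); last first.
- by move=> t; rewrite lee_fin exprM exprn_ge0// sqr_ge0.
- by apply/measurable_EFinP; exact: measurable_funX.
- exact: (ssm_P_density Hm H').
- exact: measurable_funX.
- by move=> t; exact: sqr_ge0.
by apply: eq_integral => t _; rewrite -EFinM -exprD mulnS addnC.
Qed.

End SpectralMoments.

(** * Logarithms as limits of polynomials *)

Section LogSeries.
Context {R : realType}.

(** The expression inside the norm vanishes at 0 and its derivative is [- y^n / (1 - y)], so the
    mean value theorem suffices. *)
Lemma log_series_le (n : nat) (x r : R) : 0 <= x -> x <= r -> r < 1 ->
  `|\sum_(k < n) k.+1%:R^-1 * x ^+ k.+1 + ln (1 - x)| <= r ^+ n / (1 - r).
Proof.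
move=> x0 xr r1.
have r0 : 0 <= r by exact: le_trans xr.
have rr : 0 < 1 - r by rewrite subr_gt0.
have rn : 0 <= r ^+ n / (1 - r) by rewrite divr_ge0 ?exprn_ge0// ltW.
have [->|xn0] := eqVneq x 0.
  rewrite subr0 ln1 addr0 big1 ?normr0// => k _.
  by rewrite expr0n mulr0.
have xp : 0 < x by rewrite lt_neqAle eq_sym xn0.
pose p : {poly R} := \sum_(k < n) k.+1%:R^-1 *: 'X^(k.+1).
pose F := (horner p + (@ln R \o (fun y => 1 - y)))%R.
have F1 (y : R) : y < 1 -> is_derive y 1 F (p^`().[y] - (1 - y)^-1).
  move=> y1; have y1' : 0 < 1 - y by rewrite subr_gt0.
  have d1 : is_derive y 1 (horner p) p^`().[y] by exact: is_derive_poly.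
  have d2 : is_derive y 1 (fun y => 1 - y) (- 1).
    by rewrite -sub0r; apply: is_deriveB.
  have d3 : is_derive (1 - y) 1 (@ln R) (1 - y)^-1 by exact: is_derive1_ln.
  have d4 := @is_derive1_comp _ _ (fun y => 1 - y) _ _ _ d3 d2.
  by apply: is_derive_eq; rewrite mulrN1.
have pE (y : R) : p^`().[y] = \sum_(k < n) y ^+ k.
  rewrite raddf_sum horner_sum; apply: eq_bigr => k _ /=.
  rewrite derivZ derivXn hornerZ hornerMn hornerXn -[y ^+ _ *+ _]mulr_natl mulrA.
  by rewrite mulVf ?pnatr_eq0// mul1r.
have cF : {within `[0, x], continuous F}.
  apply: derivable_within_continuous => y; rewrite in_itv/= => /andP[_ yx].
  by apply: ex_derive; apply: F1; apply: le_lt_trans yx _; exact: le_lt_trans r1.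
have dF (y : R) : y \in `]0, x[ -> is_derive y 1 F (p^`().[y] - (1 - y)^-1).
  rewrite in_itv/= => /andP[_ yx]; apply: F1.
  by apply: lt_trans yx _; exact: le_lt_trans r1.
have [y yx] := MVT xp dF cF.
rewrite /F /= !fctE /= subr0 ln1 addr0 subr0.
have -> : p.[0] = 0.
  rewrite horner_sum big1// => k _.
  by rewrite hornerZ hornerXn expr0n mulr0.
have -> : p.[x] = \sum_(k < n) k.+1%:R^-1 * x ^+ k.+1.
  by rewrite horner_sum; apply: eq_bigr => k _; rewrite hornerZ hornerXn.
rewrite subr0 => ->.
move: yx; rewrite in_itv/= => /andP[y0 yx].
have y1 : 0 < 1 - y by rewrite subr_gt0; apply: lt_trans yx _; exact: le_lt_trans r1.
have -> : p^`().[y] - (1 - y)^-1 = - (y ^+ n / (1 - y)).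
  apply: (mulfI (lt0r_neq0 y1)).
  rewrite mulrBr divff ?gt_eqF// mulrN mulrCA divff ?gt_eqF// mulr1 pE.
  by rewrite -[y ^+ n](subrK 1) subrX1; ring.
rewrite mulNr normrN ger0_norm; last first.
  by rewrite mulr_ge0 ?divr_ge0 ?exprn_ge0// ltW.
apply: le_trans (_ : y ^+ n / (1 - y) <= _).
  rewrite ler_piMr ?divr_ge0 ?exprn_ge0 1?ltW//.
  exact: le_lt_trans r1.
have [y0' y1' yr] : [/\ 0 <= y, 0 <= 1 - y & y <= r].
  by split; apply/ltW => //; exact: lt_le_trans xr.
apply: ler_pM; rewrite ?exprn_ge0 ?invr_ge0//.
  by rewrite lerXn2r.
by rewrite lef_pV2 ?posrE// lerD2l lerN2.
Qed.

End LogSeries.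

Section LogIntegral.
Context {R : realType} {d : measure_display} {T : measurableType d}.
Variables (nu : probability T R) (z : T -> R) (c : R).
Hypothesis z_meas : measurable_fun setT z.
Hypothesis c_gt0 : 0 < c.
Hypothesis z_ge0 : forall x, 0 <= z x.
Hypothesis z_le : forall x, c ^+ 2 * (1 + z x ^+ 2) <= 1.

Lemma bounded_integrable (f : T -> R) K : measurable_fun setT f ->
  (forall x, `|f x| <= K) -> nu.-integrable setT (EFin \o f).
Proof.
move=> mf fK; apply: measurable_bounded_integrable => //.
  by rewrite -ge0_fin_numE// fin_num_measure.
by exists K; split => [|M KM x _]; rewrite ?num_real//=; apply: le_trans (fK x) (ltW KM).
Qed.

Lemma Rintegral_dist_le (f g : T -> R) K e : measurable_fun setT f ->
  measurable_fun setT g -> (forall x, `|f x| <= K) ->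
  (forall x, `|f x - g x| <= e) ->
  `|\int[nu]_x f x - \int[nu]_x g x| <= e.
Proof.
move=> mf mg fK fg.
have i1 : nu.-integrable setT (EFin \o f) by exact: bounded_integrable fK.
have i2 : nu.-integrable setT (EFin \o g).
  apply: (@bounded_integrable _ (K + e)) => // x.
  rewrite -[g x](subKr (f x)).
  by apply: le_trans (ler_normB _ _) _; rewrite lerD.
rewrite -RintegralB//.
have i3 : nu.-integrable setT (EFin \o (fun x => f x - g x)).
  by apply: (@bounded_integrable _ e) => //; exact: measurable_funB.
apply: le_trans (le_normr_Rintegral _ i3) _ => //.
have <- : \int[nu]_(x in setT) e = e.
  have nuT : (nu : {measure set T -> \bar R}) setT = 1%E := probability_setT nu.
  by rewrite Rintegral_cst// nuT mulr1.
apply: le_Rintegral => //.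
- apply: (@bounded_integrable _ e) => [|x]; last by rewrite normr_id.
  by apply: measurableT_comp => //; exact: measurable_funB.
- by apply: (@bounded_integrable _ `|e|).
Qed.

Variables (eps : R).
Hypothesis eps_gt0 : 0 < eps.
Hypothesis eps_le1 : eps <= 1.

Let s (x : T) := 1 - c ^+ 2 * (eps + z x ^+ 2).
Let r := 1 - c ^+ 2 * eps.
Let c2 : 0 < c ^+ 2. Proof. by rewrite exprn_gt0. Qed.
Let s_ge0 x : 0 <= s x.
Proof.
rewrite subr_ge0; apply: le_trans (z_le x).
by rewrite ler_pM2l// lerD2r.
Qed.
Let s_le x : s x <= r.
Proof. by rewrite lerD2l lerN2 ler_pM2l// lerDl sqr_ge0. Qed.
Let r_lt1 : r < 1.
Proof. by rewrite ltrBlDr ltrDl mulr_gt0. Qed.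
Let s_meas : measurable_fun setT s.
Proof.
apply: measurable_funB => //; apply: measurable_funM => //.
by apply: measurable_funD => //; exact: measurable_funX.
Qed.

(** Sign and scaling make it nonnegative for [eps <= 1], and it increases as [eps] decreases:
    monotone convergence then applies even when the limit has infinite integral. *)
Definition log_reg (x : T) := - ln (c ^+ 2 * (eps + z x ^+ 2)).

Lemma measurable_log_reg : measurable_fun setT log_reg.
Proof.
apply: measurable_funN; apply: measurableT_comp; first exact: measurable_ln.
apply: measurable_funM => //.
by apply: measurable_funD => //; exact: measurable_funX.
Qed.

Lemma log_reg_ge0 x : 0 <= log_reg x.
Proof.
rewrite /log_reg oppr_ge0 ln_le0//.
by have := s_ge0 x; rewrite subr_ge0.
Qed.

Lemma log_reg_series n : `|\sum_(k < n) k.+1%:R^-1 * \int[nu]_x s x ^+ k.+1 -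
  \int[nu]_x log_reg x| <= r ^+ n / (1 - r).
Proof.
have r0 : 0 <= r by rewrite (le_trans (s_ge0 point)) // s_le.
have mX k : measurable_fun setT (fun x => k.+1%:R^-1 * s x ^+ k.+1).
  by apply: measurable_funM => //; exact: measurable_funX.
have bX k x : `|k.+1%:R^-1 * s x ^+ k.+1| <= 1.
  rewrite ger0_norm ?mulr_ge0 ?exprn_ge0//.
  rewrite -[leRHS]mulr1; apply: ler_pM; rewrite ?exprn_ge0//.
    by rewrite invf_le1 ?ltr0n// ler1n.
  by rewrite exprn_ile1// (le_trans (s_le x)) ?ltW.
have -> : \sum_(k < n) k.+1%:R^-1 * \int[nu]_x s x ^+ k.+1 =
    \int[nu]_x (\sum_(k < n) k.+1%:R^-1 * s x ^+ k.+1).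
  elim: n => [|n IH].
    by under [RHS]eq_Rintegral do rewrite big_ord0; rewrite big_ord0 Rintegral_cst// mul0r.
  under [RHS]eq_Rintegral do rewrite big_ord_recr.
  rewrite big_ord_recr/= RintegralD//.
  - rewrite IH RintegralZl//; apply: (@bounded_integrable _ 1); first exact: measurable_funX.
    move=> x; rewrite ger0_norm ?exprn_ge0//.
    by rewrite exprn_ile1// (le_trans (s_le x)) ?ltW.
  - apply: (@bounded_integrable _ (\sum_(k < n) 1)); first exact: measurable_sum.
    by move=> x; apply: le_trans (ler_norm_sum _ _ _) _; apply: ler_sum.
  - exact: bounded_integrable (bX n).
apply: (@Rintegral_dist_le _ _ (\sum_(k < n) 1)).
- exact: measurable_sum.
- exact: measurable_log_reg.
- by move=> x; apply: le_trans (ler_norm_sum _ _ _) _; apply: ler_sum.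
move=> x; rewrite /log_reg opprK.
have -> : c ^+ 2 * (eps + z x ^+ 2) = 1 - s x by rewrite /s; ring.
exact: log_series_le.
Qed.

End LogIntegral.

Section LogLimit.
Context {R : realType} {d : measure_display} {T : measurableType d}.
Variables (nu : probability T R).

Lemma measurable_lne (f : T -> R) : measurable_fun setT f ->
  measurable_fun setT (fun x => lne (f x)%:E).
Proof.
move=> mf.
have -> : (fun x => lne (f x)%:E) =
    (fun x => if f x <= 0 then -oo%E else (ln (f x))%:E) by [].
apply: measurable_fun_ifT => //; first exact: measurable_fun_ler.
by apply/measurable_EFinP; apply: measurableT_comp => //; exact: measurable_ln.
Qed.

(** The point is the case of infinite [\int f], which corresponds to determinant 0. The positive
    part of [a - f] is at most [a], so the negative part carries the infinite mass and both sides
    are [-oo]. *)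
Lemma ge0_integral_cst_sub (a : R) (f : T -> \bar R) : 0 <= a ->
  measurable_fun setT f -> (forall x, 0 <= f x)%E ->
  (\int[nu]_x (a%:E - f x) = a%:E - \int[nu]_x f x)%E.
Proof.
move=> a0 mf f0.
have nuT : (nu : {measure set T -> \bar R}) setT = 1%E := probability_setT nu.
have ia : nu.-integrable setT (cst a%:E).
  exact: finite_measure_integrable_cst.
have ea : (\int[nu]_x (cst a%:E) x = a%:E)%E by rewrite integral_cst// nuT mule1.
have if0 : (0 <= \int[nu]_x f x)%E by exact: integral_ge0.
have [foo|] := ltP (\int[nu]_x f x)%E +oo%E.
  have fi : nu.-integrable setT f.
    apply/integrableP; split=> //.
    by under eq_integral do rewrite gee0_abs//.
  by rewrite -[in RHS]ea -integralB.
rewrite leye_eq => /eqP foo; rewrite foo /=.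
have mg : measurable_fun setT (fun x => a%:E - f x)%E by exact: emeasurable_funB.
rewrite integralE.
have p1 : (\int[nu]_x (fun x => a%:E - f x)^\+ x <= a%:E)%E.
  rewrite -[leRHS]ea; apply: ge0_le_integral => //; first exact: measurable_funepos.
  move=> x _; rewrite funeposE ge_max lee_fin a0 andbT.
  by rewrite -[leRHS]sube0 leeB.
have p0 : (0 <= \int[nu]_x (fun x => a%:E - f x)^\+ x)%E by exact: integral_ge0.
have n1 : (\int[nu]_x f x <= \int[nu]_x ((fun x => a%:E - f x)^\- x + cst a%:E x))%E.
  apply: ge0_le_integral => //.
  - by apply: emeasurable_funD => //; exact: measurable_funeneg.
  - move=> x _ /=; rewrite funenegE.
    apply: le_trans (_ : - (a%:E - f x) + a%:E <= _)%E; last first.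
      by apply: leeD2r; rewrite le_max lexx.
    by case: (f x) (f0 x) => [y| |]// _ /=; rewrite lee_fin; lra.
rewrite foo ge0_integralD// in n1; last exact: measurable_funeneg.
have -> : (\int[nu]_x (fun x => a%:E - f x)^\- x = +oo)%E.
  apply/eqP; rewrite -leye_eq; move: n1; rewrite ea leye_eq.
  by case: (\int[nu]_x _)%E => //.
by case: (\int[nu]_x _)%E p1 p0 => //.
Qed.

Lemma log_reg_pointwise (z : T -> R) (c : R) x : 0 < c -> 0 <= z x ->
  (log_reg z c n.+1%:R^-1 x)%:E @[n --> \oo] --> (- lne (c ^+ 2 * z x ^+ 2)%:E)%E.
Proof.
move=> c0 z0; have c2 : 0 < c ^+ 2 by rewrite exprn_gt0.
have [E|zn] := eqVneq (z x) 0.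
  rewrite E expr0n mulr0 /= lexx /=.
  apply/cvgeryP/cvgryPge => A.
  exists (Num.truncn (c ^+ 2 * expR A)).+1 => // n /= Nn.
  rewrite /log_reg E expr0n addr0 lerNr -[leRHS](expRK (- A)) ler_ln ?posrE ?expR_gt0//.
    rewrite expRN ler_pdivrMr// ler_pdivlMl ?expR_gt0// mulrC.
    apply: ltW; apply: lt_le_trans (truncnS_gt _) _.
    by rewrite ler_nat (leq_trans Nn).
  by rewrite divr_gt0.
have zp : 0 < c ^+ 2 * z x ^+ 2 by rewrite mulr_gt0// exprn_gt0// lt_neqAle eq_sym zn.
rewrite lne_EFin// -EFinN.
have h1 : c ^+ 2 * (n.+1%:R^-1 + z x ^+ 2) @[n --> \oo] --> c ^+ 2 * z x ^+ 2.
  apply: cvgMl_tmp; rewrite -[X in _ --> X]add0r; apply: cvgD; last exact: cvg_cst.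
  exact: cvg_harmonic.
have h2 := cvgN (cvg_comp _ _ h1 (continuous_ln zp)).
by apply: cvg_EFin; [near=> n | exact: h2].
Unshelve. all: by end_near. Qed.

Lemma log_reg_cvg (z : T -> R) (c : R) : measurable_fun setT z -> 0 < c ->
  (forall x, 0 <= z x) -> (forall x, c ^+ 2 * (1 + z x ^+ 2) <= 1) ->
  (\int[nu]_x log_reg z c n.+1%:R^-1 x)%:E @[n --> \oo] -->
  (\int[nu]_x - lne (c ^+ 2 * z x ^+ 2)%:E)%E.
Proof.
move=> mz c0 z0 zle.
have n0 n : 0 < n.+1%:R^-1 :> R by [].
have n1 n : n.+1%:R^-1 <= 1 :> R by rewrite invf_le1 ?ltr0n// ler1n.
have mr n : measurable_fun setT (fun x => (log_reg z c n.+1%:R^-1 x)%:E).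
  by apply/measurable_EFinP; exact: measurable_log_reg.
have rE n : (\int[nu]_x log_reg z c n.+1%:R^-1 x)%:E =
    (\int[nu]_x (log_reg z c n.+1%:R^-1 x)%:E)%E.
  rewrite fineK//; apply: integrable_fin_num => //.
  apply: (@bounded_integrable _ _ _ _ _ (- ln (c ^+ 2 * n.+1%:R^-1))).
    exact: measurable_log_reg.
  move=> x; rewrite ger0_norm; last exact: (log_reg_ge0 c0 zle (n1 n)).
  rewrite /log_reg lerN2 ler_ln ?posrE ?mulr_gt0 ?exprn_gt0//.
    by rewrite ler_pM2l ?exprn_gt0// lerDl sqr_ge0.
  by rewrite ltr_pwDl ?sqr_ge0.
under eq_cvg do rewrite rE.
have -> : (\int[nu]_x - lne (c ^+ 2 * z x ^+ 2)%:E =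
    \int[nu]_x limn (fun n => (log_reg z c n.+1%:R^-1 x)%:E))%E.
  apply: eq_integral => x _; apply/esym/cvg_lim => //.
  exact: log_reg_pointwise.
apply: cvg_monotone_convergence => //.
- by move=> n x _; rewrite lee_fin; exact: (log_reg_ge0 c0 zle (n1 n)).
- move=> x _ a b ab; rewrite lee_fin /log_reg lerN2.
  have p k : 0 < c ^+ 2 * (k.+1%:R^-1 + z x ^+ 2).
    by rewrite mulr_gt0 ?exprn_gt0// ltr_pwDl ?sqr_ge0.
  rewrite ler_ln ?posrE// ler_pM2l ?exprn_gt0// lerD2r.
  by rewrite lef_pV2 ?posrE ?ltr0n// ler_nat.
Qed.

(** After scaling by [c], [- lne (c z)] is nonnegative and [- ln c >= 0], so the constant can be
    split off without knowing that the logarithm is integrable. *)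
Lemma integral_lne_scale (z : T -> R) (c : R) : measurable_fun setT z -> 0 < c ->
  (forall x, 0 <= z x) -> (forall x, c ^+ 2 * (1 + z x ^+ 2) <= 1) ->
  (\int[nu]_x lne (z x)%:E =
   (- ln c)%:E - 2^-1%:E * \int[nu]_x - lne (c ^+ 2 * z x ^+ 2)%:E)%E.
Proof.
move=> mz c0 z0 zle.
have c2 : 0 < c ^+ 2 by rewrite exprn_gt0.
have c0' := ltW c0; have c2' := ltW c2.
have c1 : c <= 1.
  rewrite -(@ler_pXn2r _ 2)// ?nnegrE// expr1n; apply: le_trans (zle point).
  by rewrite ler_peMr// lerDl sqr_ge0.
have mf : measurable_fun setT (fun x => - lne (c * z x)%:E)%E.
  by apply: measurableT_comp => //; apply: measurable_lne; exact: measurable_funM.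
have f0 x : (0 <= - lne (c * z x)%:E)%E.
  rewrite oppe_ge0 lne_le0 lee_fin -(@ler_pXn2r _ 2)// ?nnegrE ?mulr_ge0//.
  rewrite expr1n exprMn; apply: le_trans (zle x); rewrite ler_wpM2l//.
  by rewrite lerDr.
have -> : (\int[nu]_x - lne (c ^+ 2 * z x ^+ 2)%:E =
    2%:E * \int[nu]_x - lne (c * z x)%:E)%E.
  rewrite -ge0_integralZl//; apply: eq_integral => x _.
  have [E|zn] := eqVneq (z x) 0.
    by rewrite E expr0n !mulr0 /= lexx /= gt0_muley// lte_fin.
  have zp : 0 < c * z x by rewrite mulr_gt0// lt_neqAle eq_sym zn/=.
  rewrite -exprMn !lne_EFin ?exprn_gt0// -!EFinN -EFinM lnXn//; congr (_%:E).
  by rewrite mulrN mulr_natl.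
rewrite muleA -EFinM mulVf// mul1e -ge0_integral_cst_sub//; last by rewrite oppr_ge0 ln_le0.
apply: eq_integral => x _; rewrite oppeK.
have [E|zn] := eqVneq (z x) 0; first by rewrite E mulr0 /= lexx.
have zp : 0 < z x by rewrite lt_neqAle eq_sym zn/=.
by rewrite !lne_EFin ?mulr_gt0// -EFinD lnM ?posrE// addKr.
Qed.

End LogLimit.

(** The degree tends to infinity first, at fixed [eps], and removes [K r^n]; then
    [eps = 1 / (n + 1)] tends to 0 and removes [del]. The two limits may be [+oo] and are identified
    by uniqueness of limits in the extended reals. *)
Theorem integral_lne_eq {R : realType} {d1 d2 : measure_display}
    {T1 : measurableType d1} {T2 : measurableType d2}
    (nu1 : probability T1 R) (nu2 : probability T2 R)
    (z1 : T1 -> R) (z2 : T2 -> R) (c K : R) (del : R -> R) :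
  measurable_fun setT z1 -> measurable_fun setT z2 -> 0 < c -> 0 <= K ->
  (forall x, 0 <= z1 x) -> (forall x, c ^+ 2 * (1 + z1 x ^+ 2) <= 1) ->
  (forall x, 0 <= z2 x) -> (forall x, c ^+ 2 * (1 + z2 x ^+ 2) <= 1) ->
  (forall eps n, 0 < eps -> eps <= 1 ->
    `|\sum_(k < n) k.+1%:R^-1 * \int[nu1]_x (1 - c ^+ 2 * (eps + z1 x ^+ 2)) ^+ k.+1 -
      \sum_(k < n) k.+1%:R^-1 * \int[nu2]_x (1 - c ^+ 2 * (eps + z2 x ^+ 2)) ^+ k.+1| <=
    del eps + K * (1 - c ^+ 2 * eps) ^+ n) ->
  del n.+1%:R^-1 @[n --> \oo] --> (0 : R) ->
  (\int[nu1]_x lne (z1 x)%:E = \int[nu2]_x lne (z2 x)%:E)%E.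
Proof.
move=> mz1 mz2 c0 K0 z10 z1le z20 z2le H del0.
have c2 : 0 < c ^+ 2 by rewrite exprn_gt0.
rewrite (integral_lne_scale nu1 mz1 c0)// (integral_lne_scale nu2 mz2 c0)//.
congr (_ - _ * _)%E.
have L1 := log_reg_cvg (nu := nu1) mz1 c0 z10 z1le.
have L2 := log_reg_cvg (nu := nu2) mz2 c0 z20 z2le.
pose I1 n := \int[nu1]_x log_reg z1 c n.+1%:R^-1 x.
pose I2 n := \int[nu2]_x log_reg z2 c n.+1%:R^-1 x.
have I12 n : `|I1 n - I2 n| <= del n.+1%:R^-1.
  set eps := n.+1%:R^-1.
  have e0 : 0 < eps by rewrite invr_gt0 ltr0n.
  have e1 : eps <= 1 by rewrite invf_le1 ?ltr0n// ler1n.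
  pose r := 1 - c ^+ 2 * eps.
  have r1 : r < 1 by rewrite ltrBlDr ltrDl mulr_gt0.
  have r0 : 0 <= r.
    rewrite subr_ge0; apply: le_trans (z1le point); rewrite ler_pM2l//.
    by apply: le_trans e1 _; rewrite lerDl sqr_ge0.
  (* [K] comes from the hypothesis, and [(1 - r)^-1] once from each of the two truncated series. *)
  apply: (@le_add_geometric _ _ _ (K + 2 * (1 - r)^-1) r) => //.
    by rewrite addr_ge0// mulr_ge0// invr_ge0 subr_ge0 ltW.
  move=> m.
  have h1 := log_reg_series nu1 mz1 c0 z1le e0 e1 m.
  have h2 := log_reg_series nu2 mz2 c0 z2le e0 e1 m.
  have h3 := H eps m e0 e1.
  rewrite -/r in h1 h2 h3.
  move: h1 h2 h3; rewrite /I1 /I2 -/eps.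
  set a := \sum_(k < m) _; set b := \sum_(k < m) _.
  set i1 := \int[nu1]_x _; set i2 := \int[nu2]_x _.
  rewrite !ler_norml => /andP[h1 h1'] /andP[h2 h2'] /andP[h3 h3'].
  by apply/andP; split; rewrite ?mulrDl; nra.
have L3 : (I1 n - I2 n)%:E @[n --> \oo] --> 0%E.
  apply: cvg_EFin; first by near=> n.
  apply/cvgr0Pnorm_lt => e e0.
  move/cvgr0Pnorm_lt : del0 => /(_ _ e0) [N _ HN].
  by exists N => // n /HN /=; apply: le_lt_trans; apply: le_trans (I12 n) (ler_norm _).
have L4 : (I1 n)%:E @[n --> \oo] -->
    (\int[nu2]_x - lne (c ^+ 2 * z2 x ^+ 2)%:E + 0)%E.
  have -> : (fun n => (I1 n)%:E) = (fun n => ((I2 n)%:E + (I1 n - I2 n)%:E)%E).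
    by apply/funext => n; rewrite -EFinD addrC subrK.
  by apply: cvgeD => //; exact: fin_num_adde_defl.
by rewrite adde0 in L4; exact: (cvg_unique _ L1 L4).
Unshelve. all: by end_near. Qed.

Lemma measurable_inv {R : realType} : measurable_fun setT (@GRing.inv R).
Proof.
(* Squaring makes the base of the real power nonnegative, and the factor [x] restores the sign and
   the convention [0^-1 = 0]. *)
have -> : @GRing.inv R = (fun x => x * (x ^+ 2) `^ (-1)).
  apply/funext => x; rewrite powR_inv1 ?sqr_ge0//.
  have [->|x0] := eqVneq x 0; first by rewrite invr0 mul0r.
  by rewrite expr2 invfM mulrA divff// mul1r.
apply: measurable_funM => //.
have m2 : measurable_fun setT (fun x : R => x ^+ 2) by exact: measurable_funX.
exact: (measurableT_comp (@measurable_powR R (-1)) m2).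
Qed.

Lemma measurable_sqrt {R : realType} : measurable_fun setT (@Num.sqrt R).
Proof. by apply: continuous_measurable_fun; exact: sqrt_continuous. Qed.

(** The integral is [eps |e|^2] in the perturbation estimate. Its integrand is at most 4 and tends
    to 0 wherever [h] does not vanish. *)
Lemma cvg_regularized_inverse {R : realType} {d : measure_display}
    {T : measurableType d} (mu : probability T R) (h : T -> R) :
  measurable_fun setT h -> (forall x, 0 <= h x) -> mu [set x | h x = 0] = 0%E ->
  \int[mu]_x (n.+1%:R^-1 / (n.+1%:R^-1 / 4 + h x)) @[n --> \oo] --> (0 : R).
Proof.
move=> mh h0 hn.
pose e n : R := n.+1%:R^-1.
have e0 n : 0 < e n by rewrite invr_gt0 ltr0n.
have den n x : 0 < e n / 4 + h x by rewrite ltr_pwDl// divr_gt0.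
pose f n x := e n / (e n / 4 + h x).
have mf n : measurable_fun setT (f n).
  apply: measurable_funM => //; apply: measurableT_comp; first exact: measurable_inv.
  exact: measurable_funD.
have f_ge0 n x : 0 <= f n x by rewrite divr_ge0// ltW.
have f_le n x : f n x <= 4.
  by rewrite ler_pdivrMr//; have := h0 x; lra.
have H : (\int[mu]_x (f n x)%:E)%E @[n --> \oo] --> (\int[mu]_x 0%:E)%E.
  have [] := @dominated_convergence _ _ _ mu setT measurableT
    (fun n x => (f n x)%:E) (fun=> 0%E) (fun=> 4%:E) => //.
  - by move=> n; apply/measurable_EFinP.
  - exists [set x | h x = 0]; split => //.
      by have := mh measurableT [set 0] (measurable_set1 0); rewrite setTI.
    move=> x /= /not_implyP[_ ncv]; have [//|hx] := eqVneq (h x) 0.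
    exfalso; apply: ncv.
    apply: cvg_EFin; first by near=> n.
    have h1 : e n @[n --> \oo] --> (0 : R) by exact: cvg_harmonic.
    have h2 : e n / 4 + h x @[n --> \oo] --> 0 / 4 + h x.
      by apply: cvgD; [exact: (@cvgMr_tmp _ _ _ _ e 0 4^-1 h1) | exact: cvg_cst].
    rewrite mul0r add0r in h2.
    have h3 := cvgM h1 (cvgV hx h2).
    by rewrite mul0r in h3; exact: h3.
  - exact: finite_measure_integrable_cst.
  - by apply: aeW => x n _; rewrite gee0_abs ?lee_fin.
rewrite integral0 in H.
exact: (fine_cvg H).
Unshelve. all: by end_near. Qed.

(** * Words and measurability of the relation *)

Section StandardBorel.
Context {R : realType} {d : measure_display} {X : measurableType d}.

(** By the Hausdorff property, the complement of the diagonal is a union of products of disjoint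
    basic open sets, and a countable basis leaves countably many of them. Measurability of the
    relation and of fixed-point sets of words depends on this. *)
Lemma measurable_diagonal : standard_borel R X ->
  measurable [set p : X * X | p.1 = p.2].
Proof.
move=> [Y [hY [B cB [Bo Bb]] [h [g hK gK] hA]]].
have mO (U : set Y) : open U -> measurable (h @^-1` U).
  move=> oU; apply/hA; rewrite image_preimage; first exact: sub_gen_smallest.
  by apply/seteqP; split => // y _; exists (g y).
have /countable_injP[f finj] := cB.
pose en n : set Y := if pselect (exists2 U, B U & f U = n) is left e
  then projT1 (cid2 e) else set0.
have en_open n : open (en n).
  by rewrite /en; case: pselect => [e|_]; [case: cid2 => U /= /Bo|exact: open0].
have enK U : B U -> en (f U) = U.
  move=> BU; rewrite /en; case: pselect => [e|]; last by case; exists U.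
  by case: cid2 => V /= BV fV; apply: finj; rewrite ?inE.
pose S n m : set (X * X) :=
  if en n `&` en m == set0 then h @^-1` en n `*` h @^-1` en m else set0.
rewrite (_ : [set p | _] = ~` \bigcup_n \bigcup_m S n m).
  apply: measurableC; apply: bigcupT_measurable => n; apply: bigcupT_measurable => m.
  by rewrite /S; case: ifPn => // _; apply: measurableX; exact: mO.
apply/seteqP; split => -[x y] /=.
  move=> <- [n _ [m _]]; rewrite /S; case: ifPn => // /eqP nm [/= xn xm].
  by have : (en n `&` en m) (h x) by []; rewrite nm.
apply: contra_notP => xy.
have hxy : h x != h y by apply/eqP => /(can_inj hK).
move: hY; rewrite open_hausdorff => /(_ _ _ hxy)[[U V] /= [xU yV] [oU oV UV]].
have [U' [BU' xU'] U'U] := Bb (h x) U (open_nbhs_nbhs (conj oU (set_mem xU))).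
have [V' [BV' yV'] V'V] := Bb (h y) V (open_nbhs_nbhs (conj oV (set_mem yV))).
exists (f U') => //; exists (f V') => //; rewrite /S !enK//.
rewrite ifT//; apply/eqP/seteqP; split => // t [/U'U Ut /V'V Vt].
by move/eqP : UV => <-.
Qed.

End StandardBorel.

Section Words.
Context {R : realType} {d : measure_display} {X : measurableType d}.
Context {mu : {measure set X -> \bar R}}.
Context {I : countType} (Lam : I -> partial_iso mu).
Implicit Types (l : I * bool) (w : word (I := I)) (x y z : X).

Definition letter_dom l : set X := if l.2 then pdom (Lam l.1) else prng (Lam l.1).
Definition letter_fun l : X -> X := if l.2 then pfun (Lam l.1) else Defs.pinv (Lam l.1).
Definition letter_inv l : I * bool := (l.1, ~~ l.2).

#[local] Arguments letter_act : simpl never.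

Lemma letter_actE l x : letter_act Lam l x =
  if x \in letter_dom l then Some (letter_fun l x) else None.
Proof. by rewrite /letter_act /letter_dom /letter_fun; case: l.2. Qed.

Lemma letter_invK l : letter_inv (letter_inv l) = l.
Proof. by case: l => i b; rewrite /letter_inv negbK. Qed.

Lemma letter_fun_dom l x : letter_dom l x -> letter_dom (letter_inv l) (letter_fun l x).
Proof.
rewrite /letter_dom /letter_fun /letter_inv /=; case: l.2 => /=.
- exact: pfun_prng.
- exact: pinv_pdom.
Qed.

Lemma letter_funK l x : letter_dom l x -> letter_fun (letter_inv l) (letter_fun l x) = x.
Proof.
rewrite /letter_dom /letter_fun /letter_inv /=; case: l.2 => /=.
- exact: pfunK.
- exact: Defs.pinvK.
Qed.

Lemma letter_act_inv l x y :
  letter_act Lam l x = Some y -> letter_act Lam (letter_inv l) y = Some x.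
Proof.
rewrite !letter_actE; case: ifPn => // /set_mem lx [<-].
by rewrite mem_set ?letter_funK//; exact: letter_fun_dom.
Qed.

Lemma measurable_letter_dom l : measurable (letter_dom l).
Proof.
rewrite /letter_dom; case: l.2; [exact: pdom_measurable|exact: prng_measurable].
Qed.

Lemma measurable_letter_fun l : measurable_fun (letter_dom l) (letter_fun l).
Proof.
rewrite /letter_dom /letter_fun; case: l.2; [exact: pfun_measurable|exact: pinv_measurable].
Qed.

Lemma letter_fun_image l C : C `<=` letter_dom l ->
  letter_fun l @` C = letter_dom (letter_inv l) `&` letter_fun (letter_inv l) @^-1` C.
Proof.
move=> Cl; apply/seteqP; split => [y [x Cx <-]|y [ly Cy]].
  by split; [exact/letter_fun_dom/Cl | rewrite /= letter_funK//; exact: Cl].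
exists (letter_fun (letter_inv l) y) => //.
by rewrite -{1}(letter_invK l) letter_funK.
Qed.

(** For an inverse letter, the invariance of the direct one is applied to the image set. *)
Lemma letter_fun_preserves l C : measurable C -> C `<=` letter_dom l ->
  mu (letter_fun l @` C) = mu C.
Proof.
move=> mC Cl; have [e|e] := boolP l.2.
  move: Cl; rewrite /letter_dom /letter_fun e => Cl; exact: pfun_preserves.
have mC' : measurable (letter_fun l @` C).
  by rewrite letter_fun_image//; apply: measurable_letter_fun => //;
    exact: measurable_letter_dom.
have Cl' : letter_fun l @` C `<=` pdom (Lam l.1).
  move=> _ [x Cx <-]; have := letter_fun_dom (Cl _ Cx).
  by rewrite /letter_dom /letter_inv /= e.
rewrite -(pfun_preserves mC' Cl'); congr (mu _).
have E : pfun (Lam l.1) = letter_fun (letter_inv l).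
  by rewrite /letter_fun /letter_inv /= e.
rewrite E image_comp; apply/seteqP; split => [_ [x Cx <-]|x Cx].
  by rewrite /= letter_funK//; exact: Cl.
by exists x => //=; rewrite letter_funK//; exact: Cl.
Qed.

Lemma word_act_cat w1 w2 x :
  word_act Lam (w1 ++ w2) x = obind (word_act Lam w1) (word_act Lam w2 x).
Proof.
rewrite /word_act foldr_cat; case: (foldr _ (Some x) w2) => //.
by elim: w1 => //= l w1 ->.
Qed.

Lemma word_act_inv w x y :
  word_act Lam w x = Some y -> word_act Lam (word_inv w) y = Some x.
Proof.
elim: w y => [|l w IH] y /=; first by move=> [->].
rewrite /word_inv map_cons rev_cons -cats1 word_act_cat.
case E : (word_act Lam w x) => [z|] //= /letter_act_inv ->.
exact: IH.
Qed.

Lemma gen_relP x y : gen_rel Lam x y <-> exists w, word_act Lam w x = Some y.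
Proof. by split => [[<-|//]|]; [exists [::] | right]. Qed.

Lemma gen_rel_sym x y : gen_rel Lam x y -> gen_rel Lam y x.
Proof. by move=> /gen_relP[w /word_act_inv h]; apply/gen_relP; eexists; exact: h. Qed.

Lemma gen_rel_trans x y z : gen_rel Lam x y -> gen_rel Lam y z -> gen_rel Lam x z.
Proof.
move=> /gen_relP[w wx] /gen_relP[v vy]; apply/gen_relP.
by exists (v ++ w); rewrite word_act_cat wx.
Qed.

Lemma gen_rel_letter l x : letter_dom l x -> gen_rel Lam x (letter_fun l x).
Proof. by move=> lx; apply/gen_relP; exists [:: l]; rewrite /= letter_actE mem_set. Qed.

Lemma rel_class_letter l x : letter_dom l x ->
  rel_class Lam (letter_fun l x) = rel_class Lam x.
Proof.
move=> lx; have h := gen_rel_letter lx.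
apply/seteqP; split => z; rewrite /rel_class /=.
- by move=> zl; apply: gen_rel_trans zl (gen_rel_sym h).
- by move=> zx; apply: gen_rel_trans zx h.
Qed.

Definition word_dom w : set X := [set x | word_act Lam w x].
(** The identity off the domain makes this a total map, so that measurability passes through
    composition. *)
Definition word_val w x : X := odflt x (word_act Lam w x).

Definition letter_tot l x := if x \in letter_dom l then letter_fun l x else x.
Lemma measurable_letter_tot l : measurable_fun setT (letter_tot l).
Proof.
have ml := measurable_letter_dom l.
apply: measurable_fun_if => //.
- by apply: (@measurable_fun_bool _ _ _ _ true); rewrite setTI preimage_mem_true.
- rewrite setTI preimage_mem_true; exact: measurable_letter_fun.
Qed.

Lemma measurable_word w : measurable (word_dom w) /\ measurable_fun setT (word_val w).
Proof.
elim: w => [|l w [mw mv]].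
  split; first by rewrite (_ : word_dom _ = setT)//; apply/seteqP; split.
  exact: measurable_id.
have E : word_dom (l :: w) = word_dom w `&` word_val w @^-1` letter_dom l.
  apply/seteqP; split => x; rewrite /word_dom /word_val /=;
    (case: (word_act Lam w x) => [z|] /=; last by [|case]); rewrite letter_actE.
  - by case: ifPn => // /set_mem.
  - by move=> [_ /mem_set ->].
have m1 : measurable (word_dom (l :: w)).
  rewrite E; apply: measurableI => //; rewrite -[X in measurable X]setTI.
  by apply: mv => //; exact: measurable_letter_dom.
split => //.
rewrite (_ : word_val _ = fun x => if x \in word_dom (l :: w) then
    letter_tot l (word_val w x) else x).
  apply: measurable_fun_ifT => //.
  - by apply: (@measurable_fun_bool _ _ _ _ true); rewrite setTI preimage_mem_true.
  - exact: (measurableT_comp (measurable_letter_tot l) mv).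
apply/funext => x; case: ifPn => [/set_mem|/negP].
  rewrite /word_dom /word_val /letter_tot /=.
  case: (word_act Lam w x) => [z|] //=; rewrite letter_actE.
  by case: ifPn.
rewrite inE /word_dom /word_val /=.
by case: (obind _ _).
Qed.

End Words.

Section Restriction.
Context {R : realType} {d : measure_display} {T : measurableType d}.

Lemma ge0_integral_mrestr (m : {measure set T -> \bar R}) (D : set T)
    (mD : measurable D) (f : T -> \bar R) : measurable_fun setT f ->
  (forall x, 0 <= f x)%E -> (\int[mrestr m mD]_x f x = \int[m]_(x in D) f x)%E.
Proof.
move=> mf f0.
have mDc : measurable (~` D) by exact: measurableC.
rewrite (@ge0_negligible_integral _ _ _ _ setT (~` D))//; last first.
  by rewrite /= /mrestr setICl measure0.
rewrite setDE setTI setCK.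
by apply: eq_measure_integral => C mC CD; rewrite /= /mrestr setIidl.
Qed.

End Restriction.

(** * The counting measure on the relation *)

Section LeftCounting.
Context {R : realType} {d : measure_display} {X : measurableType d}.
Context {mu : {measure set X -> \bar R}}.
Context {I : countType} (Lam : I -> partial_iso mu).
Hypothesis hX : standard_borel R X.
Implicit Types (x y z : X) (k : nat).

Let measurable_eq (d' : measure_display) (T : measurableType d') (f g : T -> X) :
  measurable_fun setT f -> measurable_fun setT g ->
  measurable [set t | f t = g t].
Proof.
move=> mf mg; have mfg : measurable_fun setT (fun t => (f t, g t)).
  exact: measurable_fun_pair.
have := mfg measurableT _ (measurable_diagonal hX).
by rewrite setTI.
Qed.

Lemma word_enumeration :
  {f : nat -> option (word (I := I)) | forall w, exists k, f k = Some w}.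
Proof. by exists unpickle => w; exists (pickle w); rewrite pickleK. Qed.

Definition nth_word k : option (word (I := I)) := sval word_enumeration k.

Lemma nth_word_surj w : exists k, nth_word k = Some w.
Proof. exact: (svalP word_enumeration). Qed.

Lemma measurable_rel_set : measurable (rel_set Lam).
Proof.
have -> : rel_set Lam = \bigcup_k (if nth_word k is Some w then
    (fst @^-1` word_dom Lam w) `&` [set p : X * X | word_val Lam w p.1 = p.2]
    else set0).
  apply/seteqP; split => [[x y]|[x y] [k _]].
    move=> /gen_relP[w wx]; have [k kw] := nth_word_surj w; exists k => //; rewrite kw.
    by rewrite /word_dom /word_val /= wx.
  move: (nth_word k) => [w|]//; rewrite /word_dom /word_val /= => -[].
  by case E : word_act => [z|] // _ <-; apply/gen_relP; exists w.
apply: bigcupT_measurable => k; move: (nth_word k) => [w|]//.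
have [m1 m2] := measurable_word Lam w.
apply: measurableI.
  by have := @measurable_fst _ _ X X measurableT _ m1; rewrite setTI.
apply: measurable_eq => //; exact: measurableT_comp.
Qed.

Definition enum_class k x : option X := obind (fun w => word_act Lam w x) (nth_word k).
Definition rep_class k x : X := odflt x (enum_class k x).
(** Different words may send [x] to the same point. Keeping the least index enumerates each class
    without repetition, measurably in [x], and turns sums over classes into series. *)
Definition first_hit k : set X :=
  [set x | enum_class k x /\ forall j, (j < k)%N -> enum_class j x <> enum_class k x].

Let measurable_enum_dom k : measurable [set x | enum_class k x].
Proof.
rewrite /enum_class; case: (nth_word k) => [w|] /=; first exact: (measurable_word Lam w).1.
by rewrite (_ : [set x | _] = set0)//; apply/seteqP; split.
Qed.

Lemma measurable_rep_class k : measurable_fun setT (rep_class k).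
Proof.
rewrite /rep_class /enum_class; move: (nth_word k) => [w|] /=.
  exact: (measurable_word Lam w).2.
exact: measurable_id.
Qed.

Lemma measurable_first_hit k : measurable (first_hit k).
Proof.
have -> : first_hit k = [set x | enum_class k x] `&`
    \bigcap_(j in [set j | (j < k)%N]) ~` ([set x | enum_class j x] `&`
       [set x | rep_class j x = rep_class k x]).
  apply/seteqP; split => x [kx h]; split => // j /= jk.
    move=> [jx]; rewrite /rep_class; move: (h j jk) jx kx.
    by case: (enum_class j x) => [a|] //; case: (enum_class k x) => [b|] //= ab _ _ e;
      apply: ab; rewrite e.
  move=> e; apply: (h j jk); split => /=; first by rewrite e.
  by rewrite /rep_class e.
apply: measurableI => //; apply: bigcap_measurableType => // j _.
apply: measurableC; apply: measurableI => //.
by apply: measurable_eq; exact: measurable_rep_class.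
Qed.

Lemma rep_class_rel k x : rel_class Lam x (rep_class k x).
Proof.
rewrite /rep_class /enum_class; move: (nth_word k) => [w|] /=; last by left.
by case E : word_act => [z|] /=; [apply/gen_rel_sym/gen_relP; exists w | left].
Qed.

Lemma rep_class_bij x :
  set_bij [set k | first_hit k x] (rel_class Lam x) (fun k => rep_class k x).
Proof.
split.
- by move=> k _; exact: rep_class_rel.
- move=> j k /set_mem [jx jmin] /set_mem [kx kmin].
  wlog jk : j k jx jmin kx kmin / (j < k)%N => [hw e|e].
    by have [jk|kj|//] := ltngtP j k; [exact: hw|exact/esym/hw].
  exfalso; apply: (kmin j jk); move: e jx kx; rewrite /rep_class.
  by case: (enum_class j x) (enum_class k x) => [a|] [b|]//= ->.
- move=> y /= /gen_rel_sym /gen_relP[w wy].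
  have ex : exists k, enum_class k x == Some y.
    by have [k kw] := nth_word_surj w; exists k; rewrite /enum_class kw /= wy.
  exists (ex_minn ex); case: ex_minnP => k /eqP ky kmin.
    split; first by rewrite ky.
    by move=> j jk; rewrite ky => /eqP /kmin; rewrite leqNgt jk.
  by rewrite /rep_class ky.
Qed.

Let pairing k x : X * X := (x, rep_class k x).
Let measurable_pairing k : measurable_fun setT (pairing k).
Proof. by apply: measurable_fun_pair => //; exact: measurable_rep_class. Qed.

Lemma class_measure_exists k : {m : {measure set (X * X) -> \bar R} |
  forall F, measurable_fun setT F -> (forall p, 0 <= F p)%E ->
    (\int[m]_p F p = \int[mu]_(x in first_hit k) F (x, rep_class k x))%E}.
Proof.
unshelve eexists; [refine (pushforward (mrestr mu (measurable_first_hit k)) (pairing k)); exact: measurable_pairing|].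
move=> F mF F0; rewrite ge0_integral_pushforward//.
rewrite preimage_setT ge0_integral_mrestr//.
- exact: measurableT_comp.
- by move=> x; exact: F0.
Qed.

(** The Feldman-Moore left counting measure, as a sum of images of [mu] under the graphs of the
    [rep_class k]. It makes the space of the relation an ordinary L^2 space, so that one integral
    replaces the integral of class sums. *)
Definition left_counting : {measure set (X * X) -> \bar R} :=
  mseries (fun k => sval (class_measure_exists k)) 0.

Lemma ge0_esum_rel_class x (u : X -> \bar R) : (forall z, 0 <= u z)%E ->
  (\esum_(z in rel_class Lam x) u z =
   \sum_(k <oo) (if x \in first_hit k then u (rep_class k x) else 0))%E.
Proof.
move=> u0; rewrite (reindex_esum _ _ _ _ (rep_class_bij x)) esum_mkcond.
rewrite nneseries_esumT; last by move=> k; case: ifPn.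
apply: eq_esum => k _; rewrite (_ : (k \in _) = (x \in first_hit k))//.
Qed.

Let series_meas (F : X * X -> \bar R) k : measurable_fun setT F ->
  measurable_fun setT
    (fun x => (if x \in first_hit k then F (x, rep_class k x) else 0)%E).
Proof.
move=> mF; apply: measurable_fun_ifT => //.
  apply: (@measurable_fun_bool _ _ _ _ true); rewrite setTI preimage_mem_true.
  exact: measurable_first_hit.
exact: (measurableT_comp mF (measurable_pairing k)).
Qed.

Lemma measurable_esum_rel_class (F : X * X -> \bar R) : measurable_fun setT F ->
  (forall p, 0 <= F p)%E ->
  measurable_fun setT (fun x => \esum_(z in rel_class Lam x) F (x, z)).
Proof.
move=> mF F0.
under eq_fun do rewrite ge0_esum_rel_class//.
apply: ge0_emeasurable_sum => //.
  by move=> k x _ _; case: ifPn.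
by move=> k _; exact: series_meas.
Qed.

Lemma ge0_integral_left_counting (F : X * X -> \bar R) : measurable_fun setT F ->
  (forall p, 0 <= F p)%E ->
  (\int[left_counting]_p F p = \int[mu]_x \esum_(z in rel_class Lam x) F (x, z))%E.
Proof.
move=> mF F0; rewrite ge0_integral_measure_series//.
under [RHS]eq_integral do rewrite ge0_esum_rel_class//.
rewrite integral_nneseries//; last 2 first.
- by move=> k; exact: series_meas.
- by move=> k x _; case: ifPn.
apply: eq_eseriesr => k _; rewrite (svalP (class_measure_exists k))//.
rewrite integral_mkcond; apply: eq_integral => x _.
by rewrite patchE.
Qed.

End LeftCounting.

(** * The Hilbert space of the relation *)

(** [class_sum] applies [fine] to sums that may be infinite at some points; integrability confines
    these points to a null set. *)
Lemma ge0_integral_fine {R : realType} {d : measure_display} {T : measurableType d}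
    (m : {measure set T -> \bar R}) (a : T -> \bar R) :
  measurable_fun setT a -> (forall x, 0 <= a x)%E -> (\int[m]_x a x < +oo)%E ->
  m.-integrable setT (EFin \o (fun x => fine (a x))) /\
  (\int[m]_x (fine (a x))%:E = \int[m]_x a x)%E.
Proof.
move=> ma a0 aoo.
have ia : m.-integrable setT a.
  apply/integrableP; split => //.
  by under eq_integral do rewrite gee0_abs//.
have mfa : measurable_fun setT (EFin \o (fun x => fine (a x))).
  by apply/measurable_EFinP; apply: measurableT_comp.
have e : ae_eq m setT (EFin \o (fun x => fine (a x))) a.
  apply: filterS (integrable_ae measurableT ia) => x /= h _.
  by rewrite fineK// h.
have E : (\int[m]_x (fine (a x))%:E = \int[m]_x a x)%E by exact: ae_eq_integral.
split => //; apply/integrableP; split => //.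
rewrite (eq_integral (fun x => (fine (a x))%:E)) ?E// => x _.
by rewrite gee0_abs// lee_fin fine_ge0.
Qed.

Section InnerProduct.
Context {R : realType} {d : measure_display} {X : measurableType d}.
Context {mu : {measure set X -> \bar R}}.
Context {I : countType} (Lam : I -> partial_iso mu).
Hypothesis hX : standard_borel R X.
Local Notation kernel := (X * X -> R[i]).
Local Notation N := (left_counting Lam hX).
Local Notation rel := (rel_set Lam).
Implicit Types (Psi Phi : kernel) (F : X * X -> R) (x y z : X).

Lemma rel_class_rel_set x z : rel_class Lam x z -> rel (x, z).
Proof. exact: gen_rel_sym. Qed.

Lemma class_sum_eq x (u v : X -> R) : (forall z, rel_class Lam x z -> u z = v z) ->
  class_sum Lam x u = class_sum Lam x v.
Proof.
move=> uv; rewrite /class_sum.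
by congr (fine _ - fine _); apply: eq_esum => z /uv ->.
Qed.

Lemma Rintegral_class_sum F : N.-integrable setT (EFin \o F) ->
  \int[mu]_x class_sum Lam x (fun z => F (x, z)) = \int[N]_p F p.
Proof.
move=> iF; have mF : measurable_fun setT F.
  by apply/measurable_EFinP; exact: (measurable_int N).
pose Fp p := (Num.max (F p) 0)%:E; pose Fn p := (Num.max (- F p) 0)%:E.
have mFp : measurable_fun setT Fp.
  by apply/measurable_EFinP; exact: measurable_maxr.
have mFn : measurable_fun setT Fn.
  by apply/measurable_EFinP; apply: measurable_maxr => //; exact: measurable_funN.
have Fp0 p : (0 <= Fp p)%E by rewrite lee_fin le_max lexx orbT.
have Fn0 p : (0 <= Fn p)%E by rewrite lee_fin le_max lexx orbT.
pose a x := (\esum_(z in rel_class Lam x) Fp (x, z))%E.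
pose b x := (\esum_(z in rel_class Lam x) Fn (x, z))%E.
have a0 x : (0 <= a x)%E by apply: esum_ge0.
have b0 x : (0 <= b x)%E by apply: esum_ge0.
have ma : measurable_fun setT a by exact: measurable_esum_rel_class.
have mb : measurable_fun setT b by exact: measurable_esum_rel_class.
have Ea : (\int[mu]_x a x = \int[N]_p Fp p)%E by rewrite ge0_integral_left_counting.
have Eb : (\int[mu]_x b x = \int[N]_p Fn p)%E by rewrite ge0_integral_left_counting.
have FpE : (EFin \o F)^\+%E = Fp.
  by apply/funext => p; rewrite funeposE /= /Fp EFin_max.
have FnE : (EFin \o F)^\-%E = Fn.
  by apply/funext => p; rewrite funenegE /= /Fn EFin_max.
have fa : (\int[mu]_x a x < +oo)%E.
  by rewrite Ea -FpE; exact: integral_funepos_lt_pinfty.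
have fb : (\int[mu]_x b x < +oo)%E.
  by rewrite Eb -FnE; exact: integral_funeneg_lt_pinfty.
have [ia ea] := ge0_integral_fine ma a0 fa.
have [ib eb] := ge0_integral_fine mb b0 fb.
have EF : (\int[N]_p (F p)%:E = \int[N]_p Fp p - \int[N]_p Fn p)%E.
  by rewrite -FpE -FnE -integralE.
rewrite /class_sum RintegralB// /Rintegral ea eb Ea Eb EF; apply/esym/fineB.
- by rewrite ge0_fin_numE ?integral_ge0// -Ea.
- by rewrite ge0_fin_numE ?integral_ge0// -Eb.
Qed.

(** Kernels are constrained only on the relation; the cut-off gives functions measurable on the
    whole product. *)
Definition rel_restrict (F : X * X -> R) : X * X -> R := F \_ rel.

Lemma measurable_rel_restrict F : measurable_fun rel F ->
  measurable_fun setT (rel_restrict F).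
Proof. by move/(measurable_restrictT _ (measurable_rel_set Lam hX)). Qed.

Lemma rel_restrictE F p : rel p -> rel_restrict F p = F p.
Proof. by move=> h; rewrite /rel_restrict patchE mem_set. Qed.

Definition sqnorm (c : R[i]) : R := complex.Re c ^+ 2 + complex.Im c ^+ 2.

Lemma normc_sqr (c : R[i]) : Normc.normc c ^+ 2 = sqnorm c.
Proof. by case: c => a b; rewrite /sqnorm sqr_sqrtr// addr_ge0// sqr_ge0. Qed.

Lemma sqnorm_ge0 c : 0 <= sqnorm c.
Proof. by rewrite addr_ge0// sqr_ge0. Qed.

Definition rdot Psi Phi (p : X * X) : R :=
  complex.Re (Psi p) * complex.Re (Phi p) + complex.Im (Psi p) * complex.Im (Phi p).

Lemma rdotE Psi Phi p : complex.Re (Psi p * conjc (Phi p)) = rdot Psi Phi p.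
Proof. by rewrite /rdot; case: (Psi p) (Phi p) => a b [a' b'] /=; ring. Qed.

Lemma measurable_rdot Psi Phi : cmeasurable_fun rel Psi -> cmeasurable_fun rel Phi ->
  measurable_fun rel (rdot Psi Phi).
Proof.
by move=> [m1 m2] [m3 m4]; apply: measurable_funD; apply: measurable_funM.
Qed.

Lemma normL2sqE Psi : cmeasurable_fun rel Psi ->
  normL2sq Lam Psi = (\int[N]_p (rel_restrict (rdot Psi Psi) p)%:E)%E.
Proof.
move=> mPsi; rewrite ge0_integral_left_counting; last 2 first.
- by apply/measurable_EFinP; apply: measurable_rel_restrict; exact: (measurable_rdot mPsi mPsi).
- move=> p; rewrite /rel_restrict patchE lee_fin; case: ifPn => // _.
  by rewrite /rdot -!expr2 addr_ge0// sqr_ge0.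
apply: eq_integral => x _; apply: eq_esum => z /rel_class_rel_set h.
by rewrite rel_restrictE// normc_sqr /sqnorm /rdot -!expr2.
Qed.

Lemma rdot_integrable Psi Phi : L2 Lam Psi -> L2 Lam Phi ->
  N.-integrable setT (EFin \o rel_restrict (rdot Psi Phi)).
Proof.
move=> [m1 f1] [m2 f2]; rewrite !normL2sqE// in f1 f2.
have mr (P Q : kernel) : cmeasurable_fun rel P -> cmeasurable_fun rel Q ->
    measurable_fun setT (EFin \o rel_restrict (rdot P Q)).
  by move=> mP mQ; apply/measurable_EFinP; apply: measurable_rel_restrict; exact: measurable_rdot.
have r0 (P : kernel) p : (0 <= (rel_restrict (rdot P P) p)%:E)%E.
  rewrite /rel_restrict patchE lee_fin; case: ifPn => // _.
  by rewrite /rdot -!expr2 addr_ge0// sqr_ge0.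
have i (P : kernel) : cmeasurable_fun rel P ->
    (\int[N]_p (rel_restrict (rdot P P) p)%:E < +oo)%E ->
    N.-integrable setT (EFin \o rel_restrict (rdot P P)).
  move=> mP fP; apply/integrableP; split; first exact: mr.
  rewrite (eq_integral (fun p => (rel_restrict (rdot P P) p)%:E))// => p _.
  by rewrite gee0_abs//; exact: r0.
have := integrableD measurableT (i _ m1 f1) (i _ m2 f2).
apply: le_integrable => //; first exact: mr.
move=> p _ /=; rewrite lee_fin [leRHS]ger0_norm; last first.
  by rewrite addr_ge0// -lee_fin; exact: r0.
rewrite /rel_restrict !patchE; case: ifPn => _; last by rewrite normr0 addr0.
rewrite /rdot; case: (Psi p) (Phi p) => a b [a' b'] /=.
rewrite ler_norml; apply/andP; split.
- have : 0 <= (a + a') ^+ 2 + (b + b') ^+ 2 by rewrite addr_ge0 ?sqr_ge0.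
  have : 0 <= a ^+ 2 + a' ^+ 2 + b ^+ 2 + b' ^+ 2 by rewrite !addr_ge0 ?sqr_ge0.
  nra.
- have : 0 <= (a - a') ^+ 2 + (b - b') ^+ 2 by rewrite addr_ge0 ?sqr_ge0.
  have : 0 <= a ^+ 2 + a' ^+ 2 + b ^+ 2 + b' ^+ 2 by rewrite !addr_ge0 ?sqr_ge0.
  nra.
Qed.

(** The relation space viewed as a real Hilbert space: spectral measures and the trace enter the
    determinant only through real parts. *)
Definition rinner Psi Phi : R := complex.Re (inner Lam Psi Phi).

Lemma rinnerE Psi Phi : L2 Lam Psi -> L2 Lam Phi ->
  rinner Psi Phi = \int[N]_p rel_restrict (rdot Psi Phi) p.
Proof.
move=> h1 h2; rewrite -Rintegral_class_sum; last exact: rdot_integrable.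
rewrite /rinner /inner /=; apply: eq_Rintegral => x _.
by apply: class_sum_eq => z /rel_class_rel_set h; rewrite rel_restrictE// rdotE.
Qed.

End InnerProduct.

Section L2Space.
Context {R : realType} {d : measure_display} {X : measurableType d}.
Context {mu : {measure set X -> \bar R}}.
Context {I : countType} (Lam : I -> partial_iso mu).
Hypothesis hX : standard_borel R X.
Local Notation kernel := (X * X -> R[i]).
Local Notation N := (left_counting Lam hX).
Local Notation rel := (rel_set Lam).
Local Notation L2 := (L2 Lam).
Local Notation rinner := (rinner Lam).
Implicit Types (Psi Phi Xi : kernel).

Lemma cReD (a b : R[i]) : complex.Re (a + b) = complex.Re a + complex.Re b.
Proof. by case: a b => ? ? []. Qed.
Lemma cImD (a b : R[i]) : complex.Im (a + b) = complex.Im a + complex.Im b.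
Proof. by case: a b => ? ? []. Qed.
Lemma cReM (a b : R[i]) : complex.Re (a * b) =
  complex.Re a * complex.Re b - complex.Im a * complex.Im b.
Proof. by case: a b => ? ? []. Qed.
Lemma cImM (a b : R[i]) : complex.Im (a * b) =
  complex.Re a * complex.Im b + complex.Im a * complex.Re b.
Proof. by case: a b => ? ? []. Qed.

Lemma sqnormM (a b : R[i]) : sqnorm (a * b) = sqnorm a * sqnorm b.
Proof. by rewrite /sqnorm cReM cImM; ring. Qed.

Lemma sqnormD_le (a b : R[i]) : sqnorm (a + b) <= 2 * (sqnorm a + sqnorm b).
Proof.
rewrite /sqnorm cReD cImD.
have := sqr_ge0 (complex.Re a - complex.Re b); have := sqr_ge0 (complex.Im a - complex.Im b).
nra.
Qed.

Lemma cmeasurableD (d' : measure_display) (T : measurableType d') (D : set T)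
    (u v : T -> R[i]) : cmeasurable_fun D u -> cmeasurable_fun D v ->
  cmeasurable_fun D (u \+ v).
Proof.
move=> [m1 m2] [m3 m4]; split.
- rewrite (_ : (fun _ => _) = (fun x => complex.Re (u x) + complex.Re (v x))).
    exact: measurable_funD.
  by apply/funext => x; rewrite cReD.
- rewrite (_ : (fun _ => _) = (fun x => complex.Im (u x) + complex.Im (v x))).
    exact: measurable_funD.
  by apply/funext => x; rewrite cImD.
Qed.

Lemma cmeasurableM (d' : measure_display) (T : measurableType d') (D : set T)
    (u v : T -> R[i]) : cmeasurable_fun D u -> cmeasurable_fun D v ->
  cmeasurable_fun D (fun x => u x * v x).
Proof.
move=> [m1 m2] [m3 m4]; split.
- rewrite (_ : (fun _ => _) = (fun x => complex.Re (u x) * complex.Re (v x) -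
    complex.Im (u x) * complex.Im (v x))).
    by apply: measurable_funB; exact: measurable_funM.
  by apply/funext => x; rewrite cReM.
- rewrite (_ : (fun _ => _) = (fun x => complex.Re (u x) * complex.Im (v x) +
    complex.Im (u x) * complex.Re (v x))).
    by apply: measurable_funD; exact: measurable_funM.
  by apply/funext => x; rewrite cImM.
Qed.

Lemma cmeasurable_cst (d' : measure_display) (T : measurableType d') (D : set T)
  (a : R[i]) : cmeasurable_fun D (fun=> a).
Proof. by split; exact: measurable_cst. Qed.

Lemma rdot_self Psi p : rdot Psi Psi p = sqnorm (Psi p).
Proof. by rewrite /rdot /sqnorm -!expr2. Qed.

Lemma normL2sq_le (K : R) Psi Phi : cmeasurable_fun rel Psi -> cmeasurable_fun rel Phi ->
  0 <= K -> (forall p, rel p -> sqnorm (Psi p) <= K * sqnorm (Phi p)) ->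
  (normL2sq Lam Psi <= K%:E * normL2sq Lam Phi)%E.
Proof.
move=> m1 m2 K0 h; rewrite !(normL2sqE hX)//.
have mr (P : kernel) : cmeasurable_fun rel P ->
    measurable_fun setT (EFin \o rel_restrict Lam (rdot P P)).
  move=> mP; apply/measurable_EFinP; apply: measurable_rel_restrict => //.
  exact: measurable_rdot.
have r0 (P : kernel) p : (0 <= (rel_restrict Lam (rdot P P) p)%:E)%E.
  rewrite /rel_restrict patchE lee_fin; case: ifPn => // _.
  by rewrite rdot_self sqnorm_ge0.
rewrite -ge0_integralZl//; last exact: mr.
apply: ge0_le_integral => //.
- exact: mr.
- by apply: emeasurable_funM => //; exact: mr.
- move=> p _; rewrite -EFinM lee_fin /rel_restrict !patchE.
  by case: ifPn => [/set_mem rp|_]; rewrite ?mulr0// !rdot_self; exact: h.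
Qed.

Lemma L2_scale a Psi : L2 Psi -> L2 (a \*o Psi).
Proof.
move=> [m f]; have m' : cmeasurable_fun rel (a \*o Psi).
  exact: (cmeasurableM (cmeasurable_cst _ a) m).
split => //; apply: le_lt_trans (normL2sq_le m' m (sqnorm_ge0 a) _) _.
  by move=> p _; rewrite /= sqnormM.
case: (normL2sq Lam Psi) f => [y _| |]//=; first by rewrite -EFinM ltry.
have [->|a0] := eqVneq (sqnorm a) 0; first by rewrite mul0e.
by rewrite gt0_muleNy ?ltNyr// lte_fin lt_neqAle eq_sym a0 sqnorm_ge0.
Qed.

Lemma L2_add Psi Phi : L2 Psi -> L2 Phi -> L2 (Psi \+ Phi).
Proof.
move=> h1 h2; have [m1 f1] := h1; have [m2 f2] := h2.
have m' : cmeasurable_fun rel (Psi \+ Phi) by exact: cmeasurableD.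
split => //; rewrite (normL2sqE hX)//.
have i1 := rdot_integrable hX h1 h1; have i2 := rdot_integrable hX h2 h2.
have i := integrableZl measurableT 2 (integrableD measurableT i1 i2).
have /integrableP[_] : N.-integrable setT (EFin \o rel_restrict Lam (rdot (Psi \+ Phi) (Psi \+ Phi))).
  apply: le_integrable i => //.
    apply/measurable_EFinP; apply: measurable_rel_restrict => //.
    exact: measurable_rdot.
  move=> p _ /=; rewrite lee_fin /rel_restrict !patchE; case: ifPn => _; last first.
    by rewrite normr0 addr0 mulr0 normr0.
  rewrite !rdot_self !ger0_norm ?sqnorm_ge0//; first exact: sqnormD_le.
  by rewrite mulr_ge0// addr_ge0 ?sqnorm_ge0.
apply: le_lt_trans; apply: ge0_le_integral => //.
- move=> p _; rewrite lee_fin /rel_restrict patchE; case: ifPn => // _.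
  by rewrite rdot_self sqnorm_ge0.
- apply/measurable_EFinP; apply: measurable_rel_restrict => //; exact: measurable_rdot.
- apply: measurableT_comp => //.
  apply/measurable_EFinP; apply: measurable_rel_restrict => //; exact: measurable_rdot.
- by move=> p _; rewrite lee_fin ler_norm.
Qed.

Lemma rinnerC Psi Phi : L2 Psi -> L2 Phi -> rinner Psi Phi = rinner Phi Psi.
Proof.
move=> h1 h2; rewrite !(rinnerE hX)//; apply: eq_Rintegral => p _.
by rewrite /rel_restrict !patchE; case: ifPn => // _; rewrite /rdot; ring.
Qed.

Lemma rinnerDl Psi Phi Xi : L2 Psi -> L2 Phi -> L2 Xi ->
  rinner (Psi \+ Phi) Xi = rinner Psi Xi + rinner Phi Xi.
Proof.
move=> h1 h2 h3; rewrite !(rinnerE hX)//; last exact: L2_add.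
rewrite -RintegralD//; [|exact: rdot_integrable|exact: rdot_integrable].
apply: eq_Rintegral => p _; rewrite /rel_restrict !patchE; case: ifPn => _.
  by rewrite /rdot cReD cImD; ring.
by rewrite addr0.
Qed.

Lemma rinnerZl (r : R) Psi Xi : L2 Psi -> L2 Xi ->
  rinner (r%:C%C \*o Psi) Xi = r * rinner Psi Xi.
Proof.
move=> h1 h2; rewrite !(rinnerE hX)//; last exact: L2_scale.
rewrite -RintegralZl//; last exact: rdot_integrable.
apply: eq_Rintegral => p _; rewrite /rel_restrict !patchE; case: ifPn => _.
  by rewrite /rdot cReM cImM /=; ring.
by rewrite mulr0.
Qed.

Lemma rinner_ge0 Psi : L2 Psi -> 0 <= rinner Psi Psi.
Proof.
move=> h; rewrite (rinnerE hX)//; apply: Rintegral_ge0 => p _.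
rewrite /rel_restrict patchE; case: ifPn => // _.
by rewrite rdot_self sqnorm_ge0.
Qed.

Lemma normL2sq_rinner Psi : L2 Psi -> normL2sq Lam Psi = (rinner Psi Psi)%:E.
Proof.
move=> h; rewrite (rinnerE hX)// fineK; last first.
  by apply: integrable_fin_num => //; exact: rdot_integrable.
by rewrite (normL2sqE hX)//; exact: h.1.
Qed.

Lemma rinner_CS Psi Phi : L2 Psi -> L2 Phi ->
  rinner Psi Phi ^+ 2 <= rinner Psi Psi * rinner Phi Phi.
Proof.
move=> h1 h2; apply: discriminant_le => r.
have h3 := L2_scale r%:C%C h2; have h4 := L2_add h1 h3.
have := rinner_ge0 h4.
rewrite (rinnerDl h1 h3 h4) (rinnerZl _ h2 h4) (rinnerC h1 h4) (rinnerC h2 h4).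
rewrite (rinnerDl h1 h3 h1) (rinnerDl h1 h3 h2) (rinnerZl _ h2 h1) (rinnerZl _ h2 h2).
rewrite (rinnerC h2 h1); move: (rinner Psi Psi) (rinner Psi Phi) (rinner Phi Phi).
by move=> x y z; congr (_ <= _); ring.
Qed.

Lemma rinner_addE Psi Phi : L2 Psi -> L2 Phi ->
  rinner (Psi \+ Phi) (Psi \+ Phi) = rinner Psi Psi + rinner Phi Phi + 2 * rinner Psi Phi.
Proof.
move=> h1 h2; have h3 := L2_add h1 h2.
rewrite (rinnerDl h1 h2 h3) (rinnerC h1 h3) (rinnerC h2 h3) (rinnerDl h1 h2 h1).
rewrite (rinnerDl h1 h2 h2) (rinnerC h2 h1).
by move: (rinner Psi Psi) (rinner Psi Phi) (rinner Phi Phi) => x y z; ring.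
Qed.

Lemma rinner_null Psi Phi : L2 Psi -> L2 Phi -> rinner Psi Psi = 0 -> rinner Psi Phi = 0.
Proof.
move=> h1 h2 h; have := rinner_CS h1 h2; rewrite h mul0r => h'.
by apply/eqP; rewrite -sqrf_eq0 eq_le h' sqr_ge0.
Qed.

Lemma kernel_sub Psi Phi : Psi \- Phi = Psi \+ ((-1)%:C%C \*o Phi).
Proof. by apply/funext => p /=; rewrite rmorphN1 mulN1r. Qed.

Lemma eqL2_rinner Psi Phi Xi : L2 Psi -> L2 Phi -> L2 Xi -> eqL2 Lam Psi Phi ->
  rinner Psi Xi = rinner Phi Xi.
Proof.
move=> h1 h2 h3; rewrite /eqL2 kernel_sub => h.
have h2' := L2_scale (-1)%:C%C h2; have h4 := L2_add h1 h2'.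
rewrite (normL2sq_rinner h4) in h; case: h => /(rinner_null h4 h3).
rewrite (rinnerDl h1 h2' h3) (rinnerZl _ h2 h3).
by move: (rinner Psi Xi) (rinner Phi Xi) => x y; lra.
Qed.

(** Carries the vanishing of imaginary parts, which positivity of an operator includes, over to the
    real inner product. *)
Lemma Im_inner Psi Phi : complex.Im (inner Lam Psi Phi) = rinner Psi ('i%C \*o Phi).
Proof.
rewrite /rinner /inner /=; apply: eq_Rintegral => x _; apply: class_sum_eq => z _.
by case: (Psi _) (Phi _) => a b [a' b'] /=; ring.
Qed.

Lemma rinner_inner Psi Phi : rinner Psi Phi = complex.Re (inner Lam Psi Phi).
Proof. by []. Qed.

Lemma rinner_def Psi Phi : rinner Psi Phi =
  \int[mu]_x class_sum Lam x (fun z => complex.Re (Psi (x, z) * conjc (Phi (x, z)))).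
Proof. by []. Qed.

Lemma normL2sq_def Psi : normL2sq Lam Psi =
  (\int[mu]_x \esum_(z in rel_class Lam x) ((Normc.normc (Psi (x, z))) ^+ 2)%:E)%E.
Proof. by []. Qed.

Lemma L2_def Psi :
  L2 Psi <-> cmeasurable_fun rel Psi /\ (normL2sq Lam Psi < +oo)%E.
Proof. by []. Qed.

End L2Space.

(** * Translations and multiplications *)

Section ChangeOfVariables.
Context {R : realType} {d : measure_display} {X : measurableType d}.
Context {mu : {measure set X -> \bar R}}.
Context {I : countType} (Lam : I -> partial_iso mu).
Implicit Types (l : I * bool).

Lemma ge0_integral_letter l (G : X -> \bar R) :
  measurable_fun (letter_dom Lam (letter_inv l)) G -> (forall x, 0 <= G x)%E ->
  (\int[mu]_(x in letter_dom Lam l) G (letter_fun Lam l x) =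
   \int[mu]_(x in letter_dom Lam (letter_inv l)) G x)%E.
Proof.
move=> mG G0.
have mD := measurable_letter_dom Lam l.
have mD' := measurable_letter_dom Lam (letter_inv l).
pose th := letter_tot Lam l.
have mth : measurable_fun setT th by exact: measurable_letter_tot.
pose G' := G \_ (letter_dom Lam (letter_inv l)).
have mG' : measurable_fun setT G' by exact/(measurable_restrictT _ mD').
have G'0 x : (0 <= G' x)%E by rewrite /G' patchE; case: ifPn.
transitivity (\int[mu]_(x in letter_dom Lam l) G' (th x))%E.
  apply: eq_integral => x lx; rewrite /th /letter_tot lx /G' patchE mem_set//.
  exact/letter_fun_dom/set_mem.
rewrite -(@ge0_integral_mrestr _ _ _ mu _ mD (fun x => G' (th x)))//; last first.
  exact: measurableT_comp.
have -> : (\int[mrestr mu mD]_x G' (th x) =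
    \int[pushforward (mrestr mu mD) th]_x G' x)%E.
  by rewrite ge0_integral_pushforward ?preimage_setT.
rewrite [RHS]integral_mkcond -/G'.
have E : (\int[mu]_x G' x = \int[mrestr mu mD']_x G' x)%E.
  rewrite ge0_integral_mrestr// [RHS]integral_mkcond; apply: eq_integral => x _.
  by rewrite /G' !patchE; case: ifPn.
rewrite E; apply: eq_measure_integral => B mB _; rewrite /= /pushforward /mrestr.
have mB' : measurable (letter_dom Lam (letter_inv l) `&` B) by exact: measurableI.
rewrite [B `&` _]setIC -(@letter_fun_preserves _ _ _ _ _ Lam (letter_inv l) _ mB')//.
rewrite letter_fun_image// letter_invK; congr (mu _).
apply/seteqP; split => x /= [].
  rewrite /th /letter_tot => + lx; rewrite mem_set// => Bx; split => //; split => //.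
  exact: letter_fun_dom.
by move=> lx [_ Bx]; rewrite /th /letter_tot mem_set.
Qed.

Lemma Rintegral_letter l (G : X -> R) :
  measurable_fun (letter_dom Lam (letter_inv l)) G ->
  \int[mu]_(x in letter_dom Lam l) G (letter_fun Lam l x) =
  \int[mu]_(x in letter_dom Lam (letter_inv l)) G x.
Proof.
move=> mG; rewrite /Rintegral; congr fine.
rewrite integralE [RHS]integralE; congr (_ - _)%E.
- rewrite -(ge0_integral_letter (l := l) (G := (fun x => (G x)%:E)^\+%E))//.
    by apply: eq_integral => x _; rewrite !funeposE.
  by apply: measurable_funepos; exact/measurable_EFinP.
- rewrite -(ge0_integral_letter (l := l) (G := (fun x => (G x)%:E)^\-%E))//.
    by apply: eq_integral => x _; rewrite !funenegE.
  by apply: measurable_funeneg; exact/measurable_EFinP.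
Qed.

End ChangeOfVariables.

Section Operators.
Context {R : realType} {d : measure_display} {X : measurableType d}.
Context {mu : {measure set X -> \bar R}}.
Context {I : countType} (Lam : I -> partial_iso mu).
Hypothesis hX : standard_borel R X.
Local Notation kernel := (X * X -> R[i]).
Local Notation N := (left_counting Lam hX).
Local Notation rel := (rel_set Lam).
Local Notation L2 := (L2 Lam).
Local Notation rinner := (rinner Lam).
Implicit Types (Psi Phi Xi : kernel) (l : I * bool).

Lemma L_op_letterE l Psi p : L_op Lam [:: l] Psi p =
  if p.1 \in letter_dom Lam (letter_inv l)
  then Psi (letter_fun Lam (letter_inv l) p.1, p.2) else 0.
Proof. by rewrite /L_op /= /word_act /= letter_actE; case: ifPn. Qed.

Lemma measurable_class_sum (F : X * X -> R) : measurable_fun setT F ->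
  measurable_fun setT (fun x => class_sum Lam x (fun z => F (x, z))).
Proof.
move=> mF; apply: measurable_funB; apply: measurableT_comp => //.
- apply: (@measurable_esum_rel_class _ _ _ _ _ Lam hX (fun p => (Num.max (F p) 0)%:E)).
    by apply/measurable_EFinP; exact: measurable_maxr.
  by move=> p; rewrite lee_fin le_max lexx orbT.
- apply: (@measurable_esum_rel_class _ _ _ _ _ Lam hX (fun p => (Num.max (- F p) 0)%:E)).
    by apply/measurable_EFinP; apply: measurable_maxr => //; exact: measurable_funN.
  by move=> p; rewrite lee_fin le_max lexx orbT.
Qed.

Lemma class_sum0 x (u : X -> R) : (forall z, u z = 0) -> class_sum Lam x u = 0.
Proof.
move=> u0; rewrite /class_sum !esum1 ?subrr// => z _; by rewrite u0 ?oppr0 maxxx.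
Qed.

Lemma cmeasurable_L_op l Psi : cmeasurable_fun rel Psi ->
  cmeasurable_fun rel (L_op Lam [:: l] Psi).
Proof.
move=> [m1 m2].
pose D := letter_dom Lam (letter_inv l).
have mD : measurable D by exact: measurable_letter_dom.
have mr := measurable_rel_set Lam hX.
pose th (p : X * X) := (letter_tot Lam (letter_inv l) p.1, p.2).
have mth : measurable_fun setT th.
  apply: measurable_fun_pair => //.
  exact: (measurableT_comp (measurable_letter_tot Lam _) measurable_fst).
have mDp : measurable_fun rel (fun p : X * X => p.1 \in D).
  apply: measurable_funTS; apply: (@measurable_fun_bool _ _ _ _ true).
  rewrite (_ : _ @^-1` _ = fst @^-1` D).
    by have := @measurable_fst _ _ X X measurableT _ mD; rewrite setTI.
  by apply/seteqP; split => p /=; [exact: set_mem|exact: mem_set].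
have key (u : kernel -> X * X -> R) : (forall P p, P p = 0 -> u P p = 0) ->
    (forall P p, u (fun p => if p.1 \in D then P (th p) else 0) p =
      if p.1 \in D then u P (th p) else 0) ->
    measurable_fun rel (u Psi) ->
    measurable_fun rel (u (L_op Lam [:: l] Psi)).
  move=> u0 uE mu'.
  rewrite (_ : u _ = fun p => if p.1 \in D then u Psi (th p) else 0).
    apply: measurable_fun_if => //.
    apply: (measurable_comp mr _ mu').
      move=> _ [[x y] [rxy /= xD] <-]; rewrite /th /letter_tot /= xD.
      apply: gen_rel_trans rxy; apply: gen_rel_sym.
      exact/gen_rel_letter/set_mem.
    exact: measurable_funTS.
  apply/funext => p; rewrite -uE; congr (u _ _); apply/funext => q.
  by rewrite L_op_letterE /th /letter_tot; case: ifPn.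
split.
- apply: (key (fun P p => complex.Re (P p))) => //; first by move=> P p ->.
  by move=> P p; case: ifPn.
- apply: (key (fun P p => complex.Im (P p))) => //; first by move=> P p ->.
  by move=> P p; case: ifPn.
Qed.

(** A letter does not change the class over which one sums, so only the outer integral is
    transported, and the letter preserves [mu]. *)
Lemma L2_L_op l Psi : L2 Psi -> L2 (L_op Lam [:: l] Psi) /\
  (normL2sq Lam (L_op Lam [:: l] Psi) <= normL2sq Lam Psi)%E.
Proof.
move=> [m f]; have m' := cmeasurable_L_op l m.
suff h : (normL2sq Lam (L_op Lam [:: l] Psi) <= normL2sq Lam Psi)%E.
  by split => //; split => //; exact: le_lt_trans f.
pose G x := (\esum_(z in rel_class Lam x) ((Normc.normc (Psi (x, z))) ^+ 2)%:E)%E.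
have G0 x : (0 <= G x)%E by apply: esum_ge0 => z _; rewrite lee_fin sqr_ge0.
have mG : measurable_fun setT G.
  have -> : G = fun x => (\esum_(z in rel_class Lam x)
      (rel_restrict Lam (rdot Psi Psi) (x, z))%:E)%E.
    apply/funext => x; apply: eq_esum => z h.
    by rewrite rel_restrictE ?rdot_self ?normc_sqr//; exact: rel_class_rel_set.
  apply: (@measurable_esum_rel_class _ _ _ _ _ Lam hX
    (fun p => (rel_restrict Lam (rdot Psi Psi) p)%:E)).
    apply/measurable_EFinP; apply: measurable_rel_restrict => //.
    exact: measurable_rdot.
  move=> p; rewrite /rel_restrict patchE lee_fin; case: ifPn => // _.
  by rewrite rdot_self sqnorm_ge0.
have -> : normL2sq Lam (L_op Lam [:: l] Psi) =
    (\int[mu]_(x in letter_dom Lam (letter_inv l)) G (letter_fun Lam (letter_inv l) x))%E.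
  rewrite [RHS]integral_mkcond; apply: eq_integral => x _; rewrite patchE.
  case: ifPn => [/set_mem lx|lx].
    rewrite /G (rel_class_letter lx); apply: eq_esum => z _.
    by rewrite L_op_letterE /= mem_set.
  apply: esum1 => z _; rewrite L_op_letterE /= (negbTE lx).
  by rewrite normc_sqr /sqnorm /= expr0n addr0.
rewrite ge0_integral_letter//; last exact: measurable_funTS.
by apply: ge0_subset_integral => //; exact: measurable_letter_dom.
Qed.

Lemma L_op_adjoint l Psi Phi : L2 Psi -> L2 Phi ->
  rinner (L_op Lam [:: l] Psi) Phi = rinner Psi (L_op Lam [:: letter_inv l] Phi).
Proof.
move=> h1 h2.
have h1' := (L2_L_op l h1).1; have h2' := (L2_L_op (letter_inv l) h2).1.
pose F := rel_restrict Lam (rdot Psi (L_op Lam [:: letter_inv l] Phi)).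
pose G x := class_sum Lam x (fun z => F (x, z)).
have mG : measurable_fun setT G.
  apply: measurable_class_sum; apply: measurable_rel_restrict => //.
  by apply: measurable_rdot; [case: h1 | case: h2'].
transitivity (\int[mu]_(x in letter_dom Lam (letter_inv l))
    G (letter_fun Lam (letter_inv l) x)).
  rewrite (rinnerE hX)// -Rintegral_class_sum; last exact: rdot_integrable.
  rewrite [RHS]Rintegral_mkcond; apply: eq_Rintegral => x _; rewrite patchE.
  case: ifPn => [lx|lx]; last first.
    apply: class_sum0 => z; rewrite /rel_restrict patchE; case: ifPn => // _.
    by rewrite /rdot L_op_letterE /= (negbTE lx) /= !mul0r addr0.
  move/set_mem in lx.
  have -> : G (letter_fun Lam (letter_inv l) x) = class_sum Lam x
     (fun z => F (letter_fun Lam (letter_inv l) x, z)).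
    by rewrite /G /class_sum (rel_class_letter lx).
  apply: class_sum_eq => z zx.
  have zlx : rel_class Lam (letter_fun Lam (letter_inv l) x) z.
    by rewrite (rel_class_letter lx).
  rewrite /F !rel_restrictE; try exact: rel_class_rel_set.
  rewrite /rdot !L_op_letterE /= mem_set//.
  by rewrite mem_set ?letter_funK//; exact: letter_fun_dom.
rewrite Rintegral_letter; last exact: measurable_funTS.
rewrite (rinnerE hX)// -Rintegral_class_sum; last exact: rdot_integrable.
rewrite Rintegral_mkcond; apply: eq_Rintegral => x _; rewrite patchE.
case: ifPn => [//|lx]; apply/esym/class_sum0 => z.
rewrite /rel_restrict patchE; case: ifPn => // _.
by rewrite /rdot L_op_letterE /= (negbTE lx) /= !mulr0 addr0.
Qed.

End Operators.

Opaque rinner normL2sq Defs.L2.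

(** * Adjoint pairs generated by translations and multiplications *)

Section OperatorPairs.
Context {R : realType} {d : measure_display} {X : measurableType d}.
Context {mu : {measure set X -> \bar R}}.
Context {I : countType} (Lam : I -> partial_iso mu).
Hypothesis hX : standard_borel R X.
Local Notation kernel := (X * X -> R[i]).
Local Notation operator := (kernel -> kernel).
Local Notation rel := (rel_set Lam).
Local Notation L2 := (L2 Lam).
Local Notation rinner := (rinner Lam).
Implicit Types (Psi Phi Xi : kernel) (l : I * bool) (a b : operator).

(** The bound holds at every point, so that multiplications are honest maps on kernels and no null
    set has to be carried along. *)
Definition bounded_fun (f : X -> R[i]) :=
  cmeasurable_fun setT f /\ exists K, forall x, sqnorm (f x) <= K.

Lemma cmeasurable_fst (f : X -> R[i]) : cmeasurable_fun setT f ->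
  cmeasurable_fun rel (fun p : X * X => f p.1).
Proof.
move=> [m1 m2]; split; apply: measurable_funTS.
- exact: (measurableT_comp m1 measurable_fst).
- exact: (measurableT_comp m2 measurable_fst).
Qed.

Lemma L2_M_op f K Psi : cmeasurable_fun setT f -> (forall x, sqnorm (f x) <= K) ->
  L2 Psi -> L2 (M_op f Psi) /\ (normL2sq Lam (M_op f Psi) <= K%:E * normL2sq Lam Psi)%E.
Proof.
move=> mf fK h; have /L2_def[m fin] := h.
have m' : cmeasurable_fun rel (M_op f Psi).
  exact: (cmeasurableM (cmeasurable_fst mf) m).
have K0 : 0 <= K by exact: le_trans (sqnorm_ge0 _) (fK point).
have le : (normL2sq Lam (M_op f Psi) <= K%:E * normL2sq Lam Psi)%E.
  apply: normL2sq_le => // p _; rewrite /M_op sqnormM ler_wpM2r//.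
  exact: sqnorm_ge0.
split => //; apply/L2_def; split => //; apply: le_lt_trans le _.
by rewrite (normL2sq_rinner hX h) -EFinM ltry.
Qed.

Lemma M_op_adjoint f Psi Phi : bounded_fun f -> L2 Psi -> L2 Phi ->
  rinner (M_op f Psi) Phi = rinner Psi (M_op (fun x => conjc (f x)) Phi).
Proof.
move=> [mf [K fK]] h1 h2; rewrite (rinnerE hX (L2_M_op mf fK h1).1 h2).
rewrite (rinnerE hX h1); last first.
  apply: (L2_M_op (K := K) _ _ h2).1 => [|x].
    split; first by case: mf => m _; apply: eq_measurable_fun m => x _; case: (f x).
    case: mf => _ m; apply: eq_measurable_fun (measurable_funN m) => x _ /=.
    by case: (f x).
  by have := fK x; rewrite /sqnorm; case: (f x) => ? ? /=; rewrite sqrrN.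
apply: eq_Rintegral => p _; rewrite /rel_restrict !patchE; case: ifPn => // _.
rewrite /rdot /M_op; case: (f p.1) (Psi p) (Phi p) => x y [x1 y1] [x2 y2] /=; ring.
Qed.

(* Pairs of mutually adjoint operators, with both components honest maps on
   kernels, so that no quotient is needed to obtain a *-algebra. *)
Inductive fm_pair : operator -> operator -> Prop :=
| fm_letter l : fm_pair (L_op Lam [:: l]) (L_op Lam [:: letter_inv l])
| fm_mult f : bounded_fun f -> fm_pair (M_op f) (M_op (fun x => conjc (f x)))
| fm_add a a' b b' : fm_pair a a' -> fm_pair b b' ->
    fm_pair (fun Psi => a Psi \+ b Psi) (fun Psi => a' Psi \+ b' Psi)
| fm_scale (r : R) a a' : fm_pair a a' ->
    fm_pair (fun Psi => r%:C%C \*o a Psi) (fun Psi => r%:C%C \*o a' Psi)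
| fm_comp a a' b b' : fm_pair a a' -> fm_pair b b' ->
    fm_pair (a \o b) (b' \o a').

Lemma bounded_fun_conj f : bounded_fun f -> bounded_fun (fun x => conjc (f x)).
Proof.
move=> [[m1 m2] [K fK]]; split.
  split; first by apply: eq_measurable_fun m1 => x _; case: (f x).
  by apply: eq_measurable_fun (measurable_funN m2) => x _ /=; case: (f x).
by exists K => x; have := fK x; rewrite /sqnorm; case: (f x) => ? ? /=; rewrite sqrrN.
Qed.

Lemma fm_pair_sym a a' : fm_pair a a' -> fm_pair a' a.
Proof.
elim => {a a'} [l|f bf|a a' b b' _ h1 _ h2|r a a' _ h|a a' b b' _ h1 _ h2].
- by rewrite -{2}(letter_invK l); exact: fm_letter.
- have {2}-> : f = (fun x => conjc (conjc (f x))).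
    by apply/funext => x; rewrite conjcK.
  by apply: fm_mult; exact: bounded_fun_conj.
- exact: fm_add.
- exact: fm_scale.
- exact: fm_comp.
Qed.

(** Equality of functions rather than of L^2 classes; distributivity in the ring of operators
    depends on it. *)
Definition exact_linear a := (forall Psi Phi, a (Psi \+ Phi) = a Psi \+ a Phi) /\
  (forall (c : R[i]) Psi, a (c \*o Psi) = c \*o a Psi).

Lemma fm_pair_linear a a' : fm_pair a a' -> exact_linear a.
Proof.
elim => {a a'} [l|f bf|a a' b b' _ [h1 h1'] _ [h2 h2']|r a a' _ [h h']|a a' b b' _ [h1 h1'] _ [h2 h2']].
- split => [Psi Phi|c Psi]; apply/funext => p; rewrite /= !L_op_letterE.
    by case: ifPn => //; rewrite addr0.
  by case: ifPn => //; rewrite mulr0.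
- split => [Psi Phi|c Psi]; apply/funext => p; rewrite /= /M_op ?mulrDr//.
  by rewrite mulrCA.
- split => [Psi Phi|c Psi]; apply/funext => p; rewrite /= ?h1 ?h2 ?h1' ?h2' /=.
    by rewrite addrACA.
  by rewrite mulrDr.
- split => [Psi Phi|c Psi]; apply/funext => p; rewrite /= ?h ?h' /= ?mulrDr//.
  by rewrite mulrCA.
- by split => [Psi Phi|c Psi] /=; rewrite ?h1 ?h2 ?h1' ?h2' ?h1 ?h1'.
Qed.

Lemma fm_pair_bounded a a' : fm_pair a a' -> exists2 K, 0 <= K &
  forall Psi, L2 Psi -> L2 (a Psi) /\ rinner (a Psi) (a Psi) <= K * rinner Psi Psi.
Proof.
elim => {a a'} [l|f [mf [K fK]]|a a' b b' _ [K1 K10 h1] _ [K2 K20 h2]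
  |r a a' _ [K K0 h]|a a' b b' _ [K1 K10 h1] _ [K2 K20 h2]].
- exists 1 => // Psi hPsi; have [h h'] := L2_L_op hX l hPsi; split => //.
  by rewrite mul1r -lee_fin -(normL2sq_rinner hX h) -(normL2sq_rinner hX hPsi).
- exists K; first exact: le_trans (sqnorm_ge0 _) (fK point).
  move=> Psi hPsi; have [h h'] := L2_M_op mf fK hPsi; split => //.
  by rewrite -lee_fin EFinM -(normL2sq_rinner hX h) -(normL2sq_rinner hX hPsi).
- exists (2 * (K1 + K2)) => [|Psi hPsi]; first by rewrite mulr_ge0// addr_ge0.
  have [l1 b1] := h1 _ hPsi; have [l2 b2] := h2 _ hPsi.
  have l3 := L2_add hX l1 l2; split => //.
  (* Nonnegativity of [|a Psi - b Psi|^2] bounds the cross term of [|a Psi + b Psi|^2], whence the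
     factor 2. *)
  have l2' := L2_scale hX (-1)%:C%C l2; have l4 := L2_add hX l1 l2'.
  have := rinner_ge0 hX l4; rewrite (rinner_addE hX l1 l2') (rinner_addE hX l1 l2).
  rewrite (rinnerC hX l1 l2') (rinnerZl hX _ l2 l1) (rinnerZl hX _ l2 l2').
  rewrite (rinnerC hX l2 l2') (rinnerZl hX _ l2 l2).
  rewrite (rinnerC hX l2 l1).
  move: (rinner (a Psi) (a Psi)) (rinner (b Psi) (b Psi)) (rinner (a Psi) (b Psi))
    (rinner Psi Psi) b1 b2 => u v w s b1 b2; lra.
- exists (r ^+ 2 * K) => [|Psi hPsi]; first by rewrite mulr_ge0// sqr_ge0.
  have [l1 b1] := h _ hPsi; have l2 := L2_scale hX r%:C%C l1; split => //.
  rewrite (rinnerZl hX _ l1 l2) (rinnerC hX l1 l2) (rinnerZl hX _ l1 l1) mulrA -expr2 -[leRHS]mulrA.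
  by rewrite ler_wpM2l// sqr_ge0.
- exists (K1 * K2) => [|Psi hPsi]; first exact: mulr_ge0.
  have [l2 b2] := h2 _ hPsi; have [l1 b1] := h1 _ l2; split; first exact: l1.
  by apply: le_trans b1 _; rewrite -[leRHS]mulrA; exact: ler_wpM2l.
Qed.

Lemma fm_pair_L2 a a' Psi : fm_pair a a' -> L2 Psi -> L2 (a Psi).
Proof. by move=> /fm_pair_bounded[K _ h] /h[]. Qed.

Lemma fm_pair_adjoint a a' : fm_pair a a' ->
  forall Psi Phi, L2 Psi -> L2 Phi -> rinner (a Psi) Phi = rinner Psi (a' Phi).
Proof.
elim => {a a'} [l|f bf|a a' b b' p1 h1 p2 h2|r a a' p h|a a' b b' p1 h1 p2 h2] Psi Phi hP hQ.
- exact: L_op_adjoint.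
- exact: M_op_adjoint.
- have la := fm_pair_L2 p1 hP; have lb := fm_pair_L2 p2 hP.
  have la' := fm_pair_L2 (fm_pair_sym p1) hQ; have lb' := fm_pair_L2 (fm_pair_sym p2) hQ.
  rewrite (rinnerDl hX la lb hQ) (rinnerC hX hP (L2_add hX la' lb')).
  by rewrite (rinnerDl hX la' lb' hP) (h1 _ _ hP hQ) (h2 _ _ hP hQ)
    (rinnerC hX hP la') (rinnerC hX hP lb').
- have la := fm_pair_L2 p hP; have la' := fm_pair_L2 (fm_pair_sym p) hQ.
  rewrite (rinnerZl hX _ la hQ) (rinnerC hX hP (L2_scale hX _ la')) (rinnerZl hX _ la' hP).
  by rewrite (h _ _ hP hQ) (rinnerC hX hP la').
- rewrite /= (h1 _ _ (fm_pair_L2 p2 hP) hQ).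
  by rewrite (h2 _ _ hP (fm_pair_L2 (fm_pair_sym p1) hQ)).
Qed.

(* Right translations and right multiplications: they commute with the left
   action and agree with it on the diagonal, which gives the trace property. *)
Definition right_op l : operator := fun Psi p =>
  if p.2 \in letter_dom Lam l then Psi (p.1, letter_fun Lam l p.2) else 0.
Definition right_mul (f : X -> R[i]) : operator := fun Psi p => Psi p * f p.2.

Lemma fm_pair_right a a' : fm_pair a a' ->
  (forall l Psi, a (right_op l Psi) = right_op l (a Psi)) /\
  (forall f Psi, a (right_mul f Psi) = right_mul f (a Psi)).
Proof.
elim => {a a'} [l|f bf|a a' b b' _ [h1 h1'] _ [h2 h2']|r a a' _ [h h']|a a' b b' _ [h1 h1'] _ [h2 h2']].
- split => [k Psi|f Psi]; apply/funext => p.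
    rewrite /right_op !L_op_letterE /=.
    by case: ifPn => // _; rewrite if_same.
  by rewrite /right_mul !L_op_letterE /=; case: ifPn => //; rewrite mul0r.
- split => [k Psi|g Psi]; apply/funext => p; rewrite /right_op /right_mul /M_op /=.
    by case: ifPn => //; rewrite mulr0.
  by rewrite mulrA.
- split => [k Psi|f Psi]; apply/funext => p /=; rewrite ?h1 ?h2 ?h1' ?h2' /right_op /right_mul.
    by case: ifPn => //; rewrite addr0.
  by rewrite mulrDl.
- split => [k Psi|f Psi]; apply/funext => p /=; rewrite ?h ?h' /right_op /right_mul.
    by case: ifPn => //; rewrite mulr0.
  by rewrite mulrA.
- by split => [k Psi|f Psi] /=; rewrite ?h2 ?h1 ?h2' ?h1'.
Qed.

Local Notation delta := (@delta0 R d X).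

Lemma delta0E p : delta p = if p.1 == p.2 then 1 else 0.
Proof. by rewrite /delta0; case: eqVneq => [->|/eqP h]; [rewrite asboolT|rewrite asboolF]. Qed.

Lemma esum_rel_class_point x (c : \bar R) : (0 <= c)%E ->
  (\esum_(z in rel_class Lam x) (if z == x then c else 0) = c)%E.
Proof.
move=> c0; rewrite -[RHS](@esum_set1 _ _ x (fun=> c) c0).
rewrite [RHS]esum_mkcond [LHS]esum_mkcond; apply: eq_esum => z _.
have [->|zx] := eqVneq z x; first by rewrite !mem_set//; left.
rewrite [in RHS]memNset ?if_same//; exact/eqP.
Qed.

Lemma L2_delta0 : (mu setT < +oo)%E -> L2 delta.
Proof.
move=> fin.
have md : measurable [set p : X * X | p.1 = p.2] by exact: (measurable_diagonal hX).
have mb : measurable_fun setT (fun p : X * X => p.1 == p.2).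
  apply: (@measurable_fun_bool _ _ _ _ true); rewrite setTI.
  by rewrite (_ : _ @^-1` _ = [set p : X * X | p.1 = p.2])//;
    apply/seteqP; split => p /= h; exact/eqP.
apply/L2_def; split.
  split; apply: measurable_funTS.
  - rewrite (_ : (fun _ => _) = fun p : X * X => if p.1 == p.2 then 1 else 0).
      exact: measurable_fun_ifT.
    by apply/funext => p; rewrite delta0E; case: ifPn.
  - rewrite (_ : (fun _ => _) = fun p : X * X => 0) ?measurable_cst//.
    by apply/funext => p; rewrite delta0E; case: ifPn.
rewrite normL2sq_def (eq_integral (cst 1%E)) ?integral_cst ?mul1e// => x _.
rewrite -[RHS](esum_rel_class_point x (c := 1%E))//; apply: eq_esum => z _.
rewrite delta0E /= eq_sym; case: eqVneq => _; rewrite normc_sqr /sqnorm /=.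
  by rewrite expr1n expr0n addr0.
by rewrite expr0n addr0.
Qed.

Lemma rinner_delta0 Psi : rinner Psi delta = \int[mu]_x complex.Re (Psi (x, x)).
Proof.
rewrite rinner_def; apply: eq_Rintegral => x _.
rewrite /class_sum.
have E (u : X -> R) (s : R) : (forall z, u z = if z == x then s else 0) ->
    (\esum_(z in rel_class Lam x) (Num.max (u z) 0)%:E = (Num.max s 0)%:E)%E.
  move=> uE; rewrite -[RHS](esum_rel_class_point x); last by rewrite lee_fin le_max lexx orbT.
  by apply: eq_esum => z _; rewrite uE; case: ifPn => // _; rewrite maxxx.
have uE z : complex.Re (Psi (x, z) * conjc (delta (x, z))) =
    if z == x then complex.Re (Psi (x, x)) else 0.
  rewrite rdotE /rdot delta0E /= eq_sym; case: eqVneq => [->|_] /=.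
    by rewrite mulr1 mulr0 addr0.
  by rewrite !mulr0 addr0.
rewrite (E _ _ uE) (E _ (- complex.Re (Psi (x, x)))); last first.
  by move=> z; rewrite uE; case: ifPn => // _; rewrite oppr0.
rewrite /=; have [h|h] := leP 0 (complex.Re (Psi (x, x))).
  by rewrite max_r ?oppr_le0// subr0.
by rewrite max_l ?oppr_ge0 ?ltW// sub0r opprK.
Qed.

Hypothesis mu_fin : (mu setT < +oo)%E.

Definition fm_tr a : R := rinner (a delta) delta.

(** On [delta0] the left translation agrees with a right one, which commutes with [b]. With
    [Psi = b delta0], the two traces become integrals of [Psi (l^-1 x, x)] and of [Psi (x, l x)],
    which the change of variables along [l] identifies. *)
Lemma fm_tr_letter l b b' : fm_pair b b' ->
  fm_tr (L_op Lam [:: l] \o b) = fm_tr (b \o L_op Lam [:: l]).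
Proof.
move=> pb; rewrite /fm_tr !rinner_delta0 /=.
have -> : L_op Lam [:: l] delta = right_op l delta.
  apply/funext => p; rewrite L_op_letterE /right_op !delta0E /=.
  have e1 : p.2 \in letter_dom Lam l -> (p.1 == letter_fun Lam l p.2) =
      (p.1 \in letter_dom Lam (letter_inv l)) && (letter_fun Lam (letter_inv l) p.1 == p.2).
    move=> /set_mem lp; apply/eqP/andP => [->|[/set_mem lp1 /eqP <-]].
      by rewrite letter_funK//; split => //; apply/mem_set; exact: letter_fun_dom.
    by rewrite -{1}(letter_invK l) letter_funK.
  have [l2|l2] := boolP (p.2 \in letter_dom Lam l).
    by rewrite e1//; case: ifPn.
  case: ifPn => // /set_mem lp1; rewrite ifF//; apply: contraNF l2 => /eqP <-.
  by apply/mem_set; rewrite -{1}(letter_invK l); exact: letter_fun_dom.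
rewrite (fm_pair_right pb).1.
set Psi := b delta.
have /L2_def[mPsi _] : L2 Psi by exact: fm_pair_L2 pb (L2_delta0 mu_fin).
transitivity (\int[mu]_(x in letter_dom Lam (letter_inv l))
   complex.Re (Psi (letter_fun Lam (letter_inv l) x, x))).
  rewrite [RHS]Rintegral_mkcond; apply: eq_Rintegral => x _.
  by rewrite patchE L_op_letterE /=; case: ifPn.
transitivity (\int[mu]_(x in letter_dom Lam l) complex.Re (Psi (x, letter_fun Lam l x))); last first.
  rewrite Rintegral_mkcond; apply: eq_Rintegral => x _.
  by rewrite patchE /right_op /=; case: ifPn.
pose H x := complex.Re (Psi (x, letter_fun Lam l x)).
have e := @Rintegral_letter _ _ _ _ _ Lam (letter_inv l) H; rewrite letter_invK in e.
transitivity (\int[mu]_(x in letter_dom Lam l) H x); last by [].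
rewrite -e.
  apply: eq_Rintegral => x /set_mem lx; rewrite /H.
  by rewrite -{3}(letter_invK l) letter_funK.
have mr := measurable_rel_set Lam hX.
apply: (measurable_comp (F := rel) mr _ mPsi.1).
  by move=> _ [x lx <-] /=; exact: gen_rel_letter.
have mp : measurable_fun setT (fun x => (x, letter_tot Lam l x)).
  by apply: measurable_fun_pair => //; exact: measurable_letter_tot.
apply: eq_measurable_fun (measurable_funTS mp) => x lx.
by rewrite /letter_tot lx.
Qed.

Lemma fm_tr_mult f b b' : fm_pair b b' ->
  fm_tr (M_op f \o b) = fm_tr (b \o M_op f).
Proof.
move=> pb; rewrite /fm_tr !rinner_delta0 /=.
have -> : M_op f delta = right_mul f delta.
  apply/funext => p; rewrite /M_op /right_mul delta0E.
  by case: eqVneq => [->|_]; rewrite ?mulr1 ?mul1r ?mulr0 ?mul0r.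
rewrite (fm_pair_right pb).2; apply: eq_Rintegral => x _.
by rewrite /M_op /right_mul /= mulrC.
Qed.

Lemma fm_trC a a' b b' : fm_pair a a' -> fm_pair b b' -> fm_tr (a \o b) = fm_tr (b \o a).
Proof.
move=> pa; have ld := L2_delta0 mu_fin.
elim: pa b b' => {a a'} [l|f bf|a1 a1' a2 a2' p1 h1 p2 h2|r a a' p h|a1 a1' a2 a2' p1 h1 p2 h2] b b' pb.
- exact: fm_tr_letter pb.
- exact: fm_tr_mult pb.
- have lb := fm_pair_L2 pb ld.
  have e1 := h1 _ _ pb; have e2 := h2 _ _ pb; rewrite /fm_tr /= in e1 e2 *.
  rewrite (fm_pair_linear pb).1 (rinnerDl hX (fm_pair_L2 p1 lb) (fm_pair_L2 p2 lb) ld) e1 e2.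
  by rewrite (rinnerDl hX (fm_pair_L2 pb (fm_pair_L2 p1 ld)) (fm_pair_L2 pb (fm_pair_L2 p2 ld)) ld).
- have lb := fm_pair_L2 pb ld; have e := h _ _ pb; rewrite /fm_tr /= in e *.
  rewrite (fm_pair_linear pb).2 (rinnerZl hX _ (fm_pair_L2 p lb) ld) e.
  by rewrite (rinnerZl hX _ (fm_pair_L2 pb (fm_pair_L2 p ld)) ld).
(* Cycle [a1 (a2 b)] to [(a2 b) a1 = a2 (b a1)], and then to [(b a1) a2]. *)
- have := h1 _ _ (fm_comp p2 pb); have := h2 _ _ (fm_comp pb p1).
  by rewrite /fm_tr /= => e1 e2; rewrite -e1 -e2.
Qed.

End OperatorPairs.

(** * The algebra of adjoint pairs *)

Section OperatorAlgebra.
Context {R : realType} {d : measure_display} {X : measurableType d}.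
Context {mu : {measure set X -> \bar R}}.
Context {I : countType} (Lam : I -> partial_iso mu).
Local Notation kernel := (X * X -> R[i]).
Local Notation operator := (kernel -> kernel).

(** The adjoint is stored, not chosen: [star] swaps two fields, and the axioms of a *-algebra hold
    as equalities of functions. *)
Record fmop := FMop {
  fm_op : operator;
  fm_adj : operator;
  fm_opP : fm_pair Lam fm_op fm_adj
}.

Lemma fmop_eq (a b : fmop) : fm_op a = fm_op b -> fm_adj a = fm_adj b -> a = b.
Proof.
case: a b => [a a' pa] [b b' pb] /= e e'; case: _ / e in pb *; case: _ / e' in pb *.
by congr FMop; exact: Prop_irrelevance.
Qed.

Lemma bounded_fun_cst (c : R[i]) : bounded_fun (fun _ : X => c).
Proof. by split; [exact: cmeasurable_cst | exists (sqnorm c)]. Qed.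

Lemma fm_pair_id : fm_pair Lam id id.
Proof.
have E (c : R[i]) : c = 1 -> M_op (fun _ : X => c) = id :> operator.
  by move=> ->; apply/funext => Psi; apply/funext => p; rewrite /M_op mul1r.
have := fm_mult Lam (bounded_fun_cst 1).
by rewrite !E// conjc1.
Qed.

Lemma fm_pair_zero : fm_pair Lam (fun _ _ => 0) (fun _ _ => 0).
Proof.
have := fm_scale 0 fm_pair_id; congr (fm_pair _ _ _);
  by apply/funext => Psi; apply/funext => p /=; rewrite mul0r.
Qed.

Lemma fm_pair_opp a a' : fm_pair Lam a a' ->
  fm_pair Lam (fun Psi p => - a Psi p) (fun Psi p => - a' Psi p).
Proof.
move=> /(fm_scale (-1)); congr (fm_pair _ _ _);
  by apply/funext => Psi; apply/funext => p /=; rewrite rmorphN1 mulN1r.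
Qed.

Definition fmop_zero := FMop fm_pair_zero.
Definition fmop_one := FMop fm_pair_id.
Definition fmop_add (a b : fmop) := FMop (fm_add (fm_opP a) (fm_opP b)).
Definition fmop_opp (a : fmop) := FMop (fm_pair_opp (fm_opP a)).
Definition fmop_mul (a b : fmop) := FMop (fm_comp (fm_opP a) (fm_opP b)).
Definition fmop_scale (r : R) (a : fmop) := FMop (fm_scale r (fm_opP a)).
Definition fmop_star (a : fmop) := FMop (fm_pair_sym (fm_opP a)).

HB.instance Definition _ := gen_eqMixin fmop.
HB.instance Definition _ := gen_choiceMixin fmop.

Let funext2 (a b : operator) : (forall Psi p, a Psi p = b Psi p) -> a = b.
Proof. by move=> h; apply/funext => Psi; apply/funext => p. Qed.

Let addA : associative fmop_add.
Proof. by move=> a b c; apply: fmop_eq; apply: funext2 => Psi p /=; rewrite addrA. Qed.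
Let addC : commutative fmop_add.
Proof. by move=> a b; apply: fmop_eq; apply: funext2 => Psi p /=; rewrite addrC. Qed.
Let add0 : left_id fmop_zero fmop_add.
Proof. by move=> a; apply: fmop_eq; apply: funext2 => Psi p /=; rewrite add0r. Qed.
Let addN : left_inverse fmop_zero fmop_opp fmop_add.
Proof. by move=> a; apply: fmop_eq; apply: funext2 => Psi p /=; rewrite addNr. Qed.
HB.instance Definition _ := GRing.isZmodule.Build fmop addA addC add0 addN.

Let mulA : associative fmop_mul.
Proof. by move=> a b c; apply: fmop_eq. Qed.
Let mul1 : left_id fmop_one fmop_mul.
Proof. by move=> a; apply: fmop_eq. Qed.
Let mulx1 : right_id fmop_one fmop_mul.
Proof. by move=> a; apply: fmop_eq. Qed.
Let mulDl : left_distributive fmop_mul fmop_add.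
Proof.
move=> a b c; apply: fmop_eq => //; apply: funext2 => Psi p /=.
by rewrite (fm_pair_linear (fm_pair_sym (fm_opP c))).1.
Qed.
Let mulDr : right_distributive fmop_mul fmop_add.
Proof.
move=> a b c; apply: fmop_eq => //; apply: funext2 => Psi p /=.
by rewrite (fm_pair_linear (fm_opP a)).1.
Qed.
Let one_neq0 : fmop_one != fmop_zero :> fmop.
Proof.
apply/eqP => /(congr1 fm_op)/(congr1 (fun f => f (fun=> 1) point)) /= /eqP.
by rewrite oner_eq0.
Qed.
HB.instance Definition _ :=
  GRing.Zmodule_isNzRing.Build fmop mulA mul1 mulx1 mulDl mulDr one_neq0.

Let scaleA (r s : R) (a : fmop) : fmop_scale r (fmop_scale s a) = fmop_scale (r * s) a.
Proof. by apply: fmop_eq; apply: funext2 => Psi p /=; rewrite rmorphM mulrA. Qed.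
Let scale1 : left_id 1 fmop_scale.
Proof. by move=> a; apply: fmop_eq; apply: funext2 => Psi p /=; rewrite mul1r. Qed.
Let scaleDr : right_distributive fmop_scale +%R.
Proof. by move=> r a b; apply: fmop_eq; apply: funext2 => Psi p /=; rewrite mulrDr. Qed.
Let scaleDl (a : fmop) : {morph fmop_scale^~ a : r s / r + s >-> r + s}.
Proof. by move=> r s; apply: fmop_eq; apply: funext2 => Psi p /=; rewrite rmorphD mulrDl. Qed.
HB.instance Definition _ :=
  GRing.Zmodule_isLmodule.Build R fmop scaleA scale1 scaleDr scaleDl.

Let scaleAl (r : R) (a b : fmop) : r *: (a * b) = (r *: a) * b.
Proof.
apply: fmop_eq => //; apply: funext2 => Psi p /=.
by rewrite (fm_pair_linear (fm_pair_sym (fm_opP b))).2.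
Qed.
HB.instance Definition _ := GRing.Lmodule_isLalgebra.Build R fmop scaleAl.

Let scaleAr (r : R) (a b : fmop) : r *: (a * b) = a * (r *: b).
Proof.
apply: fmop_eq => //; apply: funext2 => Psi p /=.
by rewrite (fm_pair_linear (fm_opP a)).2.
Qed.
HB.instance Definition _ := GRing.Lalgebra_isAlgebra.Build R fmop scaleAr.

Lemma fm_op_sum (J : Type) (s : seq J) (P : pred J) (F : J -> fmop) Psi p :
  fm_op (\sum_(j <- s | P j) F j) Psi p = \sum_(j <- s | P j) fm_op (F j) Psi p.
Proof. by elim/big_rec2: _ => //= j y1 y2 _ <-. Qed.

Lemma fmop_starD a b : fmop_star (a + b) = fmop_star a + fmop_star b.
Proof. exact: fmop_eq. Qed.
Lemma fmop_starM a b : fmop_star (a * b) = fmop_star b * fmop_star a.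
Proof. exact: fmop_eq. Qed.
Lemma fmop_starZ (r : R) a : fmop_star (r *: a) = r *: fmop_star a.
Proof. exact: fmop_eq. Qed.
Lemma fmop_starK a : fmop_star (fmop_star a) = a.
Proof. exact: fmop_eq. Qed.

Hypothesis hX : standard_borel R X.
Hypothesis mu_fin : (mu setT < +oo)%E.
Local Notation delta := (@delta0 R d X).

Definition fmop_tr (a : fmop) : R := fm_tr Lam (fm_op a).

Let ld := L2_delta0 Lam hX mu_fin.
Lemma L2_fmop (a : fmop) Psi : L2 Lam Psi -> L2 Lam (fm_op a Psi).
Proof. exact: (fm_pair_L2 hX (fm_opP a)). Qed.
Lemma fmop_adjoint (a : fmop) Psi Phi : L2 Lam Psi -> L2 Lam Phi ->
  rinner Lam (fm_op a Psi) Phi = rinner Lam Psi (fm_op (fmop_star a) Phi).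
Proof. exact: (fm_pair_adjoint hX (fm_opP a)). Qed.

Lemma fmop_trD a b : fmop_tr (a + b) = fmop_tr a + fmop_tr b.
Proof. exact: (rinnerDl hX (L2_fmop a ld) (L2_fmop b ld) ld). Qed.
Lemma fmop_trZ (r : R) a : fmop_tr (r *: a) = r * fmop_tr a.
Proof. exact: (rinnerZl hX r (L2_fmop a ld) ld). Qed.
Lemma fmop_trC a b : fmop_tr (a * b) = fmop_tr (b * a).
Proof. exact: (fm_trC hX mu_fin (fm_opP a) (fm_opP b)). Qed.
Lemma fmop_tr_star_mul a b :
  fmop_tr (fmop_star a * b) = rinner Lam (fm_op b delta) (fm_op a delta).
Proof.
have := fmop_adjoint (fmop_star a) (L2_fmop b ld) ld.
by rewrite fmop_starK.
Qed.
Lemma fmop_tr_star a : fmop_tr (fmop_star a) = fmop_tr a.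
Proof.
have := fmop_tr_star_mul a 1; rewrite mulr1 => ->.
exact: (rinnerC hX ld (L2_fmop a ld)).
Qed.
Lemma fmop_tr_ge0 a : 0 <= fmop_tr (fmop_star a * a).
Proof. rewrite fmop_tr_star_mul; exact: (rinner_ge0 hX (L2_fmop a ld)). Qed.

Lemma fmop_bound (a : fmop) : exists2 K, 0 <= K & forall Psi, L2 Lam Psi ->
  rinner Lam (fm_op a Psi) (fm_op a Psi) <= K * rinner Lam Psi Psi.
Proof.
have [K K0 h] := fm_pair_bounded hX (fm_opP a); exists K => // Psi hP.
exact: (h _ hP).2.
Qed.

(** [tnorm x] is the L^2 norm of [x delta0], so an operator bound on the relation space passes to
    left multiplication. *)
Lemma fmop_mul_bound (a : fmop) c : 0 <= c ->
  (forall Psi, L2 Lam Psi ->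
    rinner Lam (fm_op a Psi) (fm_op a Psi) <= c ^+ 2 * rinner Lam Psi Psi) ->
  mul_bound fmop_star fmop_tr a c.
Proof.
move=> c0 h x; rewrite /tnorm !fmop_tr_star_mul.
rewrite -[c]ger0_norm// -sqrtr_sqr -sqrtrM ?sqr_ge0// ler_wsqrtr//.
exact: (h _ (L2_fmop x ld)).
Qed.

Lemma fmop_mul_bound_exists (a : fmop) :
  exists2 c, 0 <= c & mul_bound fmop_star fmop_tr a c.
Proof.
have [K K0 h] := fmop_bound a; exists (Num.sqrt K); first exact: sqrtr_ge0.
apply: fmop_mul_bound; first exact: sqrtr_ge0.
by move=> Psi /h; rewrite sqr_sqrtr.
Qed.

End OperatorAlgebra.

Section RealMultiplications.
Context {R : realType} {d : measure_display} {X : measurableType d}.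
Context {mu : {measure set X -> \bar R}}.
Context {I : countType} (Lam : I -> partial_iso mu).
Hypothesis hX : standard_borel R X.
Implicit Types (r : X -> R).

Definition bounded_real r := measurable_fun setT r /\ exists K, forall x, `|r x| <= K.

Lemma bounded_real_fun r : bounded_real r -> bounded_fun (fun x => (r x)%:C%C).
Proof.
move=> [mr [K rK]]; split; first by split => //; exact: measurable_cst.
exists (K ^+ 2) => x; rewrite /sqnorm /= expr0n addr0 -real_normK ?num_real//.
have K0 : 0 <= K by exact: le_trans (normr_ge0 _) (rK x).
by rewrite ler_pXn2r ?nnegrE.
Qed.

Lemma fm_pair_real r : bounded_real r ->
  fm_pair Lam (M_op (fun x => (r x)%:C%C)) (M_op (fun x => (r x)%:C%C)).
Proof.
move=> /bounded_real_fun/(fm_mult Lam); congr (fm_pair _ _ _).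
by congr M_op; apply/funext => x; rewrite conjc_real.
Qed.

Definition fm_real r (br : bounded_real r) : fmop Lam := FMop (fm_pair_real br).

Lemma fm_realE r (br : bounded_real r) Psi p :
  fm_op (fm_real br) Psi p = (r p.1)%:C%C * Psi p.
Proof. by []. Qed.

Lemma fm_real_star r (br : bounded_real r) : fmop_star (fm_real br) = fm_real br.
Proof. exact: fmop_eq. Qed.

Lemma fm_real_form_ge0 r (br : bounded_real r) Psi : (forall x, 0 <= r x) ->
  L2 Lam Psi -> 0 <= rinner Lam (fm_op (fm_real br) Psi) Psi.
Proof.
move=> r0 h; rewrite (rinnerE hX (L2_fmop hX (fm_real br) h) h).
apply: Rintegral_ge0 => p _; rewrite /rel_restrict patchE; case: ifPn => // _.
rewrite /rdot fm_realE cReM cImM /= !mul0r subr0 addr0 -!mulrA -mulrDr.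
by rewrite mulr_ge0// -!expr2 addr_ge0// sqr_ge0.
Qed.

Lemma fm_real_form_le r (br : bounded_real r) K Psi : (forall x, r x <= K) ->
  L2 Lam Psi -> rinner Lam (fm_op (fm_real br) Psi) Psi <= K * rinner Lam Psi Psi.
Proof.
move=> rK h.
have br' : bounded_real (fun x => K - r x).
  case: br => mr [K' rK']; split; first exact: measurable_funB.
  by exists (`|K| + K') => x; apply: le_trans (ler_normB _ _) _; rewrite lerD2l.
have := fm_real_form_ge0 br' (fun x => _) h.
have -> : fm_op (fm_real br') Psi = (K%:C%C \*o Psi) \+ ((-1)%:C%C \*o fm_op (fm_real br) Psi).
  apply/funext => p; rewrite fm_realE /= /M_op rmorphN1 mulN1r rmorphB mulrBl.
  by [].
have h1 := L2_fmop hX (fm_real br) h.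
rewrite (rinnerDl hX (L2_scale hX _ h) (L2_scale hX _ h1) h).
rewrite (rinnerZl hX _ h h) (rinnerZl hX _ h1 h) mulN1r subr_ge0; apply.
by move=> x; rewrite subr_ge0.
Qed.

End RealMultiplications.

Section Letters.
Context {R : realType} {d : measure_display} {X : measurableType d}.
Context {mu : {measure set X -> \bar R}}.
Context {I : countType} (Lam : I -> partial_iso mu).
Hypothesis hX : standard_borel R X.
Hypothesis mu_fin : (mu setT < +oo)%E.

Definition fm_let (l : I * bool) : fmop Lam := FMop (fm_letter Lam l).
Definition fm_mul_fun (f : X -> R[i]) (bf : bounded_fun f) : fmop Lam :=
  FMop (fm_mult Lam bf).

Lemma fm_let_bound l : mul_bound (@fmop_star _ _ _ _ _ Lam) (fmop_tr (Lam := Lam)) (fm_let l) 1.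
Proof.
apply: fmop_mul_bound => // Psi h; have [h1 le] := L2_L_op hX l h.
by rewrite expr1n mul1r -lee_fin -(normL2sq_rinner hX h1) -(normL2sq_rinner hX h).
Qed.

Lemma fm_mul_fun_bound f (bf : bounded_fun f) c : 0 <= c ->
  (forall x, sqnorm (f x) <= c ^+ 2) ->
  mul_bound (@fmop_star _ _ _ _ _ Lam) (fmop_tr (Lam := Lam)) (fm_mul_fun bf) c.
Proof.
move=> c0 fc; apply: fmop_mul_bound => // Psi h.
have [h1 le] := L2_M_op hX bf.1 fc h.
by rewrite -lee_fin EFinM -(normL2sq_rinner hX h1) -(normL2sq_rinner hX h).
Qed.

Lemma fm_let_full l : letter_dom Lam l = setT -> letter_dom Lam (letter_inv l) = setT ->
  fmop_star (fm_let l) * fm_let l = 1.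
Proof.
move=> dl dl'.
have E : L_op Lam [:: letter_inv l] \o L_op Lam [:: l] = id.
  apply/funext => Psi; apply/funext => -[x y] /=.
  rewrite !L_op_letterE /= letter_invK dl dl' !in_setT.
  by rewrite letter_funK// dl.
exact: fmop_eq.
Qed.

End Letters.

(** * The operator as a perturbed translation *)

Section PerturbedTranslation.
Context {R : realType} {d : measure_display} {X : measurableType d}.
Context {mu : probability X R}.
Context {I : countType} (Lam : I -> partial_iso mu).
Hypothesis hX : standard_borel R X.
Hypothesis htree : treeing Lam.
Variables (n : nat) (g : 'I_n -> I) (i0 : 'I_n).
Hypothesis hg : injective g.
Hypothesis hdom : pdom (Lam (g i0)) = setT.
Hypothesis hrng : prng (Lam (g i0)) = setT.
Variables (F0 : X -> R[i]) (u : 'I_n -> X -> R[i]) (c : 'I_n -> R).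
Hypothesis F0_bounded : bounded_fun F0.
Hypothesis u_meas : forall i, cmeasurable_fun setT (u i).
Hypothesis c_ge0 : forall i, 0 <= c i.
Hypothesis u_le : forall i x, sqnorm (u i x) <= c i ^+ 2.
Local Notation delta := (@delta0 R d X).
Local Notation tr := (fmop_tr (Lam := Lam)).
Local Notation star := (@fmop_star _ _ _ _ _ Lam).

Let mu_fin : ((mu : {measure set X -> \bar R}) setT < +oo)%E.
Proof. by rewrite -ge0_fin_numE// fin_num_measure. Qed.
Let ld := L2_delta0 Lam hX mu_fin.
Let gam : I * bool := (g i0, true).
Let gam' : I * bool := (g i0, false).
Let dom_gam : letter_dom Lam gam = setT. Proof. exact: hdom. Qed.
Let dom_gam' : letter_dom Lam gam' = setT. Proof. exact: hrng. Qed.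

Definition base_map : X -> X := letter_fun Lam gam.

Lemma measurable_base_map : measurable_fun setT base_map.
Proof. by rewrite -dom_gam; exact: measurable_letter_fun. Qed.

Let bounded_base (f : X -> R[i]) : bounded_fun f -> bounded_fun (f \o base_map).
Proof.
move=> [[m1 m2] [K fK]]; split; last by exists K => x; exact: fK.
by split; [exact: (measurableT_comp m1 measurable_base_map) |
  exact: (measurableT_comp m2 measurable_base_map)].
Qed.

Let u_bounded i : bounded_fun (u i).
Proof. by split => //; exists (c i ^+ 2). Qed.

(** A multiplication moves to the right of the translation by [g_{i0}] after composing its function
    with [base_map]. Hence [M_u L_g = L M_(u o base_map) L^-1 L_g], where [L] is the translation by
    [g_{i0}]. *)
Definition pert_term i : fmop Lam :=
  fm_mul_fun Lam (bounded_base (u_bounded i)) * (fm_let Lam gam' * fm_let Lam (g i, true)).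
Definition pert_op : fmop Lam := \sum_(i < n | i != i0) pert_term i.
Definition unpert_weight (x : X) : R := sqnorm (F0 (base_map x)).
Definition full_op : fmop Lam :=
  fm_let Lam gam * (fm_mul_fun Lam (bounded_base F0_bounded) * (1 + pert_op)).

Lemma pert_op_bound : mul_bound star tr pert_op (\sum_(i < n | i != i0) c i).
Proof.
apply: (big_ind2 (fun a s => mul_bound star tr a s)).
- by move=> x; rewrite !mul0r /tnorm mulr0 -(scale0r 1) (fmop_trZ hX mu_fin) mul0r sqrtr0.
- move=> a s b s' h1 h2; refine (mul_boundD (star := star) (t := tr) _ _ _ _ _ _ _ _ h1 h2).
  + exact: fmop_starD.
  + exact: fmop_starM.
  + exact: fmop_starZ.
  + exact: fmop_starK.
  + exact: (fmop_trD hX mu_fin).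
  + exact: (fmop_trZ hX mu_fin).
  + exact: (fmop_tr_star hX mu_fin).
  + exact: (fmop_tr_ge0 hX mu_fin).
- move=> i _; rewrite -[c i]mulr1; apply: mul_bound_mul; first exact: c_ge0.
    by refine (fm_mul_fun_bound hX mu_fin _ (c_ge0 i) _) => x; exact: u_le.
  rewrite -(mulr1 (1 : R)); apply: mul_bound_mul; first exact: ler01.
    exact (fm_let_bound hX mu_fin gam').
  exact (fm_let_bound hX mu_fin (g i, true)).
Qed.

Lemma full_opE Psi p : fm_op full_op Psi p = F0 p.1 *
  (L_op Lam [:: gam] Psi p + \sum_(i < n | i != i0) u i p.1 * L_op Lam [:: (g i, true)] Psi p).
Proof.
have gK x : base_map (letter_fun Lam gam' x) = x.
  by rewrite /base_map -[gam]/(letter_inv gam') letter_funK// dom_gam'.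
rewrite /= L_op_letterE -[letter_inv gam]/gam' dom_gam' in_setT /M_op /= gK.
rewrite L_op_letterE -[letter_inv gam]/gam' dom_gam' in_setT; congr (_ * (_ + _)).
rewrite fm_op_sum; apply: eq_bigr => i _.
rewrite /= /M_op /= gK L_op_letterE -[letter_inv gam']/gam dom_gam in_setT /=.
by rewrite -/base_map gK; case: p.
Qed.

Let weight_bounded : bounded_real unpert_weight.
Proof.
have [[m1 m2] [K fK]] := bounded_base F0_bounded.
split; first by apply: measurable_funD; apply: measurable_funX.
by exists K => x; rewrite ger0_norm ?sqnorm_ge0//; exact: fK.
Qed.

Definition weight_op : fmop Lam := fm_real Lam weight_bounded.

Lemma full_op_star : star full_op * full_op = star (1 + pert_op) * weight_op * (1 + pert_op).
Proof.
rewrite /full_op !fmop_starM -!mulrA; congr (_ * _).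
rewrite (mulrA (star (fm_let _ _))) fm_let_full// mul1r mulrA; congr (_ * _).
have E : M_op (fun x => conjc ((F0 \o base_map) x)) \o M_op (F0 \o base_map) =
    M_op (fun x => (unpert_weight x)%:C%C).
  apply/funext => Psi; apply/funext => p; rewrite /M_op /= mulrA; congr (_ * _).
  rewrite /unpert_weight /sqnorm; case: (F0 _) => a b /=; rewrite /real_complex_def.
  by apply/eqP; rewrite eq_complex /=; apply/andP; split; apply/eqP; ring.
exact: fmop_eq.
Qed.

(** The words of [q^j]: [j] blocks [g_{i0}^-1 g_i] with [i <> i0]. *)
Inductive pert_word : nat -> word (I := I) -> Prop :=
| pert_word0 : pert_word 0 [::]
| pert_wordS j i w : i != i0 -> pert_word j w ->
    pert_word j.+1 [:: gam', (g i, true) & w].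

Let rr := (fun l l' : I * bool => (l.1 == l'.1) ==> (l.2 == l'.2)).

Lemma pert_word_reduced j w : pert_word j w -> reduced w.
Proof.
(* Strengthened by a preceding letter [g_i], [i <> i0], to cover the junction of two blocks. Inside
   a block and at a junction, neighbours are different generators by [hg]. *)
move=> h; suff : forall i, i != i0 -> path rr (g i, true) w.
  case: h => // j' i w' ii0 _ /(_ _ ii0) /=; by case/andP.
elim: h => {j w} // j i w ii0 _ IH i' i'i0 /=.
rewrite IH// andbT /rr /= !(inj_eq hg) (negbTE i'i0) /=.
by rewrite (eq_sym i0) (negbTE ii0).
Qed.

(** Instead of expanding [q^j] into products, only the support of [q^j delta0] is followed: it lies
    on the graphs of the words with [j] blocks. *)
Lemma pert_op_support j Psi p : (forall p, Psi p != 0 -> exists2 w, pert_word j w &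
    word_act Lam w p.2 = Some p.1) ->
  fm_op pert_op Psi p != 0 ->
  exists2 w, pert_word j.+1 w & word_act Lam w p.2 = Some p.1.
Proof.
move=> H; rewrite fm_op_sum => nz.
have [i ii0 hi] : exists2 i, i != i0 & fm_op (pert_term i) Psi p != 0.
  apply: contrapT => h; move/eqP: nz; apply; apply: big1 => i ii0.
  by apply/eqP/negPn/negP => hi; apply: h; exists i.
move: hi; rewrite /= /M_op mulf_eq0 negb_or => /andP[_].
rewrite L_op_letterE -[letter_inv gam']/gam dom_gam in_setT /= -/base_map.
rewrite L_op_letterE /=; case: ifPn => [/set_mem di|]; last by rewrite eqxx.
move=> /H[w jw /= wE]; exists [:: gam', (g i, true) & w]; first exact: pert_wordS.
rewrite /word_act /= -/(word_act Lam w p.2) wE /=.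
have di' := letter_fun_dom di; rewrite letter_invK in di'.
rewrite letter_actE mem_set//= -{1}(letter_invK (g i, true)) letter_funK//=.
rewrite letter_actE dom_gam' in_setT.
by rewrite -[gam']/(letter_inv gam) letter_funK// dom_gam.
Qed.

Lemma pert_op_exp_support j p : fm_op (pert_op ^+ j) delta p != 0 ->
  exists2 w, pert_word j w & word_act Lam w p.2 = Some p.1.
Proof.
elim: j p => [|j IH] p.
  rewrite expr0 /= delta0E; case: (eqVneq p.1 p.2) => [e _|_ /eqP//].
  by exists [::]; [exact: pert_word0 | rewrite /= e].
by rewrite exprS; exact: pert_op_support.
Qed.

(** The trace integrates the kernel over the diagonal, where it is nonzero only at fixed points of
    reduced nonempty words. There are countably many words, and the treeing makes each fixed-point
    set null. *)
Lemma pert_op_trace j : tr (pert_op ^+ j.+1) = 0.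
Proof.
rewrite /fmop_tr /fm_tr rinner_delta0; set Psi := fm_op _ _.
have /L2_def[[mPsi _] _] : L2 Lam Psi by exact: L2_fmop.
have mr := measurable_rel_set Lam hX.
have mdiag : measurable_fun setT (fun x : X => complex.Re (Psi (x, x))).
  apply: (measurable_comp (F := rel_set Lam) mr _ mPsi).
    by move=> _ [x _ <-]; left.
  exact: measurable_fun_pair.
suff ae : ae_eq mu setT (fun x => (complex.Re (Psi (x, x)))%:E) (cst 0%E).
  rewrite /Rintegral (@ae_eq_integral _ _ _ _ _ _ _ _ _ _ ae) ?integral0//.
  exact/measurable_EFinP.
pose Z k : set X := if nth_word (I := I) k is Some w
  then [set x | pert_word j.+1 w /\ word_act Lam w x = Some x] else set0.
have : (mu : {measure set X -> \bar R}).-negligible (\bigcup_k Z k).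
  apply: negligible_bigcup => k; rewrite /Z.
  case: (nth_word k) => [w|]; last exact: negligible_set0.
  have [jw|njw] := pselect (pert_word j.+1 w); last first.
    by apply: (@negligibleS _ _ _ _ set0); [move=> x [] | exact: negligible_set0].
  apply: (@negligibleS _ _ _ _ [set x | word_act Lam w x = Some x]) => [x []//|].
  apply/negligibleP.
    rewrite (_ : [set x | _] = word_dom Lam w `&` [set x | word_val Lam w x = x]).
      apply: measurableI; first exact: (measurable_word Lam w).1.
      have mv := (measurable_word Lam w).2.
      have mp : measurable_fun setT (fun x => (word_val Lam w x, x)).
        exact: measurable_fun_pair.
      by have := mp measurableT _ (measurable_diagonal hX); rewrite setTI.
    apply/seteqP; split => x; rewrite /word_dom /word_val /=.
      by move=> ->.
    by case: (word_act Lam w x) => [y|] [] //= _ ->.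
  by apply htree; [inversion jw | exact: pert_word_reduced jw].
apply: negligibleS => x /= h.
have : Psi (x, x) != 0 by apply/eqP => e; apply: h => _; rewrite e.
move=> /pert_op_exp_support[w jw wx].
have [k kw] := nth_word_surj w.
by exists k => //; rewrite /Z kw.
Qed.

End PerturbedTranslation.

(** * The logarithmic estimate in the algebra of the relation *)

Section LogEstimate.
Context {R : realType} {d : measure_display} {X : measurableType d}.
Context {mu : probability X R}.
Context {I : countType} (Lam : I -> partial_iso mu).
Hypothesis hX : standard_borel R X.
Local Notation delta := (@delta0 R d X).
Local Notation tr := (fmop_tr (Lam := Lam)).
Local Notation star := (@fmop_star _ _ _ _ _ Lam).

Let mu_fin : ((mu : {measure set X -> \bar R}) setT < +oo)%E.
Proof. by rewrite -ge0_fin_numE// fin_num_measure. Qed.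
Let ld := L2_delta0 Lam hX mu_fin.

Lemma fmop_tr_diag (a : fmop Lam) (r : X -> R) :
  (forall Psi p, fm_op a Psi p = (r p.1)%:C%C * Psi p) -> tr a = \int[mu]_x r x.
Proof.
move=> h; rewrite /fmop_tr /fm_tr rinner_delta0; apply: eq_Rintegral => x _.
by rewrite h delta0E eqxx mulr1.
Qed.

Lemma fmop_tr_diagX (a : fmop Lam) (r : X -> R) k :
  (forall Psi p, fm_op a Psi p = (r p.1)%:C%C * Psi p) ->
  tr (a ^+ k) = \int[mu]_x (r x ^+ k).
Proof.
move=> h; apply: fmop_tr_diag; elim: k => [|k IH] Psi p.
  by rewrite !expr0 rmorph1 mul1r.
by rewrite exprS /= h IH exprS rmorphM mulrA.
Qed.

Lemma fmop_tr1 : tr 1 = 1.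
Proof.
rewrite (@fmop_tr_diag _ (cst 1)); last by move=> Psi p; rewrite rmorph1 mul1r.
rewrite Rintegral_cst// mul1r [X in fine X](_ : _ = 1%E)//.
exact: probability_setT.
Qed.

Variables (q : fmop Lam) (w : X -> R) (rho Mh kap eps : R).
Hypothesis bw : bounded_real w.
Hypothesis q_trace : forall j, tr (q ^+ j.+1) = 0.
Hypothesis rho_ge0 : 0 <= rho.
Hypothesis rho_lt1 : rho < 1.
Hypothesis q_bound : mul_bound star tr q rho.
Hypothesis w_gt0 : forall x, 0 < w x.
Hypothesis w_le : forall x, w x <= Mh.
Hypothesis eps_gt0 : 0 < eps.
Hypothesis kap_gt0 : 0 < kap.
Hypothesis kap_le : kap * (eps + 4 * Mh) <= 1.

Let dval x := Num.sqrt (eps / 4 + w x).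
Let dpos x : 0 < eps / 4 + w x. Proof. by rewrite addr_gt0// divr_gt0. Qed.
Let dval_gt0 x : 0 < dval x. Proof. by rewrite sqrtr_gt0. Qed.
Let dval_meas : measurable_fun setT dval.
Proof.
apply: (measurableT_comp measurable_sqrt); apply: measurable_funD => //.
exact: bw.1.
Qed.
Let bd : bounded_real dval.
Proof.
split => //; exists (Num.sqrt (eps / 4 + Mh)) => x.
by rewrite ger0_norm ?sqrtr_ge0// ler_wsqrtr// lerD2l.
Qed.
Let be : bounded_real (fun x => (dval x)^-1).
Proof.
split; first exact: (measurableT_comp measurable_inv dval_meas).
exists (Num.sqrt (eps / 4))^-1 => x; rewrite ger0_norm ?invr_ge0 ?sqrtr_ge0//.
have s0 : 0 < Num.sqrt (eps / 4) by rewrite sqrtr_gt0 divr_gt0.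
by rewrite lef_pV2 ?posrE// ler_wsqrtr// lerDl ltW.
Qed.
Let h := fm_real Lam bw.
Let dd := fm_real Lam bd.
Let ee := fm_real Lam be.

Let ediag : tnorm star tr ee ^+ 2 = \int[mu]_x (eps / 4 + w x)^-1.
Proof.
rewrite /tnorm sqr_sqrtr; last exact: (fmop_tr_ge0 hX mu_fin).
apply: fmop_tr_diag => Psi p; rewrite fm_real_star /= /M_op mulrA -rmorphM.
by rewrite -invfM -expr2 sqr_sqrtr ?ltW.
Qed.

(** At [s = 0] the path is a multiplication operator, so its truncated logarithm is given by
    integrals over [X]; at [s = 1] it is the regularized [T^* T]. The quantity [sqrt eps |e|] turns
    into the root of an explicit integral. *)
Lemma trunc_log_full_le n :
  `|trunc_log tr n (1 - kap *: (eps%:A + star (1 + q) * h * (1 + q))) -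
    \sum_(k < n) k.+1%:R^-1 * \int[mu]_x ((1 - kap * (eps + w x)) ^+ k.+1)| <=
  2 * (1 - rho)^-1 * ((1 - rho)^-1 * Num.sqrt (\int[mu]_x (eps / (eps / 4 + w x))) +
    3 * (1 - kap * eps) ^+ n).
Proof.
have mul_star (x y : fmop Lam) : tip star tr (h * x) y =
    rinner Lam (fm_op h (fm_op x delta)) (fm_op y delta).
  exact: (fmop_tr_star_mul hX mu_fin y (h * x)).
have norm_sqr (x : fmop Lam) : tnorm star tr x ^+ 2 =
    rinner Lam (fm_op x delta) (fm_op x delta).
  rewrite /tnorm sqr_sqrtr; last exact: (fmop_tr_ge0 hX mu_fin).
  exact: (fmop_tr_star_mul hX mu_fin).
have main := @trunc_log_perturbed R (fmop Lam) star tr (@fmop_starD _ _ _ _ _ Lam)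
  (@fmop_starM _ _ _ _ _ Lam) (@fmop_starZ _ _ _ _ _ Lam) (@fmop_starK _ _ _ _ _ Lam)
  (fmop_trD hX mu_fin) (fmop_trZ hX mu_fin) (fmop_trC hX mu_fin)
  (fmop_tr_star hX mu_fin) (fmop_tr_ge0 hX mu_fin) fmop_tr1 q h dd ee rho kap eps Mh
  (fmop_mul_bound_exists hX mu_fin) q_trace rho_ge0 rho_lt1 q_bound (fm_real_star Lam bw).
have {main} := main _ _ (fm_real_star Lam bd) _ _ eps_gt0 kap_gt0 kap_le n.
rewrite /perturbed.
have -> : 1 + 1 *: star q = star (1 + q) by rewrite scale1r fmop_starD; congr (_ + _); exact: fmop_eq.
rewrite !scale1r !scale0r !addr0 mul1r mulr1.
have -> : trunc_log tr n (1 - kap *: (eps%:A + h)) =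
    \sum_(k < n) k.+1%:R^-1 * \int[mu]_x ((1 - kap * (eps + w x)) ^+ k.+1).
  apply: eq_bigr => k _; congr (_ * _); apply: fmop_tr_diagX => Psi p /=.
  by rewrite /M_op rmorphB rmorph1 rmorphM rmorphD mulrBl mul1r -mulrDl mulrA.
have -> : Num.sqrt (\int[mu]_x (eps / (eps / 4 + w x))) =
    Num.sqrt eps * tnorm star tr ee.
  rewrite RintegralZl ?ediag//; last first.
    apply: (@bounded_integrable _ _ _ _ _ (eps / 4)^-1).
      by apply: (measurableT_comp measurable_inv); apply: measurable_funD => //; exact: bw.1.
    move=> x; have e4 : 0 < eps / 4 by rewrite divr_gt0.
    rewrite ger0_norm; last by rewrite invr_ge0 ltW.
    by rewrite lef_pV2 ?posrE// lerDl ltW.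
  by rewrite sqrtrM ?ltW// -ediag sqrtr_sqr ger0_norm// sqrtr_ge0.
rewrite mulrA; apply.
- by move=> x; rewrite mul_star; apply: (fm_real_form_ge0 hX) => [y|];
    [exact: ltW | exact: (L2_fmop hX x ld)].
- move=> x; rewrite mul_star norm_sqr; apply: (fm_real_form_le hX) => //.
  exact: (L2_fmop hX x ld).
- apply: fmop_eq; apply/funext => Psi; apply/funext => p /=; rewrite /M_op mulrA -rmorphM;
    by rewrite -expr2 sqr_sqrtr ?ltW// rmorphD mulrDl.
- by apply: fmop_eq; apply/funext => Psi; apply/funext => p /=; rewrite /M_op mulrA -rmorphM;
    rewrite ?mulVf ?divff ?mul1r// ?gt_eqF.
Qed.
End LogEstimate.

(** * The absolute value and its spectral measure *)

Section WeakOperators.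
Context {R : realType} {d : measure_display} {X : measurableType d}.
Context {mu : {measure set X -> \bar R}}.
Context {I : countType} (Lam : I -> partial_iso mu).
Hypothesis hX : standard_borel R X.
Local Notation kernel := (X * X -> R[i]).
Local Notation L2 := (Defs.L2 Lam).
Local Notation rinner := (rinner Lam).

Lemma rinner_mulil Psi Phi : L2 Psi -> L2 Phi ->
  rinner ('i%C \*o Psi) Phi = - rinner Psi ('i%C \*o Phi).
Proof.
move=> h1 h2; rewrite -mulN1r -(rinnerZl hX (-1) h1 (L2_scale hX _ h2)).
rewrite !rinner_def; apply: eq_Rintegral => x _; apply: class_sum_eq => z _ /=.
by case: (Psi _) (Phi _) => a b [a' b'] /=; ring.
Qed.

Lemma L2_cst0 Psi : L2 Psi -> L2 (fun=> 0).
Proof.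
move=> h; rewrite (_ : (fun=> 0) = (0 : R[i]) \*o Psi); first exact: L2_scale.
by apply/funext => p /=; rewrite mul0r.
Qed.

Section Bounded.
Variable A : kernel -> kernel.
Hypothesis hA : bounded_op Lam A.

Lemma bounded_op_L2 Psi : L2 Psi -> L2 (A Psi).
Proof. by case: hA => h _ _; exact: h. Qed.

Lemma bounded_op_add Psi Phi Xi : L2 Psi -> L2 Phi -> L2 Xi ->
  rinner (A (Psi \+ Phi)) Xi = rinner (A Psi) Xi + rinner (A Phi) Xi.
Proof.
move=> h1 h2 h3; have a1 := bounded_op_L2 h1; have a2 := bounded_op_L2 h2.
have a12 := bounded_op_L2 (L2_add hX h1 h2).
have one_scale (Z : kernel) : (1 : R[i]) \*o Z = Z.
  by apply/funext => p /=; rewrite mul1r.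
rewrite -(rinnerDl hX a1 a2 h3).
apply: (eqL2_rinner hX a12 (L2_add hX a1 a2) h3).
by have [_ + _] := hA; move=> /(_ 1 Psi Phi h1 h2); rewrite !one_scale.
Qed.

Lemma bounded_op_scale c Psi Xi : L2 Psi -> L2 Xi ->
  rinner (A (c \*o Psi)) Xi = rinner (c \*o A Psi) Xi.
Proof.
move=> h1 h3; have h0 := L2_cst0 h1; have a0 := bounded_op_L2 h0.
have hc := L2_scale hX c h1; have ac := bounded_op_L2 hc.
have ca := L2_scale hX c (bounded_op_L2 h1).
have add0 (Z : kernel) : Z \+ (fun=> 0) = Z.
  by apply/funext => p /=; rewrite addr0.
have z0 : rinner (A (fun=> 0)) Xi = 0.
  have := bounded_op_add h0 h0 h3; rewrite add0 => /eqP.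
  by rewrite -subr_eq subrr => /eqP.
have [_ + _] := hA; move=> /(_ c Psi _ h1 h0); rewrite add0 => e.
rewrite (eqL2_rinner hX ac (L2_add hX ca a0) h3 e).
by rewrite (rinnerDl hX ca a0 h3) z0 addr0.
Qed.

Lemma bounded_op_form : exists2 M, 0 <= M & forall Psi, L2 Psi ->
  rinner (A Psi) Psi <= M * rinner Psi Psi.
Proof.
(* [M0] bounds squared norms; [|M0| <= (|M0| + 1)^2] avoids a square root and any assumption on the
   sign of [M0]. *)
have [_ _ [M0 hM]] := hA; exists (`|M0| + 1) => [|Psi h].
  by rewrite addr_ge0.
have ha := bounded_op_L2 h; have := hM _ h.
rewrite (normL2sq_rinner hX ha) (normL2sq_rinner hX h) -EFinM lee_fin => le.
have s0 := rinner_ge0 hX h; have cs := rinner_CS hX ha h.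
move: (rinner Psi Psi) (rinner (A Psi) (A Psi)) (rinner (A Psi) Psi) le s0 cs.
move=> s s' r le s0 cs.
have le' : s' <= `|M0| * s.
  by apply: le_trans le _; rewrite ler_wpM2r// ler_norm.
have M1 : 0 <= `|M0| by [].
have r2 : r ^+ 2 <= ((`|M0| + 1) * s) ^+ 2.
  apply: le_trans cs _; apply: le_trans (ler_wpM2r s0 le') _.
  rewrite exprMn -mulrA -expr2 ler_wpM2r ?sqr_ge0//; nra.
have R0 : 0 <= (`|M0| + 1) * s by rewrite mulr_ge0// addr_ge0.
have [r0|/ltW r0] := leP r 0; first exact: le_trans r0 R0.
by rewrite -(@ler_pXn2r _ 2).
Qed.

End Bounded.

Lemma positive_op_ge0 P Psi : positive_op Lam P -> L2 Psi -> 0 <= rinner (P Psi) Psi.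
Proof.
by move=> [_ pos] /pos; rewrite lecE => /andP[_]; rewrite rinner_inner.
Qed.

(* Positivity makes [<P x, i x>] vanish; polarizing this quadratic form, first
   at [x + i z], gives the symmetry of [P]. *)
Lemma positive_op_sym P Psi Phi : positive_op Lam P -> L2 Psi -> L2 Phi ->
  rinner (P Psi) Phi = rinner Psi (P Phi).
Proof.
move=> pP hPsi hPhi; have [bP pos] := pP.
have LP := bounded_op_L2 bP.
have Li (x : kernel) : L2 x -> L2 ('i%C \*o x) by move=> h; exact: L2_scale.
have null x : L2 x -> rinner (P x) ('i%C \*o x) = 0.
  by move=> h; have := pos _ h; rewrite lecE => /andP[/eqP e _]; rewrite -Im_inner e.
have iD (x y : kernel) : 'i%C \*o (x \+ y) = ('i%C \*o x) \+ ('i%C \*o y).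
  by apply/funext => p /=; rewrite mulrDr.
have DR x y z : L2 x -> L2 y -> L2 z -> rinner z (x \+ y) = rinner z x + rinner z y.
  move=> hx hy hz; rewrite (rinnerC hX hz (L2_add hX hx hy)) (rinnerDl hX hx hy hz).
  by rewrite (rinnerC hX hx hz) (rinnerC hX hy hz).
have pol x y : L2 x -> L2 y -> rinner (P x) ('i%C \*o y) + rinner (P y) ('i%C \*o x) = 0.
  move=> hx hy; have := null _ (L2_add hX hx hy).
  rewrite iD (bounded_op_add bP hx hy (L2_add hX (Li _ hx) (Li _ hy))).
  rewrite (DR _ _ _ (Li _ hx) (Li _ hy) (LP _ hx)) (DR _ _ _ (Li _ hx) (Li _ hy) (LP _ hy)).
  by rewrite (null _ hx) (null _ hy) add0r addr0.
have ii (x : kernel) : 'i%C \*o ('i%C \*o x) = (-1)%:C%C \*o x.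
  apply/funext => p /=; rewrite mulrA; congr (_ * _).
  by apply/eqP; rewrite eq_complex /=; apply/andP; split; apply/eqP; ring.
have scN x y : L2 x -> L2 y -> rinner x ((-1)%:C%C \*o y) = - rinner x y.
  move=> hx hy; rewrite (rinnerC hX hx (L2_scale hX _ hy)) (rinnerZl hX _ hy hx).
  by rewrite mulN1r (rinnerC hX hx hy).
have e1 := pol Psi _ hPsi (Li _ hPhi).
have e2 : rinner (P ('i%C \*o Phi)) ('i%C \*o Psi) = rinner (P Phi) Psi.
  rewrite (bounded_op_scale bP _ hPhi (Li _ hPsi)) (rinner_mulil (LP _ hPhi) (Li _ hPsi)).
  by rewrite ii (scN _ _ (LP _ hPhi) hPsi) opprK.
rewrite e2 ii (scN _ _ (LP _ hPsi) hPhi) in e1.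
rewrite (rinnerC hX hPsi (LP _ hPhi)).
by apply/eqP; rewrite eq_sym -subr_eq0 addrC e1.
Qed.

End WeakOperators.

Section AbsoluteValue.
Context {R : realType} {d : measure_display} {X : measurableType d}.
Context {mu : probability X R}.
Context {I : countType} (Lam : I -> partial_iso mu).
Hypothesis hX : standard_borel R X.
Local Notation kernel := (X * X -> R[i]).
Local Notation L2 := (Defs.L2 Lam).
Local Notation rinner := (rinner Lam).
Local Notation delta := (@delta0 R d X).
Local Notation tr := (fmop_tr (Lam := Lam)).
Local Notation star := (@fmop_star _ _ _ _ _ Lam).
Variables (T P : kernel -> kernel) (a : fmop Lam).
Variable E : set (measurableTypeR R) -> kernel -> kernel.
Variable m : {measure set (measurableTypeR R) -> \bar R}.
Hypothesis T_L2 : forall Psi, L2 Psi -> L2 (T Psi).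
Hypothesis T_a : forall Psi, L2 Psi -> eqL2 Lam (T Psi) (fm_op a Psi).
Hypothesis absP : is_abs_op Lam T P.
Hypothesis specE : spectral_measure Lam P E.
Hypothesis mE : forall B, measurable B -> m B = (complex.Re (FM_trace Lam (E B)))%:E.

Let mu_fin : ((mu : {measure set X -> \bar R}) setT < +oo)%E.
Proof. by rewrite -ge0_fin_numE// fin_num_measure. Qed.
Let ld := L2_delta0 Lam hX mu_fin.

Let posP : positive_op Lam P. Proof. by case: absP. Qed.
Let P_L2 Psi : L2 Psi -> L2 (P Psi). Proof. exact: (bounded_op_L2 posP.1). Qed.
Let b : fmop Lam := star a * a.

(** The adjoint of [T] supplied by [is_abs_op] reduces [P o P] to [<T Psi, T Phi>], where [T] may be
    replaced by [a] because they agree up to [eqL2]. *)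
Lemma abs_op_sqr Psi Phi : L2 Psi -> L2 Phi ->
  rinner (P (P Psi)) Phi = rinner (fm_op b Psi) Phi.
Proof.
move=> h1 h2; have [_ [S [bS adj] PP]] := absP.
have S_L2 := bounded_op_L2 bS.
have hT1 := T_L2 h1; have hT2 := T_L2 h2.
have ha1 := L2_fmop hX a h1; have ha2 := L2_fmop hX a h2.
rewrite (eqL2_rinner hX (P_L2 (P_L2 h1)) (S_L2 _ hT1) h2 (PP _ h1)) /=.
rewrite (rinnerC hX (S_L2 _ hT1) h2).
have -> : rinner Phi (S (T Psi)) = rinner (T Phi) (T Psi).
  by rewrite !rinner_inner adj.
rewrite (eqL2_rinner hX hT2 ha2 hT1 (T_a h2)) (rinnerC hX ha2 hT1).
rewrite (eqL2_rinner hX hT1 ha1 ha2 (T_a h1)).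
have := fmop_adjoint hX (star a) ha1 h2; rewrite fmop_starK => <-.
by [].
Qed.

Let V := {Psi : kernel | L2 Psi}.
Let addV (u v : V) : V := exist _ _ (L2_add hX (svalP u) (svalP v)).
Let formV (u v : V) : R := rinner (sval u) (sval v).
Let PV (u : V) : V := exist _ _ (P_L2 (svalP u)).
Let EL2 B (mB : measurable B) Psi : L2 Psi -> L2 (E B Psi).
Proof. by have [/(_ _ mB)[bE _ _] _ _] := specE; exact: (bounded_op_L2 bE). Qed.
(** [E B] is known to preserve L^2 only for measurable [B]; the identity is the default
    elsewhere. *)
Let EV (B : set (measurableTypeR R)) (u : V) : V :=
  if pselect (measurable B) is left mB then exist _ _ (EL2 mB (svalP u)) else u.
Let dV : V := exist _ _ ld.

Let EVE B u : measurable B -> sval (EV B u) = E B (sval u).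
Proof. by move=> mB; rewrite /EV; case: pselect. Qed.

Let form_EVl B u v : measurable B -> formV (EV B u) v = rinner (E B (sval u)) (sval v).
Proof. by move=> mB; rewrite /formV (EVE _ mB). Qed.
Let form_EVr B u v : measurable B -> formV u (EV B v) = rinner (sval u) (E B (sval v)).
Proof. by move=> mB; rewrite /formV (EVE _ mB). Qed.

Let formVE u v : formV u v = rinner (sval u) (sval v). Proof. by []. Qed.

Let sum_sym : forall u v, formV u v = formV v u.
Proof. by move=> u v; exact: (rinnerC hX (svalP u) (svalP v)). Qed.

Lemma abs_op_moment : exists2 M, 0 <= M &
  [/\ m setT = 1%E, m [set t | t < 0] = 0%E, m [set t | M + 1 <= t] = 0%E &
     forall k, (\int[m]_t (t ^+ (2 * k))%:E = (tr (b ^+ k))%:E)%E].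
Proof.
have [M M0 PM] := bounded_op_form hX posP.1; exists M => //.
have [orthE ET _] := specE.
have C : forall u v, formV u v = formV v u := sum_sym.
have Dl u v w : formV (addV u v) w = formV u w + formV v w.
  exact: (rinnerDl hX (svalP u) (svalP v) (svalP w)).
have ge0 u : 0 <= formV u u by exact: (rinner_ge0 hX (svalP u)).
have null u v : formV u u = 0 -> formV u v = 0.
  exact: (rinner_null hX (svalP u) (svalP v)).
have PD u v w : formV (PV (addV u v)) w = formV (PV u) w + formV (PV v) w.
  exact: (bounded_op_add hX posP.1 (svalP u) (svalP v) (svalP w)).
have Psym u v : formV (PV u) v = formV u (PV v).
  exact: (positive_op_sym hX posP (svalP u) (svalP v)).
have P_ge0 u : 0 <= formV (PV u) u by exact: (positive_op_ge0 posP (svalP u)).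
have P_le u : formV (PV u) u <= M * formV u u by exact: (PM _ (svalP u)).
have ED B u v w : measurable B ->
    formV (EV B (addV u v)) w = formV (EV B u) w + formV (EV B v) w.
  move=> mB; rewrite !(form_EVl _ _ mB); have [bE _ _] := orthE _ mB.
  exact: (bounded_op_add hX bE (svalP u) (svalP v) (svalP w)).
have Esym B u v : measurable B -> formV (EV B u) v = formV u (EV B v).
  move=> mB; rewrite (form_EVl _ _ mB) (form_EVr _ _ mB); have [_ [_ adj] _] := orthE _ mB.
  by rewrite !rinner_inner (adj _ _ (svalP u) (svalP v)).
have Eidem B u v : measurable B -> formV (EV B (EV B u)) v = formV (EV B u) v.
  move=> mB; rewrite !(form_EVl _ _ mB) (EVE _ mB); have [_ _ id] := orthE _ mB.
  have h1 := EL2 mB (svalP u).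
  exact: (eqL2_rinner hX (EL2 mB h1) h1 (svalP v) (id _ (svalP u))).
have ETV u v : formV (EV setT u) v = formV u v.
  rewrite (form_EVl _ _ measurableT).
  exact: (eqL2_rinner hX (EL2 measurableT (svalP u)) (svalP u) (svalP v) (ET _ (svalP u))).
have Espec u : exists2 m : {measure set (measurableTypeR R) -> \bar R},
    scalar_spectral_measure formV EV u m & (\int[m]_t t%:E = (formV (PV u) u)%:E)%E.
  have [_ _ /(_ _ (svalP u))[m' m'E m'P]] := specE.
  exists m' => [B mB|]; first by rewrite (m'E _ mB) (form_EVl _ _ mB) rinner_inner.
  by rewrite m'P formVE rinner_inner.
have ssm : scalar_spectral_measure formV EV dV m.
  by move=> B mB; rewrite (mE mB) (form_EVl _ _ mB) rinner_inner.
pose PP x := PV (PV x).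
have mom k : (\int[m]_t (t ^+ (2 * k))%:E = (tr (b ^+ k))%:E)%E.
  rewrite (iter_moment C Dl ge0 null PD Psym P_ge0 ED Esym Eidem ETV Espec k ssm).
  congr EFin.
  have tele : forall j u v, formV (iter j PV u) (iter j PV v) = formV (iter j PP u) v.
    elim=> [//|j IH] u v; rewrite !iterSr IH -Psym; congr (formV _ v).
    by elim: j {IH} => [|j IHj] //; rewrite !iterS -IHj.
  (* [P o P] and [b] agree only after pairing with a vector, so [b] cannot be substituted inside an
     iterate. Each [b] is moved to the other argument by self-adjointness before the induction
     hypothesis is used. *)
  have bE : forall j u v, formV (iter j PP u) v = rinner (iter j (fm_op b) (sval u)) (sval v).
    elim=> [//|j IH] u v; rewrite !iterS.
    have Lb j' : L2 (iter j' (fm_op b) (sval u)).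
      by elim: j' => [|j' IHj]; [exact: svalP | exact: (L2_fmop hX b IHj)].
    rewrite formVE (abs_op_sqr (svalP _) (svalP _)).
    rewrite (fmop_adjoint hX b (svalP _) (svalP _)) (fmop_adjoint hX b (Lb j) (svalP _)).
    have -> : star b = b by rewrite /b fmop_starM fmop_starK.
    exact: (IH u (exist _ _ (L2_fmop hX b (svalP v)))).
  rewrite tele bE /fmop_tr /fm_tr; congr (rinner _ delta).
  by elim: k => [//|k IH]; rewrite exprS /= IH.
split => //.
- have := mom 0; rewrite expr0 fmop_tr1 => <-.
  by under eq_integral do rewrite muln0 expr0; rewrite integral_cst// mul1e.
- exact: (ssm_lt0 C Dl ge0 null P_ge0 ED Esym Eidem ETV Espec ssm).
- exact: (ssm_gt C Dl ge0 null M0 P_le ED Esym Eidem ETV Espec ssm).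
Qed.
End AbsoluteValue.

Section ProbabilityOfMeasure.
Context {R : realType} {d : measure_display} {T : measurableType d}.
Variable m : {measure set T -> \bar R}.
Hypothesis m1 : m setT = 1%E.
Definition unit_measure of m setT = 1%E : set T -> \bar R := m.
HB.instance Definition _ := Measure.on (unit_measure m1).
HB.instance Definition _ := Measure_isProbability.Build d T R (unit_measure m1) m1.

Lemma probability_of_measure : {nu : probability T R | forall B, nu B = m B}.
Proof. by exists (unit_measure m1). Qed.
End ProbabilityOfMeasure.

Section PolynomialMoments.
Context {R : realType} {d : measure_display} {T : measurableType d}.
Variables (A : algType R) (t : A -> R) (b : A) (nu : probability T R) (y : T -> R) (K : R).
Hypothesis tD : forall a c, t (a + c) = t a + t c.
Hypothesis tZ : forall s a, t (s *: a) = s * t a.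
Hypothesis y_meas : measurable_fun setT y.
Hypothesis y_bound : forall x, `|y x| <= K.
Hypothesis t_moment : forall k, t (b ^+ k) = \int[nu]_x (y x ^+ k).

Let yX_meas k : measurable_fun setT (fun x => y x ^+ k).
Proof. exact: measurable_funX. Qed.
Let yX_bound k x : `|y x ^+ k| <= K ^+ k.
Proof.
by rewrite normrX lerXn2r ?nnegrE// (le_trans _ (y_bound x)).
Qed.

Lemma horner_alg_moment (p : {poly R}) : t (horner_alg b p) = \int[nu]_x p.[y x].
Proof.
have -> : horner_alg b p = \sum_(i < size p) p`_i *: b ^+ i.
  rewrite -{1}(coefK p) poly_def linear_sum /=; apply: eq_bigr => i _.
  by rewrite linearZ /= rmorphXn /= horner_algX mulr_algl.
have sumE n : t (\sum_(i < n) p`_i *: b ^+ i) = \int[nu]_x (\sum_(i < n) p`_i * y x ^+ i).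
  elim: n => [|n IH].
    rewrite big_ord0 -(scale0r 1) tZ mul0r.
    by under eq_Rintegral do rewrite big_ord0; rewrite Rintegral_cst// mul0r.
  rewrite big_ord_recr /= tD IH tZ t_moment.
  under [RHS]eq_Rintegral do rewrite big_ord_recr /=.
  have mX k : measurable_fun setT (fun x => p`_k * y x ^+ k) by exact: measurable_funM.
  rewrite RintegralD//.
  - by rewrite RintegralZl//; exact: (bounded_integrable nu (yX_meas n) (yX_bound n)).
  - apply: (@bounded_integrable _ _ _ nu _ (\sum_(i < n) `|p`_i| * K ^+ i)).
      exact: measurable_sum.
    move=> x; apply: le_trans (ler_norm_sum _ _ _) _; apply: ler_sum => i _.
    by rewrite normrM ler_wpM2l.
  - apply: (@bounded_integrable _ _ _ nu _ (`|p`_n| * K ^+ n)) => // x.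
    by rewrite normrM ler_wpM2l.
by rewrite sumE; apply: eq_Rintegral => x _; rewrite horner_coef.
Qed.

(** The truncated logarithm is the trace of a polynomial in [b], hence determined by the moments of
    [b]. *)
Lemma trunc_log_moment kap eps n :
  trunc_log t n (1 - kap *: (eps%:A + b)) =
  \sum_(k < n) k.+1%:R^-1 * \int[nu]_x ((1 - kap * (eps + y x)) ^+ k.+1).
Proof.
apply: eq_bigr => k _; congr (_ * _).
have <- : horner_alg b ((1 - kap *: (eps%:P + 'X)) ^+ k.+1) = (1 - kap *: (eps%:A + b)) ^+ k.+1.
  rewrite rmorphXn rmorphB rmorph1; congr ((1 - _) ^+ _).
  by rewrite /= linearZ /= rmorphD /= horner_algX horner_algC mulr_algl.
rewrite horner_alg_moment.
by apply: eq_Rintegral => x _; rewrite !hornerE.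
Qed.

End PolynomialMoments.

(** * Comparison of the two logarithmic integrals *)

Section LogIntegral.
Context {R : realType} {d : measure_display} {X : measurableType d}.
Context {mu : probability X R}.
Context {I : countType} (Lam : I -> partial_iso mu).
Hypothesis hX : standard_borel R X.
Local Notation tr := (fmop_tr (Lam := Lam)).
Local Notation star := (@fmop_star _ _ _ _ _ Lam).
Local Notation Rm := (measurableTypeR R).
Variables (q a : fmop Lam) (w : X -> R) (rho Mh M : R).
Hypothesis bw : bounded_real w.
Hypothesis q_trace : forall j, tr (q ^+ j.+1) = 0.
Hypothesis rho_ge0 : 0 <= rho.
Hypothesis rho_lt1 : rho < 1.
Hypothesis q_bound : mul_bound star tr q rho.
Hypothesis w_gt0 : forall x, 0 < w x.
Hypothesis w_le : forall x, w x <= Mh.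
Hypothesis star_aa : star a * a = star (1 + q) * fm_real Lam bw * (1 + q).
Variable m : {measure set Rm -> \bar R}.
Hypothesis M_ge0 : 0 <= M.
Hypothesis m1 : m setT = 1%E.
Hypothesis m_lt0 : m [set t | t < 0] = 0%E.
Hypothesis m_gt : m [set t | M + 1 <= t] = 0%E.
Hypothesis m_moment : forall k,
  (\int[m]_t (t ^+ (2 * k))%:E = (tr ((star a * a) ^+ k))%:E)%E.

Let mu_fin : ((mu : {measure set X -> \bar R}) setT < +oo)%E.
Proof. by rewrite -ge0_fin_numE// fin_num_measure. Qed.

(** Bounded at every point, as the logarithmic estimates require, and equal to [t] almost everywhere
    because [m] lives on [[0, M + 1[]. *)
Let z (t : Rm) : R := Num.min (Num.max t 0) (M + 1).
Let z_ge0 t : 0 <= z t.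
Proof. by rewrite le_min le_max lexx orbT /= addr_ge0. Qed.
Let z_le t : z t <= M + 1.
Proof. by rewrite ge_min lexx orbT. Qed.
Let z_meas : measurable_fun setT z.
Proof. by apply: measurable_minr => //; apply: measurable_maxr => //; exact: measurable_id. Qed.
Let z_id t : 0 <= t -> t < M + 1 -> z t = t.
Proof. by move=> t0 tM; rewrite /z max_l// min_l// ltW. Qed.

Let z_ae : m.-negligible (~` [set t : Rm | 0 <= t /\ z t = t]).
Proof.
apply: (@negligibleS _ _ _ _ ([set t : Rm | t < 0] `|` [set t : Rm | M + 1 <= t])).
  move=> t /= h; apply: contrapT => /not_orP[/negP h1 /negP h2]; apply: h.
  by rewrite -leNgt in h1; rewrite -ltNge in h2; rewrite z_id.
apply: negligibleU; apply/negligibleP => //.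
  by rewrite -set_itvNyo; exact: measurable_itv.
by rewrite -set_itvcy; exact: measurable_itv.
Qed.

Lemma log_integral_eq :
  (\int[m]_(t in `[0%R, +oo[) lne t%:E = \int[mu]_x lne (Num.sqrt (w x))%:E)%E.
Proof.
have [nu nuE] := probability_of_measure m1.
have w_ge0 x : 0 <= w x by exact: ltW.
have Mh0 : 0 <= Mh by exact: le_trans (w_ge0 point) (w_le point).
have int_nu (f : Rm -> \bar R) : (\int[nu]_t f t = \int[m]_t f t)%E.
  by apply: eq_measure_integral => B _ _; exact: nuE.
have z2_meas : measurable_fun setT (fun t => z t ^+ 2) by exact: measurable_funX.
have lhs : (\int[m]_(t in `[0%R, +oo[) lne t%:E = \int[nu]_t lne (z t)%:E)%E.
  rewrite int_nu integral_mkcond; apply: (@ae_eq_integral _ _ _ m setT) => //.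
  - have mD : measurable (`[0%R, +oo[ : set Rm) by exact: measurable_itv.
    apply: (measurable_restrictT _ mD).1.
    by apply: measurable_funTS; apply: measurable_lne; exact: measurable_id.
  - exact: measurable_lne.
  apply: negligibleS z_ae => t /= h [t0 zt]; apply: h => _.
  by rewrite patchE zt ifT// inE /= in_itv /= t0.
have moment k : tr ((star a * a) ^+ k) = \int[nu]_t ((z t ^+ 2) ^+ k).
  have := m_moment k => /(congr1 fine) /= <-; congr fine; rewrite int_nu.
  apply: (@ae_eq_integral _ _ _ m setT) => //.
  - by apply/measurable_EFinP; apply: measurable_funX.
  - by apply/measurable_EFinP; apply: measurable_funX.
  by apply: negligibleS z_ae => t /= h [t0 zt]; apply: h => _; rewrite exprM zt.
have z2_bound t : `|z t ^+ 2| <= (M + 1) ^+ 2.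
  by rewrite ger0_norm ?sqr_ge0// lerXn2r ?nnegrE// addr_ge0.
(* Dominates [1 + z^2] for both functions and [eps + 4 Mh] for [eps <= 1], so that the single number
   [c^2 = S^-1] normalizes both logarithms and serves as [kap]. *)
pose S := 1 + 4 * Mh + (M + 1) ^+ 2.
have S1 : 1 <= S by rewrite /S -addrA lerDl addr_ge0 ?sqr_ge0// mulr_ge0.
have S0 : 0 < S by exact: lt_le_trans S1.
pose c := Num.sqrt S^-1.
have c0 : 0 < c by rewrite sqrtr_gt0 invr_gt0.
have c2 : c ^+ 2 = S^-1 by rewrite sqr_sqrtr// invr_ge0 ltW.
have cle y : y <= S -> c ^+ 2 * y <= 1.
  by move=> yS; rewrite c2 ler_pdivrMl// mulr1.
pose k0 := (1 - rho)^-1.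
have k0_ge0 : 0 <= k0 by rewrite invr_ge0 subr_ge0 ltW.
pose J eps := \int[mu]_x (eps / (eps / 4 + w x)).
rewrite lhs.
apply: (integral_lne_eq (nu1 := nu) (nu2 := mu) (c := c) (K := 2 * k0 * 3)
  (del := fun eps => 2 * k0 * (k0 * Num.sqrt (J eps)))) => //.
- by apply: (measurableT_comp measurable_sqrt); exact: bw.1.
- by rewrite !mulr_ge0.
- move=> t; apply: cle; have := z2_bound t; rewrite ger0_norm ?sqr_ge0// /S => h.
  by rewrite -addrA lerD2l (le_trans h)// lerDr mulr_ge0.
- move=> x; apply: cle; rewrite sqr_sqrtr// /S -addrA lerD2l.
  have := w_le x; have := sqr_ge0 (M + 1); lra.
- move=> eps n e0 e1.
  have kle : c ^+ 2 * (eps + 4 * Mh) <= 1.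
    by apply: cle; rewrite /S; have := sqr_ge0 (M + 1); lra.
  have c20 : 0 < c ^+ 2 by rewrite exprn_gt0.
  have := trunc_log_full_le hX bw q_trace rho_ge0 rho_lt1 q_bound w_gt0 w_le e0 c20 kle n.
  rewrite -star_aa.
  rewrite (trunc_log_moment (fmop_trD hX mu_fin) (fmop_trZ hX mu_fin) z2_meas z2_bound moment).
  rewrite -/k0 -/(J eps) mulrDr [2 * k0 * (3 * _)]mulrA.
  under [X in _ - X]eq_bigr => k _ do under eq_Rintegral => x _ do
    rewrite -[w x]sqr_sqrtr//.
  by [].
- have w0 : mu [set x | w x = 0] = 0%E.
    rewrite (_ : [set x | _] = set0) ?measure0//.
    by apply/seteqP; split => // x /= wx; have := w_gt0 x; rewrite wx ltxx.
  have J0 := cvg_regularized_inverse bw.1 w_ge0 w0.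
  have sJ : Num.sqrt (J n.+1%:R^-1) @[n --> \oo] --> (0 : R).
    by rewrite -(sqrtr0 R); apply: cvg_comp J0 _; exact: sqrt_continuous.
  rewrite -(mulr0 (2 * k0)) -(mulr0 k0).
  by apply: cvgMr; apply: cvgMr.
Qed.

End LogIntegral.

(** * Essentially bounded coefficients *)

Section EssentiallyBounded.
Context {R : realType} {d : measure_display} {X : measurableType d}.
Variable mu : probability X R.
Local Notation muT := (mu : {measure set X -> \bar R}).

Lemma Linfty_norm_ge0 (f : X -> R[i]) : (0 <= Linfty_norm muT f)%E.
Proof. exact: Lnorm_ge0. Qed.

Lemma Linfty_norm_negligible (f : X -> R[i]) : (Linfty_norm muT f < +oo)%E ->
  muT.-negligible (~` [set x | sqnorm (f x) <= fine (Linfty_norm muT f) ^+ 2]).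
Proof.
move=> foo; have f0 := Linfty_norm_ge0 f.
have fK : Linfty_norm muT f = (fine (Linfty_norm muT f))%:E.
  by rewrite fineK// ge0_fin_numE.
set K := fine _ in fK *.
have K0 : 0 <= K by rewrite -lee_fin -fK.
have supE : (ess_sup muT (abse \o (fun x => (Normc.normc (f x))%:E)) <= K%:E)%E.
  have mu1 : (0 < muT setT)%E by rewrite (_ : muT setT = 1%E)//; exact: probability_setT.
  by rewrite -fK /Linfty_norm unlock /= mu1.
have /ess_supP := supE.
apply: negligibleS => x /= h le; apply: h.
move: le; rewrite lee_fin => le.
rewrite -normc_sqr lerXn2r ?nnegrE//; last by apply: le_trans le; exact: ler_norm.
by case: (f x) => a b; exact: sqrtr_ge0.
Qed.

Lemma Re_inv (z : R[i]) : complex.Re z^-1 = complex.Re z * (sqnorm z)^-1.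
Proof. by case: z. Qed.
Lemma Im_inv (z : R[i]) : complex.Im z^-1 = - complex.Im z * (sqnorm z)^-1.
Proof. by case: z => a b; rewrite mulNr. Qed.

Lemma measurable_sqnorm (f : X -> R[i]) : cmeasurable_fun setT f ->
  measurable_fun setT (fun x => sqnorm (f x)).
Proof. by move=> [m1 m2]; apply: measurable_funD; apply: measurable_funX. Qed.

Lemma cmeasurable_div (f h : X -> R[i]) : cmeasurable_fun setT f ->
  cmeasurable_fun setT h -> cmeasurable_fun setT (fun x => f x / h x).
Proof.
move=> mf mh; apply: (cmeasurableM mf).
have mi : measurable_fun setT (fun x => (sqnorm (h x))^-1).
  by apply: (measurableT_comp measurable_inv); exact: measurable_sqnorm.
split.
- rewrite (_ : (fun _ => _) = fun x => complex.Re (h x) * (sqnorm (h x))^-1).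
    by apply: measurable_funM => //; exact: mh.1.
  by apply/funext => x; rewrite Re_inv.
- rewrite (_ : (fun _ => _) = fun x => - complex.Im (h x) * (sqnorm (h x))^-1).
    by apply: measurable_funM => //; apply: measurable_funN; exact: mh.2.
  by apply/funext => x; rewrite Im_inv.
Qed.

Lemma cmeasurable_if (B : set X) (f h : X -> R[i]) : measurable B ->
  cmeasurable_fun setT f -> cmeasurable_fun setT h ->
  cmeasurable_fun setT (fun x => if x \in B then f x else h x).
Proof.
move=> mB [f1 f2] [h1 h2].
have mb : measurable_fun setT (fun x => x \in B).
  by apply: (measurable_fun_bool true); rewrite setTI (_ : _ @^-1` _ = B)//;
    apply/seteqP; split => x /=; [move/set_mem | move/mem_set].
split.
- rewrite (_ : (fun _ => _) = fun x => if x \in B then complex.Re (f x) else complex.Re (h x)).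
    exact: measurable_fun_ifT.
  by apply/funext => x; case: ifP.
- rewrite (_ : (fun _ => _) = fun x => if x \in B then complex.Im (f x) else complex.Im (h x)).
    exact: measurable_fun_ifT.
  by apply/funext => x; case: ifP.
Qed.

Lemma negligible_cover (J : finType) (N : J -> set X) :
  (forall j, muT.-negligible (N j)) ->
  exists2 B, measurable B & muT B = 0%E /\ forall j, N j `<=` B.
Proof.
move=> nN.
have /negligibleS nU : muT.-negligible (\bigcup_k
    (if nth None [seq Some j | j <- enum J] k is Some j then N j else set0)).
  apply: negligible_bigcup => k; case: (nth _ _ _) => [j|]; first exact: nN.
  exact: negligible_set0.
have [B [mB B0 sB]] := nU _ (@subset_refl _ _).
exists B => //; split => // j x Nx; apply: sB; exists (enum_rank j) => //.
by rewrite (nth_map j) ?nth_enum_rank// -cardE.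
Qed.

End EssentiallyBounded.

Section AlmostEverywhere.
Context {R : realType} {d : measure_display} {X : measurableType d}.
Context {mu : {measure set X -> \bar R}}.
Context {I : countType} (Lam : I -> partial_iso mu).
Hypothesis hX : standard_borel R X.
Local Notation kernel := (X * X -> R[i]).
Variable B : set X.
Hypothesis mB : measurable B.
Hypothesis muB : mu B = 0%E.

Let measurable_class_norm (Psi : kernel) : cmeasurable_fun (rel_set Lam) Psi ->
  measurable_fun setT
    (fun x => \esum_(z in rel_class Lam x) ((Normc.normc (Psi (x, z))) ^+ 2)%:E)%E.
Proof.
move=> mPsi; pose F p := (rel_restrict Lam (rdot Psi Psi) p)%:E.
rewrite (_ : (fun _ => _) = fun x => \esum_(z in rel_class Lam x) F (x, z)).
  apply: (@measurable_esum_rel_class _ _ _ _ _ Lam hX F).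
    apply/measurable_EFinP; apply: (measurable_rel_restrict hX).
    exact: (measurable_rdot mPsi mPsi).
  move=> p; rewrite /F /rel_restrict patchE lee_fin; case: ifPn => // _.
  by rewrite rdot_self sqnorm_ge0.
apply/funext => x; apply: eq_esum => z /rel_class_rel_set h.
by rewrite /F rel_restrictE// normc_sqr rdot_self.
Qed.

Lemma normL2sq_ae (Psi Phi : kernel) : cmeasurable_fun (rel_set Lam) Psi ->
  cmeasurable_fun (rel_set Lam) Phi -> (forall p, ~ B p.1 -> Psi p = Phi p) ->
  normL2sq Lam Psi = normL2sq Lam Phi.
Proof.
move=> m1 m2 h; rewrite !normL2sq_def; apply: ae_eq_integral => //.
- exact: measurable_class_norm.
- exact: measurable_class_norm.
exists B; split => // x /= nx; apply: contrapT => Bx; apply: nx => _.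
by apply: eq_esum => z _; rewrite h.
Qed.

Lemma normL2sq0 : normL2sq Lam (fun=> 0) = 0%E.
Proof.
rewrite normL2sq_def; apply: integral0_eq => x _; apply: esum1 => z _.
by rewrite normc_sqr /sqnorm /= expr0n addr0.
Qed.

Lemma eqL2_refl (Psi : kernel) : eqL2 Lam Psi Psi.
Proof.
rewrite /eqL2 (_ : Psi \- Psi = fun=> 0) ?normL2sq0//.
by apply/funext => p /=; rewrite subrr.
Qed.

Lemma eqL2_ae (Psi Phi : kernel) : cmeasurable_fun (rel_set Lam) Psi ->
  cmeasurable_fun (rel_set Lam) Phi -> (forall p, ~ B p.1 -> Psi p = Phi p) ->
  eqL2 Lam Psi Phi.
Proof.
move=> m1 m2 h; rewrite /eqL2 kernel_sub -normL2sq0; apply: normL2sq_ae.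
- by apply: cmeasurableD => //; apply: (cmeasurableM (cmeasurable_cst _ _) m2).
- exact: cmeasurable_cst.
by move=> p Bp /=; rewrite rmorphN1 mulN1r h// subrr.
Qed.

End AlmostEverywhere.

(** * The operator [T] and its comparison with an exact operator *)

Section SumOfTranslations.
Context {R : realType} {d : measure_display} {X : measurableType d}.
Context {mu : {measure set X -> \bar R}}.
Context {I : countType} (Lam : I -> partial_iso mu).
Hypothesis hX : standard_borel R X.
Local Notation kernel := (X * X -> R[i]).
Variables (n : nat) (g : 'I_n -> I) (f : 'I_n -> X -> R[i]).
Hypothesis f_meas : forall i, cmeasurable_fun setT (f i).

Definition translation_sum : kernel -> kernel :=
  \sum_(i < n) (M_op (f i) \o L_op Lam [:: (g i, true)]).

Lemma translation_sumE Psi p :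
  translation_sum Psi p = \sum_(i < n) f i p.1 * L_op Lam [:: (g i, true)] Psi p.
Proof. by rewrite /translation_sum !fct_sumE. Qed.

Lemma cmeasurable_translation_sum Psi : cmeasurable_fun (rel_set Lam) Psi ->
  cmeasurable_fun (rel_set Lam) (translation_sum Psi).
Proof.
move=> m; rewrite (_ : translation_sum Psi =
    fun p => \sum_(i < n) f i p.1 * L_op Lam [:: (g i, true)] Psi p); last first.
  by apply/funext => p; rewrite translation_sumE.
suff h (s : seq 'I_n) : cmeasurable_fun (rel_set Lam)
    (fun p => \sum_(i <- s) f i p.1 * L_op Lam [:: (g i, true)] Psi p) by exact: h.
elim: s => [|i s IH].
  rewrite (_ : (fun _ => _) = fun=> 0); first exact: cmeasurable_cst.
  by apply/funext => p; rewrite big_nil.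
rewrite (_ : (fun _ => _) = (fun p => f i p.1 * L_op Lam [:: (g i, true)] Psi p) \+
    (fun p => \sum_(i <- s) f i p.1 * L_op Lam [:: (g i, true)] Psi p)).
  apply: cmeasurableD => //; apply: cmeasurableM; first exact: cmeasurable_fst.
  exact: (cmeasurable_L_op hX _ m).
by apply/funext => p; rewrite big_cons.
Qed.

Lemma FM_span_translation_sum : (forall i, Linfty mu (f i)) ->
  FM_span Lam translation_sum.
Proof.
move=> hf; exists n, (fun=> 1), (fun i => M_op (f i) \o L_op Lam [:: (g i, true)]); split.
  move=> i; exists 2, (fun j : 'I_2 => if j == ord0 then M_op (f i) else L_op Lam [:: (g i, true)]).
  split; last by rewrite !big_ord_recl big_ord0.
  by move=> j; case: ifP => _; [right; exists (f i) | left; exists (g i, true)].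
apply/funext => Psi; apply/funext => p; rewrite translation_sumE.
by apply: eq_bigr => i _; rewrite mul1r.
Qed.

Lemma translation_sum_linear (c : R[i]) Psi Phi :
  translation_sum (c \*o Psi \+ Phi) = c \*o translation_sum Psi \+ translation_sum Phi.
Proof.
apply/funext => p; rewrite /= !translation_sumE mulr_sumr -big_split /=.
apply: eq_bigr => i _; have [lD lZ] := fm_pair_linear (fm_letter Lam (g i, true)).
by rewrite lD lZ /= mulrDr mulrCA.
Qed.

Variables (B : set X) (a : fmop Lam).
Hypothesis mB : measurable B.
Hypothesis muB : mu B = 0%E.
Hypothesis aE : forall Psi p, ~ B p.1 -> translation_sum Psi p = fm_op a Psi p.

Let cmeas Psi : L2 Lam Psi -> cmeasurable_fun (rel_set Lam) Psi.
Proof. by move=> /L2_def[]. Qed.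

Lemma translation_sum_norm Psi : L2 Lam Psi ->
  normL2sq Lam (translation_sum Psi) = normL2sq Lam (fm_op a Psi).
Proof.
move=> h; apply: (normL2sq_ae hX mB muB).
- exact: (cmeasurable_translation_sum (cmeas h)).
- exact: (cmeas (L2_fmop hX a h)).
by move=> p; exact: aE.
Qed.

Lemma translation_sum_eqL2 Psi : L2 Lam Psi ->
  eqL2 Lam (translation_sum Psi) (fm_op a Psi).
Proof.
move=> h; apply: (eqL2_ae hX mB muB).
- exact: (cmeasurable_translation_sum (cmeas h)).
- exact: (cmeas (L2_fmop hX a h)).
by move=> p; exact: aE.
Qed.

(** Linearity holds exactly, while the norm bound is borrowed from [a], which agrees with the sum
    when the first coordinate is outside the null set [B]. *)
Lemma bounded_translation_sum : bounded_op Lam translation_sum.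
Proof.
have L2T Psi : L2 Lam Psi -> L2 Lam (translation_sum Psi).
  move=> h; apply/L2_def; split; first exact: (cmeasurable_translation_sum (cmeas h)).
  by rewrite translation_sum_norm//; have /L2_def[] := L2_fmop hX a h.
split => //.
- by move=> c Psi Phi _ _; rewrite translation_sum_linear; exact: eqL2_refl.
have [K K0 hK] := fmop_bound hX a; exists K => Psi h.
rewrite translation_sum_norm// (normL2sq_rinner hX (L2_fmop hX a h)).
by rewrite (normL2sq_rinner hX h) -EFinM lee_fin; exact: hK.
Qed.

Lemma FM_algebra_translation_sum : (forall i, Linfty mu (f i)) ->
  FM_algebra Lam translation_sum.
Proof.
move=> hf; split; first exact: bounded_translation_sum.
move=> k Psi Phi e _ e0; exists translation_sum; first exact: FM_span_translation_sum.
by move=> j; rewrite subrr Normc.normc0.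
Qed.

End SumOfTranslations.

Lemma integral_letter {R : realType} {d : measure_display} {X : measurableType d}
    {mu : {measure set X -> \bar R}} {I : countType} (Lam : I -> partial_iso mu) l
    (G : X -> \bar R) : letter_dom Lam l = setT -> letter_dom Lam (letter_inv l) = setT ->
  measurable_fun setT G ->
  (\int[mu]_x G (letter_fun Lam l x) = \int[mu]_x G x)%E.
Proof.
move=> dl dl' mG; rewrite integralE [RHS]integralE.
have ge0 (H : X -> \bar R) : measurable_fun setT H -> (forall x, 0 <= H x)%E ->
    (\int[mu]_x H (letter_fun Lam l x) = \int[mu]_x H x)%E.
  by move=> mH H0; have := @ge0_integral_letter _ _ _ _ _ Lam l H; rewrite dl dl'; exact.
have pE := ge0 _ (measurable_funepos mG) (fun x => funepos_ge0 G x).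
have nE := ge0 _ (measurable_funeneg mG) (fun x => funeneg_ge0 G x).
by rewrite -pE -nE; congr (_ - _)%E; apply: eq_integral => x _; rewrite ?funeposE ?funenegE.
Qed.

Lemma sqnorm_eq0 {R : realType} (z : R[i]) : (sqnorm z == 0) = (z == 0).
Proof. by case: z => a b; rewrite /sqnorm /= paddr_eq0 ?sqr_ge0// !sqrf_eq0 eq_complex. Qed.

Theorem theorem2p3 (R : realType) (d : measure_display) (X : measurableType d)
  (mu : probability X R)
  (hX : standard_borel R X) (hmu : atomless mu)
  (I : countType) (Lam : I -> partial_iso mu)
  (htree : treeing Lam) (herg : ergodic Lam)
  (n : nat) (hn : (1 <= n)%N)
  (g : 'I_n -> I) (hg : injective g)
  (f : 'I_n -> X -> R[i]) (hf : forall i, Linfty mu (f i))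
  (i0 : 'I_n)
  (hsum : (\sum_(i < n | i != i0)
             Linfty_norm mu (fun x => f i x / f i0 x)%R < 1)%E)
  (hf0 : mu [set x | f i0 x = 0] = 0%E)
  (hdom : pdom (Lam (g i0)) = setT) (hrng : prng (Lam (g i0)) = setT) :
  let T := (\sum_(i < n) (M_op (f i) \o L_op Lam [:: (g i, true)]))%R in
  FM_algebra Lam T /\
  forall D : \bar R, is_FK_det Lam T D ->
    lne D = (\int[mu]_x lne (Normc.normc (f i0 x))%:E)%E.
Proof.
move=> T.
pose muT : {measure set X -> \bar R} := mu.
have f_meas i : cmeasurable_fun setT (f i) by case: (hf i).
pose nrm i := Linfty_norm muT (fun x => f i x / f i0 x).
(* Since [u i0] is set to 0 below, the value 0 is a valid bound at [i0]. *)
pose c i : R := if i == i0 then 0 else fine (nrm i).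
have nrm_ge0 i : (0 <= nrm i)%E by exact: Linfty_norm_ge0.
have nrm_fin i : i != i0 -> (nrm i < +oo)%E.
  move=> ii0; apply: lt_trans (ltry 1); apply: le_lt_trans hsum.
  by rewrite (bigD1 i)//= leeDl//; apply: sume_ge0 => j _; exact: nrm_ge0.
have c_ge0 i : 0 <= c i by rewrite /c; case: eqP => // _; exact: fine_ge0.
have rho_lt1 : \sum_(i < n | i != i0) c i < 1.
  rewrite -lte_fin -sumEFin; apply: le_lt_trans hsum; apply: lee_sum => i ii0.
  by rewrite /c (negbTE ii0) fineK// ge0_fin_numE// nrm_fin.
pose K := fine (Linfty_norm muT (f i0)).
pose N (j : option 'I_n) : set X := if j is Some i then
  (if i == i0 then ~` [set x | sqnorm (f i0 x) <= K ^+ 2]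
   else ~` [set x | sqnorm (f i x / f i0 x) <= c i ^+ 2])
  else [set x | f i0 x = 0].
have [B mB [muB NB]] : exists2 B, measurable B & muT B = 0%E /\ forall j, N j `<=` B.
  apply: negligible_cover => -[i|] /=.
    have [ii0|ii0] := eqVneq i i0.
      by apply: Linfty_norm_negligible; case: (hf i0).
    by rewrite /c (negbTE ii0); apply: Linfty_norm_negligible; exact: nrm_fin.
  apply/negligibleP => //.
  rewrite (_ : [set x | _] = [set x | sqnorm (f i0 x) = 0]).
    have := measurable_sqnorm (f_meas i0).
    by move=> /(_ measurableT [set 0] (measurable_set1 _)); rewrite setTI.
  by apply/seteqP; split => x /eqP h; apply/eqP; rewrite ?sqnorm_eq0// -sqnorm_eq0.
(* On the null set [B] the leading coefficient becomes 1 and the ratios become 0. All bounds then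
   hold at every point and [F0] vanishes nowhere, as the algebra of exact operators requires. *)
pose F0 x : R[i] := if x \in B then 1 else f i0 x.
pose u i x : R[i] := if x \in B then 0 else if i == i0 then 0 else f i x / f i0 x.
have F0_meas : cmeasurable_fun setT F0.
  exact: cmeasurable_if.
have u_meas i : cmeasurable_fun setT (u i).
  apply: cmeasurable_if => //.
  by case: (i == i0) => //; exact: cmeasurable_div.
have sq0 : sqnorm (0 : R[i]) = 0 by rewrite /sqnorm /= expr0n addr0.
have u_le i x : sqnorm (u i x) <= c i ^+ 2.
  rewrite /u; case: ifPn => [|/negP xB]; first by rewrite sq0 sqr_ge0.
  case: ifPn => [|ii0]; first by rewrite sq0 sqr_ge0.
  apply: contrapT => h; apply: xB; apply/mem_set; apply: (NB (Some i)) => /=.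
  by rewrite (negbTE ii0).
have F0_le x : sqnorm (F0 x) <= 1 + K ^+ 2.
  rewrite /F0; case: ifPn => [_|/negP xB].
    by rewrite /sqnorm /= expr1n expr0n addr0 lerDl sqr_ge0.
  apply: contrapT => h; apply: xB; apply/mem_set; apply: (NB (Some i0)) => /=.
  by rewrite eqxx => le; apply: h; apply: le_trans le _; rewrite lerDr.
have F0_gt0 x : 0 < sqnorm (F0 x).
  rewrite lt_neqAle eq_sym sqnorm_ge0 andbT sqnorm_eq0 /F0.
  case: ifPn => [_|/negP xB]; first exact: oner_neq0.
  by apply/eqP => fz; apply: xB; apply/mem_set; exact: (NB None).
have F0_bounded : bounded_fun F0 by split => //; exists (1 + K ^+ 2).
pose a : fmop Lam := full_op hdom F0_bounded u_meas u_le.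
have aE Psi p : ~ B p.1 -> translation_sum Lam g f Psi p = fm_op a Psi p.
  move=> pB; rewrite /a (full_opE hdom hrng) translation_sumE (bigD1 i0)//= mulrDr.
  have pB' : p.1 \in B = false by apply/negP => /set_mem.
  rewrite /F0 pB'; congr (_ + _); rewrite mulr_sumr; apply: eq_bigr => i ii0.
  rewrite /u pB' (negbTE ii0) mulrA; congr (_ * _); rewrite mulrCA divff ?mulr1//.
  by apply/eqP => fz; apply: pB; exact: (NB None).
have T_bd := bounded_translation_sum hX f_meas mB muB aE.
split; first exact: (FM_algebra_translation_sum hX f_meas mB muB aE hf).
move=> D [P [E [m [absP specE mE ->]]]]; rewrite expeRK.
have [M M0 [m1 mlt mgt mom]] := abs_op_moment hX (bounded_op_L2 T_bd)
  (translation_sum_eqL2 hX f_meas mB muB aE) absP specE mE.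
rewrite (log_integral_eq hX (pert_op_trace hX htree hg hdom hrng u_meas u_le)
  (sumr_ge0 _ (fun i _ => c_ge0 i)) rho_lt1 (pert_op_bound hX hdom u_meas c_ge0 u_le)
  (fun x => F0_gt0 _) (fun x => F0_le _) (full_op_star hdom hrng F0_bounded u_meas u_le)
  M0 m1 mlt mgt mom).
pose G x := lne (Num.sqrt (sqnorm (F0 x)))%:E.
have mG : measurable_fun setT G.
  by apply: measurable_lne; apply: (measurableT_comp measurable_sqrt); exact: measurable_sqnorm.
have mf0 : measurable_fun setT (fun x => lne (Normc.normc (f i0 x))%:E).
  apply: measurable_lne; rewrite (_ : (fun _ => _) = fun x => Num.sqrt (sqnorm (f i0 x))).
    by apply: (measurableT_comp measurable_sqrt); exact: measurable_sqnorm.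
  by apply/funext => x; case: (f i0 x).
(* The weight of [a] is [|F0|^2] composed with [g_{i0}]; invariance of [mu] removes the translation,
   and [F0] agrees with [f_{i0}] off [B]. *)
transitivity (\int[mu]_x G x)%E.
  exact: (integral_letter (Lam := Lam) (l := (g i0, true)) hdom hrng mG).
apply: ae_eq_integral => //.
exists B; split => // x /= nx; apply: contrapT => Bx; apply: nx => _.
rewrite /G /F0 ifF; last by apply/negP => /set_mem.
by case: (f i0 x).
Qed.
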